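(* Let $\ell$ be an NMC intensity and let $x\le y$ be integers. Then the duality formula $$E^{xy}_\ell\big(\mathcal{D}_u\Phi\big)=E^{xy}_\ell\Big(\Phi\int_{[0,1]}\big[\dot u(t)+\Xi_\ell(t,X_{t^-})u(t)\big]\,dX_t\Big)$$ holds for all $\Phi\in\mathcal{S}$ and all $u\in\mathcal{U}$, where $E^{xy}_\ell$ denotes expectation under the bridge $R^{xy}_\ell$.
   Context: Path space: $\Omega$ is the set of all càdlàg step functions $\omega:[0,1]\to\mathbb{Z}$ with initial value in $\mathbb{Z}$ and finitely many jumps, all of amplitude $+1$, occurring at instants $0<t_1<\cdots<t_n<1$ (where $n=\omega_1-\omega_0$). Set $t_i=1$ for $i>n$ and $T_i(\omega):=t_i$ for all $i\ge1$. $X=(X_t)_{0\le t\le 1}$ is the canonical process, $\Omega$ carries the $\sigma$-field generated by $X$, and $\mathcal{P}(\Omega)$ is the set of probability measures on $\Omega$. Integrals against $X$ are $\int_{[0,1]}f(t,X_{t^-})\,dX_t=\sum_{i:T_i<1}f(T_i,X_{T_i^-})$. NMC (nice Markov counting) intensity: a function $\ell:[0,1]\times\mathbb{Z}\to(0,\infty)$, bounded above by some constant, with $t\mapsto\ell(t,z)$ in $\mathcal{C}^1([0,1])$ for each $z\in\mathbb{Z}$. For $x\in\mathbb{Z}$, $R^x_\ell\in\mathcal{P}(\Omega)$ is the law of the counting process starting from $x$ with intensity $\ell$, i.e. $X_0=x$ a.s. and $X_t-X_0-\int_0^t\ell(s,X_{s^-})\,ds$ is a local martingale. For integers $x\le y$,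 the bridge is $R^{xy}_\ell:=R^x_\ell(\cdot\mid X_1=y)$. Reciprocal invariant: $\Xi_\ell(t,z):=\partial_t\log\ell(t,z)+\ell(t,z+1)-\ell(t,z)$. Perturbation functions: $\mathcal{U}$ is the set of $\mathcal{C}^1$ functions $u:[0,1]\to\mathbb{R}$ with $u(0)=u(1)=0$; $\dot u$ is the derivative of $u$. Derivative: for $u\in\mathcal{U}$ and small $\varepsilon>0$, $\theta^\varepsilon_u(t):=t+\varepsilon u(t)$ is a change of time of $[0,1]$, and $\Theta^\varepsilon_u(\omega):=\omega\circ\theta^\varepsilon_u$. For measurable $\Phi:\Omega\to\mathbb{R}$, $\mathcal{D}_u\Phi:=\lim_{\varepsilon\to0}\frac1\varepsilon(\Phi\circ\Theta^\varepsilon_u-\Phi)$ whenever the limit exists. Simple functions: $\mathcal{S}$ is the set of $\Phi=\varphi(X_0;T_1,\dots,T_m)$ for some $m\ge1$ and some $\varphi:\mathbb{Z}\times[0,1]^m\to\mathbb{R}$ such that $\varphi(x;\cdot)$ is $\mathcal{C}^\infty$ for every $x\in\mathbb{Z}$. For such $\Phi$ the derivative exists and $\mathcal{D}_u\Phi=-\sum_{j=1}^m\partial_{t_j}\varphi(X_0;T_1,\dots,T_m)\,u(T_j)$. *)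

(* Defs.v *)
From HB Require Import structures.
From mathcomp Require Import all_boot all_order all_algebra.
From mathcomp Require Import all_classical all_reals all_analysis.
Set Implicit Arguments.
Unset Strict Implicit.
Unset Printing Implicit Defensive.
Import Order.TTheory GRing.Theory Num.Theory.
Import numFieldNormedType.Exports.
Local Open Scope classical_set_scope.
Local Open Scope ring_scope.

(* Functions on [0,1] are represented by functions on [R]; only their values on
   [0,1] are ever used.  The derivative is the limit of difference quotients
   inside [0,1], hence one-sided at 0 and at 1. *)
Definition dquot01 (R : realType) (f : R -> R) (t : R) : set_system R :=
  (f s - f t) / (s - t) @[s --> within `[0, 1] t^'].

Definition derivable01 (R : realType) (f : R -> R) (t : R) : Prop :=
  cvg (dquot01 f t).

Definition deriv01 (R : realType) (f : R -> R) (t : R) : R :=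
  lim (dquot01 f t).

Definition C1_01 (R : realType) (f : R -> R) : Prop :=
  (forall t, 0 <= t <= 1 -> derivable01 f t) /\
  {within `[0, 1], continuous (deriv01 f)}.

Definition cube (R : realType) (m : nat) : set 'rV[R]_m :=
  [set v | forall i, 0 <= v 0 i <= 1].
Arguments cube : clear implicits.

Definition along (R : realType) (m : nat) (f : 'rV[R]_m -> R) (i : 'I_m)
    (v : 'rV[R]_m) : R -> R :=
  fun s => f (\row_j (if j == i then s else v 0 j)).

Fixpoint Ck_cube (R : realType) (m k : nat) (f : 'rV[R]_m -> R) : Prop :=
  {within cube R m, continuous f} /\
  (if k is k'.+1 then
     forall i : 'I_m,
       (forall v, cube R m v -> derivable01 (along f i v) (v 0 i)) /\
       Ck_cube k' (fun v => deriv01 (along f i v) (v 0 i))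
   else True).

Definition Cinfty_cube (R : realType) (m : nat) (f : 'rV[R]_m -> R) : Prop :=
  forall k, Ck_cube k f.

(* A path on [0,1] is represented by its extension to [R] that is constant on
   ]-oo, 0] and on [1, +oo[.  The list [s] consists of the jump instants. *)
Definition has_jumps (R : realType) (f : R -> int) (s : seq R) : Prop :=
  [/\ sorted <%R s, all (fun r => 0 < r < 1) s &
      forall t, f t = f 0 + (count (fun r => r <= t) s)%:Z].

Record path_space (R : realType) := Path {
  traj :> R -> int;
  trajP : exists s, has_jumps traj s }.

Lemma const_path_subproof (R : realType) :
  exists s : seq R, has_jumps (fun=> 0) s.
Proof. by exists [::]; split. Qed.

HB.instance Definition _ (R : realType) := gen_eqMixin (path_space R).
HB.instance Definition _ (R : realType) := gen_choiceMixin (path_space R).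
HB.instance Definition _ (R : realType) :=
  isPointed.Build (path_space R) (Path (const_path_subproof R)).

Definition gen_upto (R : realType) (t : R) : set (set (path_space R)) :=
  [set A | exists (s : R) (B : set int),
     0 <= s <= t /\ A = [set w : path_space R | B (w s)]].

Definition Omega (R : realType) := g_sigma_algebraType (@gen_upto R 1).

Definition X (R : realType) (t : R) (w : Omega R) : int := traj w t.

Definition Xminus (R : realType) (t : R) (w : Omega R) : int :=
  xget 0 [set z | \forall s \near t^'-, X s w = z].

Definition jumps (R : realType) (w : Omega R) : seq R := sval (cid (trajP w)).

(* Indices start at 0: [jumpT i] is the (i+1)-st jump instant. *)
Definition jumpT (R : realType) (i : nat) (w : Omega R) : R :=
  nth 1 (jumps w) i.

Definition intX (R : realType) (f : R -> int -> R) (w : Omega R) : R :=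
  \sum_(t <- jumps w) f t (Xminus t w).

Definition Filt (R : realType) (t : R) : set (set (Omega R)) :=
  <<s @gen_upto R t >>.

Definition adapted (R : realType) (M : R -> Omega R -> R) : Prop :=
  forall (t : R) (B : set R), 0 <= t <= 1 -> measurable B ->
    Filt t (M t @^-1` B).

Definition martingale (R : realType) (P : probability (Omega R) R)
    (M : R -> Omega R -> R) : Prop :=
  [/\ adapted M,
      forall t, 0 <= t <= 1 -> P.-integrable setT (EFin \o M t) &
      forall (s t : R) (A : set (Omega R)),
        0 <= s -> s <= t -> t <= 1 -> Filt s A ->
        (\int[P]_(w in A) (M t w)%:E = \int[P]_(w in A) (M s w)%:E)%E].

Definition stopping_time (R : realType) (tau : Omega R -> R) : Prop :=
  (forall w, 0 <= tau w <= 1) /\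
  (forall t, 0 <= t <= 1 -> Filt t [set w | tau w <= t]).

(* On the closed time interval [0,1], a sequence of stopping times is
   localizing when it is nondecreasing and almost surely eventually equal
   to 1. *)
Definition local_martingale (R : realType) (P : probability (Omega R) R)
    (M : R -> Omega R -> R) : Prop :=
  exists tau : nat -> Omega R -> R,
    [/\ forall n, stopping_time (tau n),
        forall n w, tau n w <= tau n.+1 w,
        {ae P, forall w, exists n, tau n w = 1} &
        forall n, martingale P (fun t w => M (Num.min t (tau n w)) w)].

Definition NMC (R : realType) (l : R -> int -> R) : Prop :=
  [/\ forall t z, 0 <= t <= 1 -> 0 < l t z,
      exists C, forall t z, 0 <= t <= 1 -> l t z <= C &
      forall z, C1_01 (l ^~ z)].

Definition compensated (R : realType) (l : R -> int -> R) (t : R)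
    (w : Omega R) : R :=
  (X t w - X 0 w)%:~R -
  \int[lebesgue_measure]_(s in `[0, t]) l s (Xminus s w).

Definition counting_law (R : realType) (l : R -> int -> R) (x : int)
    (P : probability (Omega R) R) : Prop :=
  {ae P, forall w, X 0 w = x} /\ local_martingale P (compensated l).

Definition final_at (R : realType) (y : int) : set (Omega R) :=
  [set w | X 1 w = y].
Arguments final_at : clear implicits.

Lemma measurable_final_at (R : realType) (y : int) :
  measurable (final_at R y).
Proof.
apply: sub_sigma_algebra; exists 1, [set y]; split=> //.
by rewrite ler01 lexx.
Qed.

(* P(. | X_1 = y); [mnormalize] returns its second argument only when
   P(X_1 = y) = 0. *)
Definition bridge (R : realType) (P : probability (Omega R) R) (y : int)
    : probability (Omega R) R :=
  mnormalize (mrestr P (measurable_final_at y)) P.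

Definition Xi (R : realType) (l : R -> int -> R) (t : R) (z : int) : R :=
  deriv01 (fun s => ln (l s z)) t + l t (z + 1) - l t z.

Definition perturbation (R : realType) (u : R -> R) : Prop :=
  [/\ C1_01 u, u 0 = 0 & u 1 = 0].

Definition theta (R : realType) (u : R -> R) (e t : R) : R := t + e * u t.

(* The path which on [0,1] equals [w \o theta u e].  For a perturbation [u] and
   small e > 0 it exists and is unique; otherwise the value is irrelevant. *)
Definition Theta (R : realType) (u : R -> R) (e : R) (w : Omega R) : Omega R :=
  xget w [set w' : Omega R |
            forall t, 0 <= t <= 1 -> X t w' = X (theta u e t) w].

Definition DTheta (R : realType) (u : R -> R) (Phi : Omega R -> R) (w : Omega R)
    : R :=
  lim (e^-1 * (Phi (Theta u e w) - Phi w) @[e --> 0^'+]).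

Definition simple_functional (R : realType) (Phi : Omega R -> R) : Prop :=
  exists (m : nat) (phi : int -> 'rV[R]_m -> R),
    [/\ (0 < m)%N, forall z, Cinfty_cube (phi z) &
        forall w, Phi w = phi (X 0 w) (\row_(i < m) jumpT i w)].

(* Main.v *)
Require Import Defs.
From HB Require Import structures.
From mathcomp Require Import all_boot all_order all_algebra.
From mathcomp Require Import all_classical all_reals all_analysis.
From mathcomp Require Import measurable_realfun ring lra.
Import Order.TTheory GRing.Theory Num.Theory.
Import numFieldNormedType.Exports.
Local Open Scope classical_set_scope.
Local Open Scope ring_scope.
Set Implicit Arguments.
Unset Strict Implicit.
Unset Printing Implicit Defensive.

(** On the event X_1 = x + n the law of the counting process is explicit: the
    n jump instants have, on the simplex 0 < t_1 < ... < t_n < 1, a density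
    proportional to the product of the a_{x+i-1}(t_i), where
    a_z(t) = l(t,z) exp(Lambda_{z+1}(t) - Lambda_z(t)) and Lambda_z is a
    primitive of l(.,z).  These weights are [weight], and their logarithmic
    derivative is the reciprocal invariant Xi(.,z) ([Xi_weight]).  A time change
    theta = id + e u acts on each coordinate separately and preserves the
    simplex.  The substitution t_i = theta(s_i) ([simplex_int_change]) therefore
    turns the integral of Phi o Theta into that of Phi multiplied by the product
    of the a_z(theta s_i) theta'(s_i) / a_z(s_i) ([simplex_girsanov]).  Subtract
    Phi, divide by e and let e tend to 0: one side tends to D_u Phi, the other
    to Phi times the sum of u' + Xi u over the jumps, and both difference
    quotients stay bounded because the number of jumps is n.  Dominated
    convergence gives the duality formula for the restriction to the event
    ([limits_mean_zero]), and conditioning only divides by its probability, which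
    is positive ([final_at_gt0]).

    The law of the jump instants has to be extracted from the martingale
    property ([jump_law]).  Fix a functional F of n instants.  The candidate for
    the conditional expectation of F, given k jumps before t, is an iterated
    integral over the instants to come ([backward]); as a function of t it
    solves the backward equation ([is_derive_backward]).  Hence, along a path, it
    grows by the integral, against the compensated process, of its change at a
    jump.  This integral is approximated on the grid of the j/(N+1): for each
    path the Riemann sums converge to the increment ([grid_sum_cvg]), and each
    has mean zero, since the integrand at a grid point depends on finitely many
    integers already observed ([mean_zero_grid_integrand]).  The sums are
    dominated by the number of jumps, which is integrable by Fatou's lemma
    ([integrable_growth]); so the backward value has the same mean at time 1, where
    it is F on n jumps, as at time 0, where it is the integral of F over the
    simplex, both up to a constant factor. *)

(** * Calculus on the unit interval *)

Section Calculus.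
Context {R : realType}.
Implicit Types (f g h : R -> R) (s t : R).

(** Functions are given only on [0,1]. Composition with [clamp] extends them to
    the line, so that continuity and integration need no side condition. *)
Definition clamp t : R := Num.max 0 (Num.min 1 t).

Lemma clamp_in t : 0 <= clamp t <= 1.
Proof. by rewrite /clamp le_max lexx /= ge_max ler01 ge_min lexx. Qed.

Lemma in01_0 : 0 <= (0 : R) <= 1.
Proof. by rewrite lexx ler01. Qed.

Lemma in01_1 : 0 <= (1 : R) <= 1.
Proof. by rewrite lexx ler01. Qed.

Lemma clamp_itv t : clamp t \in `[0, 1].
Proof. by rewrite in_itv /=; exact: clamp_in. Qed.

Lemma clamp_id t : 0 <= t <= 1 -> clamp t = t.
Proof. by move=> /andP[t0 t1]; rewrite /clamp (min_idPr t1) (max_idPr t0). Qed.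

Lemma clampK t : clamp (clamp t) = clamp t.
Proof. exact/clamp_id/clamp_in. Qed.

Lemma clampP t : [\/ t <= 0 /\ clamp t = 0, 1 <= t /\ clamp t = 1 |
  0 <= t <= 1 /\ clamp t = t].
Proof.
have [t0|t0] := lerP t 0; last have [t1|t1] := lerP 1 t.
- apply: Or31; split=> //.
  by rewrite /clamp min_r ?(le_trans t0)// max_l.
- by apply: Or32; split=> //; rewrite /clamp min_l// max_r.
- by apply: Or33; rewrite clamp_id (ltW t0) (ltW t1).
Qed.

Lemma clamp_dist s t : `|clamp s - clamp t| <= `|s - t|.
Proof.
have [[? ->]|[? ->]|[/andP[? ?] ->]] := clampP s;
have [[? ->]|[? ->]|[/andP[? ?] ->]] := clampP t;
rewrite ?subrr ?normr0//; have [?|?] := ger0P (s - t);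
rewrite ler_norml; apply/andP; split; lra.
Qed.

Lemma clamp_continuous : continuous clamp.
Proof.
move=> t; apply/cvgrPdist_lt => e e0; near=> s.
apply: (le_lt_trans (clamp_dist _ _)); near: s.
exact: cvgr_dist_lt.
Unshelve. all: by end_near. Qed.

(** Turns continuity relative to a set into convergence along a filter, the form
    in which the derivatives of the data, continuous only on [0,1], are used. *)
Lemma within_cvg {T U : topologicalType} (A : set T) (f : T -> U) (x : T) :
  {within A, continuous f} -> A x -> f @ (within A (nbhs x)) --> f x.
Proof.
by move=> cf Ax; have := cf x; rewrite /prop_for /continuous_at nbhs_subspace_in.
Qed.

Lemma comp_clamp_continuous f :
  {within `[0, 1], continuous f} -> continuous (f \o clamp).
Proof.
move=> cf t.
have H : clamp @ t --> within `[0, 1] (nbhs (clamp t)).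
  move=> V; rewrite /within nbhs_simpl => HV.
  have := @clamp_continuous t _ HV; rewrite nbhs_simpl /=.
  apply: filterS => s /=; apply.
  exact: (clamp_itv s).
exact: (cvg_comp _ _ H (within_cvg cf (clamp_itv t))).
Qed.

Lemma deriv01_cvg f t : derivable01 f t -> dquot01 f t --> deriv01 f t.
Proof. by []. Qed.

Lemma is_derive01 f t : 0 < t < 1 -> derivable01 f t ->
  is_derive t 1 f (deriv01 f t).
Proof.
move=> t01 /deriv01_cvg df.
suff H : h^-1 *: (f (h *: 1 + t) - f t) @[h --> 0^'] --> deriv01 f t.
  apply: DeriveDef; last exact/cvg_lim.
  by apply/cvg_ex; exists (deriv01 f t).
apply/cvgrPdist_lt => e e0.
have /cvgrPdist_lt/(_ e e0) := df.
move=> H.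
have [d /= d0 Hd] := H.
have [a0 b0] : 0 < t /\ 0 < 1 - t by move/andP: t01 => [? ?]; lra.
near=> h.
have hd : `|h| < d by near: h; apply/dnbhs0_lt.
have ht : `|h| < t by near: h; apply/dnbhs0_lt.
have ht' : `|h| < 1 - t by near: h; apply/dnbhs0_lt.
have h0 : h != 0 by near: h; exact: nbhs_dnbhs_neq.
have -> : h^-1 *: (f (h *: 1 + t) - f t) = (f (h + t) - f t) / ((h + t) - t).
  by rewrite addrK /GRing.scale /= mulr1 mulrC.
move/ltr_normlP: ht => [? ?]; move/ltr_normlP: ht' => [? ?].
apply: Hd => /=.
- by rewrite opprD addrCA subrr addr0 normrN.
- by rewrite -subr_eq0 addrK.
- by rewrite in_itv /=; apply/andP; split; lra.
Unshelve. all: by end_near. Qed.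

End Calculus.

Section CalculusGlobal.
Context {R : realType}.
Implicit Types (f g h : R -> R) (s t : R).

Definition unif_cont f := forall e : R, 0 < e ->
  exists2 d : R, 0 < d & forall s t, `|s - t| < d -> `|f s - f t| < e.

Lemma dist_near_cvg f t : (forall e : R, 0 < e ->
  exists2 d : R, 0 < d & forall s, `|s - t| < d -> `|f s - f t| < e) ->
  {for t, continuous f}.
Proof.
move=> H; apply/cvgrPdist_lt => e /H[d d0 Hd]; near=> s.
by rewrite distrC; apply: Hd; near: s; apply: cvgr_distC_lt.
Unshelve. all: by end_near. Qed.

Lemma continuous_dist f t : {for t, continuous f} -> forall e : R, 0 < e ->
  exists2 d : R, 0 < d & forall s, `|s - t| < d -> `|f s - f t| < e.
Proof.
move=> /cvgrPdist_lt H e /H [d /= d0 Hd]; exists d => // s st.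
by rewrite distrC; apply: Hd; rewrite /= distrC.
Qed.

Lemma unif_cont_continuous f : unif_cont f -> continuous f.
Proof.
move=> ucf t; apply: dist_near_cvg => e /ucf[d d0 Hd]; exists d => // s.
exact: Hd.
Qed.

Lemma lip_unif_cont f B : (forall s t, `|f s - f t| <= B * `|s - t|) -> unif_cont f.
Proof.
move=> H e e0; exists (e / (`|B| + 1)).
  by rewrite divr_gt0// ltr_wpDl.
move=> s t; rewrite ltr_pdivlMr ?ltr_wpDl// => st.
apply: le_lt_trans st; apply: (le_trans (H s t)).
rewrite mulrC ler_wpM2l// (le_trans (ler_norm _))// lerDl//.
Qed.

(** Each point of [0,1] has its own modulus of continuity; compactness, in the
    form of near-coverings, makes a single one work for all. *)
Lemma heine01 f : {within `[0, 1], continuous f} -> unif_cont (f \o clamp).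
Proof.
move=> /comp_clamp_continuous; set g := f \o clamp => cg e e0.
have gE s : g s = g (clamp s) by rewrite /g /= clampK.
have /compact_near_coveringP := @segment_compact R 0 1.
move=> /(_ _ (0^'+) (fun d x => forall s, `|s - x| < d -> `|g s - g x| < e) _).
case.
- move=> x _.
  have [d d0 Hd] := continuous_dist (cg x) (divr_gt0 e0 (ltr0Sn _ 1)).
  near=> y r => s /= sy.
  have yx : `|y - x| < d / 2.
    by near: y; apply: cvgr_distC_lt => //; rewrite divr_gt0.
  have rd : r <= d / 2 by near: r; apply: nbhs_right_le; rewrite divr_gt0.
  have sx : `|s - x| < d.
    rewrite (_ : s - x = (s - y) + (y - x)); last by ring.
    by apply: (le_lt_trans (ler_normD _ _)); lra.
  rewrite (_ : g s - g y = (g s - g x) - (g y - g x)); last by ring.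
  have := Hd _ sx; have : `|y - x| < d by lra.
  move=> /Hd ? ?; apply: (le_lt_trans (ler_normB _ _)); lra.
- move=> d /= d0 Hd; exists (d / 2); first by rewrite divr_gt0.
  move=> s t st; rewrite (gE s) (gE t); apply: (Hd (d / 2)) => //.
  + rewrite /= sub0r normrN gtr0_norm ?divr_gt0//; lra.
  + by rewrite divr_gt0.
  + exact: (clamp_itv t).
  + exact: le_lt_trans (clamp_dist _ _) st.
Unshelve. all: by end_near. Qed.

Lemma bounded01 f : {within `[0, 1], continuous f} ->
  exists2 B : R, 0 < B & forall t, 0 <= t <= 1 -> `|f t| <= B.
Proof.
move=> cf.
have [B _ HB] := EVT_max (ler01 : (0:R) <= 1)
  (continuous_subspaceT (fun t => cvg_norm (comp_clamp_continuous cf (x := t)))).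
exists (`|f (clamp B)| + 1); first by rewrite ltr_wpDl.
move=> t t01; have := HB t; rewrite in_itv /= (clamp_id t01) => /(_ t01) H.
by rewrite (le_trans H)// lerDl.
Qed.

Lemma derivable01P f t : derivable01 f t -> forall e : R, 0 < e ->
  exists2 d : R, 0 < d & forall s, 0 <= s <= 1 -> `|s - t| < d ->
    `|f s - f t - deriv01 f t * (s - t)| <= e * `|s - t|.
Proof.
move=> /deriv01_cvg/cvgrPdist_le df e e0.
have H := df e e0.
have [d /= d0 Hd] := H; exists d => // s s01 st.
have [->|st0] := eqVneq s t; first by rewrite !subrr mulr0 subr0 normr0 mulr0.
have st1 : s - t != 0 by rewrite subr_eq0.
have := Hd s; rewrite /= distrC => /(_ st st0); rewrite in_itv => /(_ s01).
rewrite -(ler_pM2r (_ : 0 < `|s - t|)) ?normr_gt0//.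
by rewrite -normrM mulrBl divfK// distrC.
Qed.

Lemma derivable01_clamp_continuous f :
  (forall t, 0 <= t <= 1 -> derivable01 f t) -> continuous (f \o clamp).
Proof.
move=> df t; apply: dist_near_cvg => e e0 /=.
have [d d0 Hd] := derivable01P (df _ (clamp_in t)) ltr01.
set L := deriv01 f (clamp t) in Hd.
have L1 : 0 < `|L| + 1 by rewrite ltr_wpDl.
exists (Num.min d (e / (`|L| + 1))); first by rewrite lt_min d0 divr_gt0.
move=> s; rewrite lt_min => /andP[sd se].
have sd' : `|clamp s - clamp t| < d by exact: le_lt_trans (clamp_dist _ _) sd.
have se' := le_lt_trans (clamp_dist _ _) se.
have := Hd _ (clamp_in s) sd'.
rewrite ltr_pdivlMr// in se'.
move: se'; set x := clamp s - clamp t => se' H.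
rewrite (_ : f _ - _ = (f (clamp s) - f (clamp t) - L * x) + L * x); last by ring.
apply: (le_lt_trans (ler_normD _ _)); rewrite normrM.
rewrite mulrDr mulr1 in se'; rewrite mul1r in H.
rewrite (mulrC `|L|); lra.
Qed.

Lemma clamp_within f : continuous (f \o clamp) -> {within `[0, 1], continuous f}.
Proof.
move=> cf; apply: (subspace_eq_continuous _ (continuous_subspaceT cf)).
by move=> t; rewrite inE /= in_itv /= => t01; rewrite /from_subspace /= clamp_id.
Qed.

(** The mean value theorem without an order between [a] and [b]; the distances
    locate the intermediate point. *)
Lemma MVT01 f df (a b : R) : {within `[0, 1], continuous f} ->
  (forall t, 0 < t < 1 -> is_derive t 1 f (df t)) ->
  0 <= a <= 1 -> 0 <= b <= 1 ->
  exists2 c : R, 0 <= c <= 1 & `|c - a| <= `|b - a| /\ `|c - b| <= `|b - a| /\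
    f b - f a = df c * (b - a).
Proof.
move=> cf df1.
have W a' b' : 0 <= a' <= 1 -> 0 <= b' <= 1 -> a' <= b' ->
   exists2 c : R, a' <= c <= b' & f b' - f a' = df c * (b' - a').
  move=> /andP[a0 a1] /andP[b0 b1] ab.
  have sub : `[a', b'] `<=` `[0, 1].
    by move=> t /=; rewrite !in_itv /= => /andP[? ?]; apply/andP; split; lra.
  have dab t : t \in `]a', b'[ -> is_derive t 1 f (df t).
    rewrite in_itv /= => /andP[? ?]; apply: df1; apply/andP; split; lra.
  have [c cab H] := MVT_segment ab dab (continuous_subspaceW sub cf).
  by exists c.
move=> a01 b01; have [ab|/ltW ba] := leP a b.
  have [c /andP[? ?] H] := W _ _ a01 b01 ab.
  move/andP: a01 => [? ?]; move/andP: b01 => [? ?].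
  exists c; first by apply/andP; split; lra.
  rewrite H; split; last split=> //; first rewrite !ger0_norm; try lra.
  by rewrite distrC !ger0_norm; lra.
have [c /andP[? ?] H] := W _ _ b01 a01 ba.
move/andP: a01 => [? ?]; move/andP: b01 => [? ?].
exists c; first by apply/andP; split; lra.
split; first by rewrite distrC (distrC b) !ger0_norm; lra.
split; first by rewrite (distrC b) !ger0_norm; lra.
by rewrite -opprB H; ring.
Qed.

(** The base point -1 lies to the left of [0,1], which makes [prim h]
    differentiable at 0 as well. *)
Definition prim h t : R := \int[lebesgue_measure]_(s in `[-1, t]) h s.

Lemma is_derive_prim h t : continuous h -> -1 < t -> is_derive t 1 (prim h) (h t).
Proof.
move=> ch t1.
have ih : lebesgue_measure.-integrable `[-1, (t + 1)] (EFin \o h).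
  apply: continuous_compact_integrable; first exact: segment_compact.
  exact: continuous_subspaceT.
have tt : t < t + 1 by rewrite ltrDl.
have [d1 d2] := continuous_FTC1_closed tt ih t1 (ch t).
by rewrite derive1E in d2; apply: DeriveDef.
Qed.

Lemma prim_continuous h : continuous h -> {within `[0, 1], continuous (prim h)}.
Proof.
move=> ch; apply: derivable_within_continuous => t; rewrite in_itv /= => /andP[t0 _].
by have [] := @is_derive_prim h t ch (lt_le_trans (ltrN10 _) t0).
Qed.

End CalculusGlobal.

(** * Functions of finitely many jump instants *)

Section SeqFunctions.
Context {R : realType}.
Implicit Types (F G : seq R -> R) (s t : R) (r : seq R).

Definition near_seq (d : R) r r' := all2 (fun p q : R => `|p - q| < d) r r'.

(** The bounded, uniformly continuous functions of [n] real variables. Lists of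
    length [n] stand for [n]-tuples because fixing the first entry, which is the
    step of every recursion below, is then [cons]. *)
Definition BUC n F :=
  (exists B : R, forall r, size r = n -> `|F r| <= B) /\
  forall e : R, 0 < e -> exists2 d : R, 0 < d &
    forall r r', size r = n -> near_seq d r r' -> `|F r - F r'| < e.

Lemma near_seq_size d r r' : near_seq d r r' -> size r = size r'.
Proof. by rewrite /near_seq all2E => /andP[/eqP]. Qed.

Lemma near_seq_refl d r : 0 < d -> near_seq d r r.
Proof. by move=> d0; elim: r => //= t r ->; rewrite subrr normr0 d0. Qed.

Lemma near_seq_le d d' r r' : d <= d' -> near_seq d r r' -> near_seq d' r r'.
Proof.
by move=> dd; elim: r r' => [|t r IH] [|t' r'] //= /andP[/lt_le_trans -> // /IH].
Qed.

Lemma near_seq_minl d d' r r' : near_seq (Num.min d d') r r' -> near_seq d r r'.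
Proof. by apply: near_seq_le; rewrite ge_min lexx. Qed.

Lemma near_seq_minr d d' r r' : near_seq (Num.min d d') r r' -> near_seq d' r r'.
Proof. by apply: near_seq_le; rewrite ge_min lexx orbT. Qed.

Lemma near_seq_cat d r r' q q' : near_seq d r r' -> near_seq d q q' ->
  near_seq d (r ++ q) (r' ++ q').
Proof.
by elim: r r' => [|t r IH] [|t' r'] //= /andP[-> /IH] H /H.
Qed.

Lemma BUC_ext n F G : (forall r, size r = n -> F r = G r) -> BUC n F -> BUC n G.
Proof.
move=> FG [[B HB] H]; split; first by exists B => r rn; rewrite -FG// HB.
move=> e /H[d d0 Hd]; exists d => // r r' rn rr'.
by rewrite -!FG ?Hd// -(near_seq_size rr').
Qed.

Lemma BUC_cst n (c : R) : BUC n (fun=> c).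
Proof.
split; first by exists `|c|.
by move=> e e0; exists 1 => // r r' _ _; rewrite subrr normr0.
Qed.

Lemma BUC_cat n m F r : size r = m -> BUC (m + n) F ->
  BUC n (fun q => F (r ++ q)).
Proof.
move=> rm [[B HB] H]; split; first by exists B => q qn; rewrite HB// size_cat rm qn.
move=> e /H[d d0 Hd]; exists d => // q q' qn qq'.
apply: Hd; first by rewrite size_cat rm qn.
by apply: near_seq_cat => //; exact: near_seq_refl.
Qed.

Lemma BUC_cons n F t : BUC n.+1 F -> BUC n (fun r => F (t :: r)).
Proof. by move=> H; exact: (@BUC_cat n 1 F [:: t] erefl H). Qed.

Lemma BUC_mul n F G : BUC n F -> BUC n G -> BUC n (fun r => F r * G r).
Proof.
move=> [[B HB] HF] [[C HC] HG]; split.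
  exists (`|B| * `|C|) => r rn; rewrite normrM ler_pM//.
    by rewrite (le_trans (HB r rn))// ler_norm.
  by rewrite (le_trans (HC r rn))// ler_norm.
move=> e e0.
have B1 : 0 < `|B| + 1 by rewrite ltr_wpDl.
have C1 : 0 < `|C| + 1 by rewrite ltr_wpDl.
have [d d0 Hd] := HF (e / 2 / (`|C| + 1)) (divr_gt0 (divr_gt0 e0 (ltr0Sn _ 1)) C1).
have [d' d'0 Hd'] := HG (e / 2 / (`|B| + 1)) (divr_gt0 (divr_gt0 e0 (ltr0Sn _ 1)) B1).
exists (Num.min d d'); first by rewrite lt_min d0.
move=> r r' rn rr'; have r'n : size r' = n by rewrite -(near_seq_size rr').
have h1 := Hd _ _ rn (near_seq_minl rr').
have h2 := Hd' _ _ rn (near_seq_minr rr').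
rewrite ltr_pdivlMr// in h1; rewrite ltr_pdivlMr// in h2.
rewrite (_ : _ - _ = (F r - F r') * G r' + F r * (G r - G r')); last by ring.
apply: (le_lt_trans (ler_normD _ _)); rewrite !normrM.
have k1 : `|F r - F r'| * `|G r'| <= `|F r - F r'| * (`|C| + 1).
  by rewrite ler_wpM2l// (le_trans (HC _ r'n))// (le_trans (ler_norm _))// lerDl.
have k2 : `|F r| * `|G r - G r'| <= `|G r - G r'| * (`|B| + 1).
  by rewrite mulrC ler_wpM2l// (le_trans (HB _ rn))// (le_trans (ler_norm _))// lerDl.
lra.
Qed.

Lemma BUC_sub n F G : BUC n F -> BUC n G -> BUC n (fun r => F r - G r).
Proof.
move=> [[B HB] HF] [[C HC] HG]; split.
  exists (B + C) => r rn; rewrite (le_trans (ler_normB _ _))// lerD//.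
    exact: HB.
  exact: HC.
move=> e e0.
have [d d0 Hd] := HF (e / 2) (divr_gt0 e0 (ltr0Sn _ 1)).
have [d' d'0 Hd'] := HG (e / 2) (divr_gt0 e0 (ltr0Sn _ 1)).
exists (Num.min d d'); first by rewrite lt_min d0.
move=> r r' rn rr'.
have h1 := Hd _ _ rn (near_seq_minl rr').
have h2 := Hd' _ _ rn (near_seq_minr rr').
rewrite (_ : _ - _ - _ = (F r - F r') - (G r - G r')); last by ring.
apply: (le_lt_trans (ler_normB _ _)); lra.
Qed.

Lemma BUC_map n F (th : R -> R) : unif_cont th -> BUC n F ->
  BUC n (fun r => F (map th r)).
Proof.
move=> uth [[B HB] H]; split; first by exists B => r rn; rewrite HB ?size_map.
move=> e /H[d d0 Hd]; have [d' d'0 Hd'] := uth d d0; exists d' => // r r' rn rr'.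
apply: Hd; first by rewrite size_map.
elim: r r' {rn} rr' => [|t r IH] [|t' r'] //= /andP[tt' /IH].
by rewrite /near_seq /= => ->; rewrite Hd'.
Qed.

Lemma BUC_comp_tail n F (g : R -> R) : unif_cont g -> (exists B : R, forall t, `|g t| <= B) ->
  BUC n F -> BUC n.+1 (fun r => g (head 0 r) * F (behead r)).
Proof.
move=> ug [B HB] HF; apply: BUC_mul; split.
- by exists B.
- move=> e /ug[d d0 Hd]; exists d => // -[|t r] [|t' r'] //= _ /andP[tt' _].
  exact: Hd.
- by have [[C HC] _] := HF; exists C => -[|t r]//= [/HC].
- move=> e e0; have [_ /(_ e e0)[d d0 Hd]] := HF.
  by exists d => // -[|t r] [|t' r'] //= [rn] /andP[_]; exact: Hd.
Qed.

(** The [i]-th entry of the list, counted from 0, is the instant of a jump from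
    the state [z + i]; hence the shift of [z] in the recursive call. *)
Fixpoint jump_prod (b : int -> R -> R) z r : R :=
  if r is t :: r' then b z t * jump_prod b (z + 1) r' else 1.

(** The additive counterpart of [jump_prod]: the integral of [f] against a path
    started at [z], see [intX_jump_sum]. *)
Fixpoint jump_sum (f : R -> int -> R) z r : R :=
  if r is t :: r' then f t z + jump_sum f (z + 1) r' else 0.

Lemma BUC_jump_prod n b z : (forall z, unif_cont (b z)) ->
  (forall z, exists B : R, forall t, `|b z t| <= B) -> BUC n (jump_prod b z).
Proof.
move=> ub bb; elim: n z => [|n IH] z.
  by apply: (@BUC_ext _ (fun=> 1)); [case|exact: BUC_cst].
apply: BUC_ext (BUC_comp_tail (ub z) (bb z) (IH (z + 1))).
by case.
Qed.

End SeqFunctions.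

(** * Iterated integrals over the simplex of jump instants *)

Section Simplex.
Context {R : realType}.
Implicit Types (h : R -> R) (F G : seq R -> R) (s t : R) (r : seq R) (m : nat) (z : int).

Section Weight.
Variable a : int -> R -> R.
Hypothesis ca : forall z, continuous (a z).
Hypothesis ba : forall z, exists B : R, forall t, `|a z t| <= B.

(** The integral of F(t_1,...,t_m) a_z(t_1) a_{z+1}(t_2) ... a_{z+m-1}(t_m) over
    s < t_1 < ... < t_m < 1, with t_1 as the outermost variable. Writing it with
    primitives makes it differentiable in [s] by construction. *)
Fixpoint simplex_int m z F s : R :=
  if m is m'.+1 then
    let h t := a z t * simplex_int m' (z + 1) (fun r => F (t :: r)) (clamp t) in
    prim h 1 - prim h s
  else F [::].
Local Notation J := simplex_int.

Definition simplex_integrand m z F t : R :=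
  a z t * J m (z + 1) (fun r => F (t :: r)) (clamp t).

Lemma simplex_intS m z F s :
  J m.+1 z F s = prim (simplex_integrand m z F) 1 - prim (simplex_integrand m z F) s.
Proof. by []. Qed.

Lemma simplex_int_ext m z F G s : (forall r, size r = m -> F r = G r) ->
  J m z F s = J m z G s.
Proof.
elim: m z F G s => [|m IH] z F G s FG; first exact: FG.
rewrite !simplex_intS (_ : simplex_integrand m z F = simplex_integrand m z G)//.
apply/funext => t; rewrite /simplex_integrand; congr (_ * _); apply: IH => r rm.
by rewrite FG//= rm.
Qed.

(** The mean value theorem for the difference of the two primitives. *)
Lemma prim_dist (h h' : R -> R) (e s : R) : continuous h -> continuous h' -> 0 <= s <= 1 ->
  (forall t, 0 <= t <= 1 -> `|h t - h' t| <= e) ->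
  `|(prim h 1 - prim h s) - (prim h' 1 - prim h' s)| <= e * `|1 - s|.
Proof.
move=> ch ch' s01 hh'.
have cK : {within `[0, 1], continuous (fun t => prim h t - prim h' t)}.
  by apply: within_continuousB; exact: prim_continuous.
have dK t : 0 < t < 1 ->
    is_derive t 1 (fun t => prim h t - prim h' t) (h t - h' t).
  move=> /andP[t0 _]; have t1 : -1 < t by exact: lt_trans t0.
  have := is_deriveB (is_derive_prim ch t1) (is_derive_prim ch' t1).
  exact.
have [c c01 [_ [_ H]]] := MVT01 cK dK s01 in01_1.
rewrite (_ : _ - _ - _ = (prim h 1 - prim h' 1) - (prim h s - prim h' s)); last by ring.
by rewrite H normrM ler_wpM2r// hh'.
Qed.

(** The two regularity properties have to be proved together: the integrand of
    the outermost variable in dimension [m + 1] is continuous because the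
    integral in dimension [m] is both Lipschitz in the function (for the sup
    norm) and continuous in the lower bound. *)
Definition simplex_reg m z :=
  (exists D : R, 0 < D /\ forall F G (e s : R), BUC m F -> BUC m G -> 0 <= s <= 1 ->
     (forall r, size r = m -> `|F r - G r| <= e) ->
     `|J m z F s - J m z G s| <= D * e) /\
  (forall F, BUC m F -> continuous (J m z F \o clamp)).

Lemma simplex_integrand_continuous_of m z F : simplex_reg m (z + 1) ->
  BUC m.+1 F -> continuous (simplex_integrand m z F).
Proof.
move=> [[D [D0 HD]] cJ] HF t; apply: cvgM; first exact: ca.
apply: (@dist_near_cvg _ (fun t => J m (z + 1) (fun r => F (t :: r)) (clamp t))).
move=> e e0; have e2 : 0 < e / 2 by rewrite divr_gt0.
have [d d0 Hd] := continuous_dist (cJ _ (BUC_cons t HF) t) e2.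
have [_ /(_ (e / 2 / D) (divr_gt0 e2 D0)) [d' d'0 Hd']] := HF.
exists (Num.min d d'); first by rewrite lt_min d0.
move=> s; rewrite lt_min => /andP[sd sd'].
have h1 := Hd _ sd; rewrite /= in h1.
have h2 : `|J m (z + 1) (fun r => F (s :: r)) (clamp s) -
    J m (z + 1) (fun r => F (t :: r)) (clamp s)| <= D * (e / 2 / D).
  apply: HD; rewrite ?clamp_in//; do ?exact: BUC_cons.
  move=> r rm; apply/ltW/Hd'; first by rewrite /= rm.
  by apply/andP; split; last exact: near_seq_refl.
rewrite mulrCA divff ?gt_eqF// mulr1 in h2.
rewrite (_ : _ - _ = (J m (z + 1) (fun r => F (s :: r)) (clamp s) -
    J m (z + 1) (fun r => F (t :: r)) (clamp s)) +
   (J m (z + 1) (fun r => F (t :: r)) (clamp s) -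
    J m (z + 1) (fun r => F (t :: r)) (clamp t))); last by ring.
apply: (le_lt_trans (ler_normD _ _)); lra.
Qed.

Lemma simplex_regP m z : simplex_reg m z.
Proof.
elim: m z => [|m IH] z.
  split; first by exists 1; split=> // F G e s _ _ _ H; rewrite mul1r H.
  by move=> F _; exact: cst_continuous.
have [[D [D0 HD]] cJ] := IH (z + 1).
have [B HB] := ba z.
have B1 : 0 < `|B| + 1 by rewrite ltr_wpDl.
have ch F : BUC m.+1 F -> continuous (simplex_integrand m z F).
  exact: simplex_integrand_continuous_of (IH (z + 1)).
split.
- exists ((`|B| + 1) * D); split; first by rewrite mulr_gt0.
  move=> F G e s HF HG s01 FG; rewrite !simplex_intS.
  apply: le_trans (prim_dist (ch _ HF) (ch _ HG) s01 (_ : forall t, 0 <= t <= 1 ->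
    _ <= (`|B| + 1) * D * e)) _.
    move=> t t01; rewrite /simplex_integrand -mulrBr normrM -mulrA ler_pM//.
      by rewrite (le_trans (HB t))// (le_trans (ler_norm _))// lerDl.
    apply: HD; rewrite ?clamp_in//; do ?exact: BUC_cons.
    by move=> r rm; apply: FG; rewrite /= rm.
  have [B0 _] := HF.
  have e0 : 0 <= e by have := FG (nseq m.+1 0) (size_nseq _ _); apply: le_trans.
  rewrite ler_piMr ?mulr_ge0 ?(ltW D0) ?(ltW B1)//.
  by move/andP: s01 => [? ?]; rewrite ger0_norm; lra.
- move=> F HF; apply: comp_clamp_continuous.
  apply: within_continuousB; first exact: continuous_subspaceT (@cst_continuous _ _ _).
  exact: prim_continuous (ch _ HF).
Qed.

Lemma simplex_int_dist m z : exists D : R, 0 < D /\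
  forall F G (e s : R), BUC m F -> BUC m G -> 0 <= s <= 1 ->
     (forall r, size r = m -> `|F r - G r| <= e) ->
     `|J m z F s - J m z G s| <= D * e.
Proof. by have [] := simplex_regP m z. Qed.

Lemma simplex_integrand_continuous m z F : BUC m.+1 F -> continuous (simplex_integrand m z F).
Proof. exact: simplex_integrand_continuous_of (simplex_regP m (z + 1)). Qed.
Arguments simplex_integrand_continuous [m] z [F].

Lemma is_derive_simplex_int m z F s : BUC m.+1 F -> 0 <= s <= 1 ->
  is_derive s 1 (J m.+1 z F) (- (a z s * J m (z + 1) (fun r => F (s :: r)) s)).
Proof.
move=> HF s01; have s1 : -1 < s by move/andP: s01 => [? _]; lra.
have H := is_derive_prim (simplex_integrand_continuous z HF) s1.
have := is_deriveB (is_derive_cst (prim (simplex_integrand m z F) 1) s 1) H.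
by rewrite sub0r /simplex_integrand (clamp_id s01); apply.
Qed.

Arguments is_derive_simplex_int [m] z [F s].

Lemma simplex_int1 m z F : J m.+1 z F 1 = 0.
Proof. by rewrite simplex_intS subrr. Qed.

Lemma simplex_int_continuous m z F : BUC m F -> {within `[0, 1], continuous (J m z F)}.
Proof. by move=> HF; apply: clamp_within; have [_] := simplex_regP m z; apply. Qed.

Arguments simplex_int_continuous [m] z [F].

Lemma simplex_intZ m z F (c s : R) : BUC m F -> 0 <= s <= 1 ->
  J m z (fun r => c * F r) s = c * J m z F s.
Proof.
elim: m z F s => [//|m IH] z F s HF s01; rewrite !simplex_intS.
have -> : simplex_integrand m z (fun r => c * F r) = (fun t => c * simplex_integrand m z F t).
  apply/funext => t; rewrite /simplex_integrand IH ?clamp_in//; first by ring.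
  exact: BUC_cons.
have ch := simplex_integrand_continuous z HF.
have P t : prim (fun t => c * simplex_integrand m z F t) t = c * prim (simplex_integrand m z F) t.
  rewrite /prim RintegralZl//.
  apply: continuous_compact_integrable; first exact: segment_compact.
  exact: continuous_subspaceT.
by rewrite !P; ring.
Qed.

Lemma simplex_int_bound m z : exists D : R, 0 < D /\
  forall F (B s : R), BUC m F -> 0 <= s <= 1 ->
    (forall r, size r = m -> `|F r| <= B) -> `|J m z F s| <= D * B.
Proof.
have [D [D0 H]] := simplex_int_dist m z; exists D; split=> // F B s HF s01 HB.
have := H F (fun=> 0 * 0) B s HF (BUC_cst _ _) s01.
rewrite (_ : J m z (fun=> 0 * 0) s = 0) ?subr0.
  by apply=> r rm; rewrite mul0r subr0 HB.
by rewrite (@simplex_intZ m z (fun=> 0) 0 s (BUC_cst _ _) s01) mul0r.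
Qed.

(** The derivative in [s] is a weight times an integral in one dimension less,
    hence bounded in terms of the bound on the integrand. *)
Lemma simplex_int_lip m z : exists L : R, 0 < L /\
  forall F (B s t : R), BUC m F -> 0 <= s <= 1 -> 0 <= t <= 1 ->
    (forall r, size r = m -> `|F r| <= B) -> `|J m z F s - J m z F t| <= L * B * `|s - t|.
Proof.
case: m => [|m].
  exists 1; split=> // F B s t HF _ _ HB; rewrite subrr normr0 mulr_ge0// mul1r.
  by have := HB [::] erefl; apply: le_trans.
have [D [D0 HD]] := simplex_int_bound m (z + 1); have [A HA] := ba z.
have A1 : 0 < `|A| + 1 by rewrite ltr_wpDl.
exists ((`|A| + 1) * D); split; first by rewrite mulr_gt0.
move=> F B s t HF s01 t01 HB.
have dJ (x : R) : 0 < x < 1 -> is_derive x 1 (J m.+1 z F)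
    (- (a z x * J m (z + 1) (fun r => F (x :: r)) x)).
  by move=> /andP[x0 x1]; apply: is_derive_simplex_int; rewrite ?(ltW x0) ?(ltW x1).
have [c c01 [_ [_ H]]] := MVT01 (simplex_int_continuous z HF) dJ t01 s01.
rewrite H normrM normrN normrM ler_wpM2r// -mulrA ler_pM//.
  by rewrite (le_trans (HA _))// (le_trans (ler_norm _))// lerDl.
by apply: HD => //; [exact: BUC_cons|move=> r rm; rewrite HB//= rm].
Qed.

Lemma simplex_int1_gt0 m z s : (forall z t, 0 < a z t) -> 0 <= s < 1 ->
  0 < J m z (fun=> 1) s.
Proof.
move=> a0; elim: m z s => [|m IH] z s /andP[s0 s1]; first exact: ltr01.
have dJ t : t \in `]s, 1[ -> is_derive t 1 (J m.+1 z (fun=> 1))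
    (- (a z t * J m (z + 1) (fun=> 1) t)).
  rewrite in_itv /= => /andP[? ?]; apply: (is_derive_simplex_int z (BUC_cst _ _)).
  by apply/andP; split; lra.
have sub : `[s, 1] `<=` `[0, 1].
  by move=> t /=; rewrite !in_itv /= => /andP[? ?]; apply/andP; split; lra.
have [c] := MVT s1 dJ (continuous_subspaceW sub (simplex_int_continuous z (BUC_cst _ _))).
rewrite in_itv simplex_int1 sub0r mulNr => /andP[sc c1] /oppr_inj ->.
rewrite /= in sc c1; rewrite mulr_gt0 ?subr_gt0// mulr_gt0// IH// c1 andbT; lra.
Qed.

(** Joint regularity in the instants of the past (the list [behead r]) and the
    current time (the entry [head 0 r]), which the backward values inherit. *)
Lemma simplex_int_cat_BUC k m z F : BUC (k + m) F ->
  BUC k.+1 (fun r => J m z (fun q => F (behead r ++ q)) (clamp (head 0 r))).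
Proof.
move=> HF; have [[B HB] uF] := HF.
have [D [D0 HD]] := simplex_int_bound m z.
have [D' [D'0 HD']] := simplex_int_dist m z.
have [L [L0 HL]] := simplex_int_lip m z.
have HBc r q : size r = k.+1 -> size q = m -> `|F (behead r ++ q)| <= B.
  by move=> rk qm; rewrite HB// size_cat size_behead rk qm.
have Hc r : size r = k.+1 -> BUC m (fun q => F (behead r ++ q)).
  by move=> rk; apply: BUC_cat HF; rewrite size_behead rk.
split; first by exists (D * B) => r rk; apply: HD;
  [exact: Hc|exact: clamp_in|move=> q; exact: HBc].
move=> e e0; have e2 : 0 < e / 2 by rewrite divr_gt0.
have [d d0 Hd] := uF (e / 2 / D') (divr_gt0 e2 D'0).
have B0 : 0 <= B by apply: le_trans (HB (nseq (k + m) 0) (size_nseq _ _)).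
have LB : 0 < L * B + 1 by rewrite ltr_wpDl// mulr_ge0// ltW.
exists (Num.min d (e / 2 / (L * B + 1))); first by rewrite lt_min d0 divr_gt0.
move=> r r' rk rr'; have r'k : size r' = k.+1 by rewrite -(near_seq_size rr').
set t := clamp (head 0 r); set t' := clamp (head 0 r').
have h1 : `|J m z (fun q => F (behead r ++ q)) t - J m z (fun q => F (behead r' ++ q)) t|
    <= D' * (e / 2 / D').
  apply: HD'; [exact: Hc|exact: Hc|exact: clamp_in|move=> q qm].
  apply/ltW/Hd; first by rewrite size_cat size_behead rk qm.
  apply: near_seq_cat; last exact: near_seq_refl.
  case: r r' rk r'k rr' {t t'} => [|t r] [|t' r'] //= _ _ /andP[_].
  exact: near_seq_minl.
have h2 : `|J m z (fun q => F (behead r' ++ q)) t - J m z (fun q => F (behead r' ++ q)) t'|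
    <= L * B * `|t - t'|.
  by apply: HL; [exact: Hc|exact: clamp_in|exact: clamp_in|move=> q; exact: HBc].
have h3 : `|t - t'| < e / 2 / (L * B + 1).
  apply: le_lt_trans (clamp_dist _ _) _.
  case: r r' rk r'k rr' {t t' h1 h2} => [|t r] [|t' r'] //= _ _ /andP[+ _].
  by rewrite lt_min => /andP[].
rewrite ltr_pdivlMr// in h3.
rewrite mulrCA divff ?gt_eqF// mulr1 in h1.
have h4 : L * B * `|t - t'| <= `|t - t'| * (L * B + 1).
  by rewrite mulrC ler_wpM2l// lerDl.
rewrite (_ : _ - _ = (J m z (fun q => F (behead r ++ q)) t -
   J m z (fun q => F (behead r' ++ q)) t) +
   (J m z (fun q => F (behead r' ++ q)) t - J m z (fun q => F (behead r' ++ q)) t'));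
  last by ring.
apply: (le_lt_trans (ler_normD _ _)); lra.
Qed.

Section ChangeOfVariables.
Variables (th dth : R -> R) (b : int -> R -> R).
Hypothesis th01 : forall t, 0 <= t <= 1 -> 0 <= th t <= 1.
Hypothesis th1 : th 1 = 1.
Hypothesis uth : unif_cont th.
Hypothesis is_derive_th : forall t, 0 < t < 1 -> is_derive t 1 th (dth t).
Hypothesis ub : forall z, unif_cont (b z).
Hypothesis bb : forall z, exists B : R, forall t, `|b z t| <= B.
Hypothesis bE : forall z t, 0 < t < 1 -> a z (th t) * dth t = a z t * b z t.

(** The substitution t_i = th(s_i), by induction on the number of variables:
    both sides vanish at [s = 1], and their derivatives in [s] agree by the
    induction hypothesis and the relation [bE] for the outermost variable. *)
Lemma simplex_int_change m z G s : BUC m G -> 0 <= s <= 1 ->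
  J m z G (th s) = J m z (fun r => G (map th r) * jump_prod b z r) s.
Proof.
elim: m z G s => [|m IH] z G s HG s01; first by rewrite /= mulr1.
pose G' r := G (map th r) * jump_prod b z r.
have HG' : BUC m.+1 G' by apply: BUC_mul; [exact: BUC_map|exact: BUC_jump_prod].
pose K t := J m.+1 z G (th t) - J m.+1 z G' t.
have dJ t : 0 <= t <= 1 -> is_derive (th t) 1 (J m.+1 z G)
    (- (a z (th t) * J m (z + 1) (fun r => G (th t :: r)) (th t))).
  by move=> t01; apply: is_derive_simplex_int => //; exact: th01.
have cK : {within `[0, 1], continuous K}.
  apply: within_continuousB; last exact: simplex_int_continuous.
  apply: continuous_in_subspaceT => t; rewrite inE /= in_itv /= => t01.
  apply: (@continuous_comp _ _ _ th (J m.+1 z G)); first exact: unif_cont_continuous uth _.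
  by apply/differentiable_continuous/derivable1_diffP; have [] := dJ t t01.
have dK t : 0 < t < 1 -> is_derive t 1 K 0.
  move=> t01; have /andP[t0 t1] := t01.
  have t01' : 0 <= t <= 1 by rewrite !ltW.
  have d1 : is_derive t 1 (J m.+1 z G \o th)
     (- (a z (th t) * J m (z + 1) (fun r => G (th t :: r)) (th t)) * dth t).
    have := dJ t t01'; have := is_derive_th t01 => ? ?.
    exact: is_derive1_comp.
  have d2 := is_derive_simplex_int z HG' t01'.
  have := is_deriveB d1 d2; congr is_derive.
  rewrite IH//; last exact: BUC_cons.
  rewrite (_ : J m (z + 1) (fun r => G' (t :: r)) t =
     b z t * J m (z + 1) (fun r => G (th t :: map th r) * jump_prod b (z + 1) r) t).
    rewrite opprK mulNr mulrAC bE// mulrA; ring.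
  rewrite -simplex_intZ//.
    by apply: simplex_int_ext => r _; rewrite /G' /=; ring.
  apply: BUC_mul; last exact: BUC_jump_prod.
  exact: (@BUC_map _ _ (fun r => G (th t :: r)) th uth (BUC_cons _ HG)).
have [c _ [_ [_]]] := MVT01 cK dK s01 in01_1.
rewrite mul0r /K th1 !simplex_int1 subrr sub0r => /eqP.
by rewrite oppr_eq0 subr_eq0 => /eqP.
Qed.

End ChangeOfVariables.
End Weight.
End Simplex.

(** * The weights of a Markov counting intensity *)

Section Weights.
Context {R : realType}.
Implicit Types (f g h : R -> R) (s t : R) (z : int).

Lemma deriv01_is_derive f t d : 0 < t < 1 -> is_derive t 1 f d -> deriv01 f t = d.
Proof.
move=> t01 [df fd].
have H : h^-1 *: (f (h *: 1 + t) - f t) @[h --> 0^'] --> d.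
  by rewrite -fd; exact: df.
suff K : dquot01 f t = (f s - f t) / (s - t) @[s --> t^'].
  rewrite /deriv01 K; apply/cvg_lim => //.
  apply/cvgrPdist_lt => e e0; have /cvgrPdist_lt/(_ e e0) := H.
  move=> [r /= r0 Hr]; exists r => // s /= st s0.
  have := Hr (s - t); rewrite /= sub0r normrN distrC => /(_ st).
  by rewrite subr_eq0 => /(_ s0); rewrite /GRing.scale /= mulr1 subrK mulrC.
rewrite /dquot01; congr (nbhs (_ @ _)).
rewrite /dnbhs; apply/seteqP; split=> V; rewrite /within /=; last first.
  by apply: filterS => s H1 H2 _; exact: H1.
move=> HV; have : \forall s \near t, s \in `[0, 1].
  have : \forall s \near t, s \in `]0, 1[.
    by apply: near_in_itvoo; rewrite in_itv.
  apply: filterS => s; rewrite !in_itv /= => /andP[? ?]; apply/andP; split; exact: ltW.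
have HV' : \forall s \near t, s != t -> s \in `[0, 1] -> V s := HV.
by move=> N; apply: filterS2 HV' N => s H1 H2 st; exact: H1.
Qed.

Lemma is_derive_cvg0 f (d : R) : is_derive (0 : R) 1 f d ->
  e^-1 * (f e - f 0) @[e --> 0^'+] --> d.
Proof.
move=> [df fd].
have H : h^-1 *: (f (h *: 1 + 0) - f 0) @[h --> 0^'] --> d.
  by rewrite -fd; exact: df.
apply/cvgrPdist_lt => e e0; have /cvgrPdist_lt/(_ e e0) := H.
move=> [r /= r0 Hr]; exists r => // s /= sr s0.
have := Hr s sr (lt0r_neq0 s0).
by rewrite /GRing.scale /= mulr1 addr0.
Qed.

Section NMC.
Variable l : R -> int -> R.
Hypothesis Hl : NMC l.

Let l_gt0 t z : 0 <= t <= 1 -> 0 < l t z. Proof. by have [+ _ _] := Hl; apply. Qed.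

Lemma rate_within z : {within `[0, 1], continuous (l ^~ z)}.
Proof.
by have [_ _ /(_ z)[dl _]] := Hl; apply/clamp_within/derivable01_clamp_continuous.
Qed.

(** The cumulated rate Lambda_z of the state [z]. *)
Definition cumrate z : R -> R := prim (fun t => l (clamp t) z).

Lemma rate_continuous z : continuous (fun t => l (clamp t) z).
Proof. exact: comp_clamp_continuous (@rate_within z). Qed.

Lemma is_derive_cumrate z t : 0 <= t <= 1 -> is_derive t 1 (cumrate z) (l t z).
Proof.
move=> t01; have t1 : -1 < t by move/andP: t01 => [? ?]; lra.
by have := is_derive_prim (@rate_continuous z) t1; rewrite clamp_id.
Qed.

Lemma cumrate_clamp_continuous z : continuous (cumrate z \o clamp).
Proof. exact/comp_clamp_continuous/prim_continuous/rate_continuous. Qed.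

(** The contribution to the density of a jump from [z] to [z + 1] at time [t]:
    the intensity, and the factors that [t] contributes to the probabilities of
    staying in the state left and in the state entered, exp(- Lambda_z(t)) and
    exp(Lambda_{z+1}(t)). *)
Definition weight z t : R :=
  l (clamp t) z * expR (cumrate (z + 1) (clamp t) - cumrate z (clamp t)).

Definition dweight z t : R :=
  (deriv01 (l ^~ z) t + l t z * (l t (z + 1) - l t z)) *
  expR (cumrate (z + 1) t - cumrate z t).

Lemma weight_gt0 z t : 0 < weight z t.
Proof. by rewrite mulr_gt0 ?expR_gt0// l_gt0// clamp_in. Qed.

Lemma weight_clamp z t : weight z (clamp t) = weight z t.
Proof. by rewrite /weight clampK. Qed.

Let dcumrate_continuous z :
  continuous (fun t => expR (cumrate (z + 1) (clamp t) - cumrate z (clamp t))).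
Proof.
move=> t; apply: (@continuous_comp _ _ _
  (fun t => cumrate (z + 1) (clamp t) - cumrate z (clamp t)) expR).
  by apply: cvgB; exact: cumrate_clamp_continuous.
exact: continuous_expR.
Qed.

Lemma weight_continuous z : continuous (weight z).
Proof. by move=> t; apply: cvgM; [exact: rate_continuous|exact: dcumrate_continuous]. Qed.

Lemma clamped_bounded f : continuous f -> (forall t, f (clamp t) = f t) ->
  exists B : R, forall t, `|f t| <= B.
Proof.
move=> cf fE; have [|B B0 HB] := @bounded01 _ f.
  by apply: clamp_within; rewrite (_ : f \o clamp = f)//; exact/funext.
by exists B => t; rewrite -fE HB// clamp_in.
Qed.

Lemma clamped_unif_cont f : continuous f -> (forall t, f (clamp t) = f t) -> unif_cont f.
Proof.
move=> cf fE; have fcE : f \o clamp = f by exact/funext.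
by rewrite -fcE; apply: heine01; apply: clamp_within; rewrite fcE.
Qed.

Lemma weight_bounded z : exists B : R, forall t, `|weight z t| <= B.
Proof. exact: clamped_bounded (@weight_continuous z) (weight_clamp z). Qed.

Lemma is_derive_weight z t : 0 < t < 1 -> is_derive t 1 (weight z) (dweight z t).
Proof.
move=> t01; have t01' : 0 <= t <= 1 by case/andP: t01 => *; rewrite !ltW.
have [_ _ /(_ z)[dl _]] := Hl.
have d1 := is_derive01 t01 (dl t t01').
have d2 := is_deriveB (is_derive_cumrate (z + 1) t01') (is_derive_cumrate z t01').
have d3 : is_derive t 1 (expR \o (cumrate (z + 1) - cumrate z))
    (expR (cumrate (z + 1) t - cumrate z t) * (l t (z + 1) - l t z)).
  by apply: is_derive1_comp.
have d4 := is_deriveM d1 d3.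
apply: (@near_eq_is_derive _ _ _
   ((fun t => l t z) * (expR \o (cumrate (z + 1) - cumrate z)))).
  have : \forall s \near t, s \in `]0, 1[.
    by apply: near_in_itvoo; rewrite in_itv.
  apply: filterS => s; rewrite in_itv /= => /andP[? ?].
  by rewrite /weight clamp_id// !ltW.
apply: is_derive_eq d4 _; rewrite /dweight /GRing.scale /= !fctE; ring.
Qed.

Lemma dweight_bounded z : exists B : R, forall t, 0 <= t <= 1 -> `|dweight z t| <= B.
Proof.
have [_ _ /(_ z)[_ cl']] := Hl.
have [|B B0 HB] := @bounded01 _ (dweight z); last by exists B.
apply: clamp_within => t; apply: cvgM; last exact: dcumrate_continuous.
apply: cvgD; first exact: comp_clamp_continuous.
apply: cvgM; first exact: rate_continuous.
by apply: cvgB; exact: rate_continuous.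
Qed.

Lemma weight_within z : {within `[0, 1], continuous (weight z)}.
Proof. exact/continuous_subspaceT/weight_continuous. Qed.

Lemma weight_lip z : exists2 B : R, 0 < B & forall s t, `|weight z s - weight z t| <= B * `|s - t|.
Proof.
have [B HB] := dweight_bounded z; exists (`|B| + 1) => [|s t]; first by rewrite ltr_wpDl.
rewrite -(weight_clamp z s) -(weight_clamp z t).
have [c c01 [_ [_ ->]]] := MVT01 (@weight_within z) (fun t => @is_derive_weight z t)
  (clamp_in t) (clamp_in s).
rewrite normrM ler_pM// ?clamp_dist// (le_trans (HB c c01))//.
by rewrite (le_trans (ler_norm _))// lerDl.
Qed.

(** This is how the reciprocal invariant enters: the derivative of the intensity
    gives the first term of [Xi], that of the exponent the two others. *)
Lemma Xi_weight z t : 0 < t < 1 -> Xi l t z = dweight z t / weight z t.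
Proof.
move=> t01; have t01' : 0 <= t <= 1 by case/andP: t01 => *; rewrite !ltW.
have [_ _ /(_ z)[dl _]] := Hl.
have d1 := is_derive01 t01 (dl t t01').
have l0 := l_gt0 z t01'.
have d2 : is_derive t 1 (@ln R \o (l ^~ z)) ((l t z)^-1 * deriv01 (l ^~ z) t).
  by apply: is_derive1_comp; exact: is_derive1_ln.
rewrite /Xi (deriv01_is_derive t01 d2) /weight /dweight clamp_id//.
have e0 := expR_gt0 (cumrate (z + 1) t - cumrate z t).
by field; rewrite !gt_eqF.
Qed.

Lemma weight_inv_bounded z : exists2 c : R, 0 < c & forall t, (weight z t)^-1 <= c.
Proof.
have [|t|B HB] := @clamped_bounded (fun t => (weight z t)^-1).
- by move=> t; apply: cvgV; [rewrite gt_eqF ?weight_gt0|exact: weight_continuous].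
- by rewrite weight_clamp.
exists (`|B| + 1); first by rewrite ltr_wpDl.
move=> t; rewrite (le_trans (ler_norm _))// (le_trans (HB t))// (le_trans (ler_norm _))//.
by rewrite lerDl.
Qed.

End NMC.
End Weights.

(** * Time changes of the unit interval *)

Section TimeChange.
Context {R : realType}.
Implicit Types (f g h : R -> R) (e s t : R) (r : seq R) (z : int).
Variable u : R -> R.
Hypothesis Hu : perturbation u.

Definition tchange e t : R := clamp t + e * u (clamp t).

(** The slope of the time change then lies between 1/2 and 3/2, so that it is an
    increasing bijection of [0,1] with Lipschitz bounds, in both directions,
    that do not depend on [e]. *)
Definition admissible e := 0 <= e /\ forall t, 0 <= t <= 1 -> e * `|deriv01 u t| <= 2^-1.

Lemma perturbation_within : {within `[0, 1], continuous u}.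
Proof.
by have [[du _] _ _] := Hu; apply/clamp_within/derivable01_clamp_continuous.
Qed.

Lemma perturbation_is_derive t : 0 < t < 1 -> is_derive t 1 u (deriv01 u t).
Proof.
move=> t01; have [[du _] _ _] := Hu; apply: is_derive01 => //; apply: du.
by case/andP: t01 => *; rewrite !ltW.
Qed.

Lemma near_admissible : exists2 e0 : R, 0 < e0 & forall e, 0 < e <= e0 -> admissible e.
Proof.
have [[_ cu'] _ _] := Hu; have [B B0 HB] := bounded01 cu'.
exists (2^-1 / B) => [|e /andP[e0 eB]]; first by rewrite divr_gt0 ?invr_gt0.
split=> [|t t01]; first exact: ltW.
apply: (@le_trans _ _ (e * B)); first by rewrite ler_wpM2l ?HB// ltW.
by rewrite -ler_pdivlMr.
Qed.

Lemma tchange_clamp e t : tchange e (clamp t) = tchange e t.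
Proof. by rewrite /tchange clampK. Qed.

Lemma tchange0 e : tchange e 0 = 0.
Proof. by have [_ u0 _] := Hu; rewrite /tchange (clamp_id in01_0) u0 mulr0 addr0. Qed.

Lemma tchange1 e : tchange e 1 = 1.
Proof. by have [_ _ u1] := Hu; rewrite /tchange (clamp_id in01_1) u1 mulr0 addr0. Qed.

Lemma tchange_continuous e : continuous (tchange e).
Proof.
move=> t; apply: cvgD; first exact: clamp_continuous.
apply: cvgM; first exact: cvg_cst.
exact: comp_clamp_continuous perturbation_within t.
Qed.

Lemma tchange_theta e t : 0 <= t <= 1 -> tchange e t = theta u e t.
Proof. by move=> t01; rewrite /tchange /theta clamp_id. Qed.

Lemma is_derive_tchange e t : 0 < t < 1 -> is_derive t 1 (tchange e) (1 + e * deriv01 u t).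
Proof.
move=> t01; have H := is_deriveD (is_derive_id t 1)
  (is_deriveZ e (perturbation_is_derive t01)).
apply: (near_eq_is_derive _ H).
have : \forall s \near t, s \in `]0, 1[ by apply: near_in_itvoo; rewrite in_itv.
apply: filterS => s; rewrite in_itv /= => /andP[? ?].
by rewrite /tchange clamp_id// !ltW.
Qed.

Section Admissible.
Variable e : R.
Hypothesis He : admissible e.

Lemma tchange_mvt s t : exists2 k : R, 2^-1 <= k <= 3 / 2 &
  tchange e s - tchange e t = k * (clamp s - clamp t).
Proof.
have [c c01 [_ [_ H]]] := MVT01 perturbation_within perturbation_is_derive
  (clamp_in t) (clamp_in s).
exists (1 + e * deriv01 u c).
  have [e0 /(_ c c01)] := He; rewrite -(ger0_norm e0) -normrM => /ler_normlP[? ?].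
  by apply/andP; split; rewrite ger0_norm// in H *; lra.
by rewrite /tchange mulrDl mul1r -mulrA -H; ring.
Qed.

Lemma tchange_incr s t : 0 <= s <= 1 -> 0 <= t <= 1 -> (tchange e s < tchange e t) = (s < t).
Proof.
move=> s01 t01; have [k /andP[k0 _] H] := tchange_mvt t s.
have k1 : 0 < k by apply: lt_le_trans k0; rewrite invr_gt0.
by rewrite -subr_gt0 H !clamp_id// pmulr_rgt0// subr_gt0.
Qed.

Lemma tchange_in01 t : 0 <= tchange e t <= 1.
Proof.
rewrite -tchange_clamp; have /andP[t0 t1] := clamp_in t; apply/andP; split.
  by rewrite -(tchange0 e) leNgt tchange_incr ?clamp_in ?in01_0// -leNgt.
by rewrite -(tchange1 e) leNgt tchange_incr ?clamp_in ?in01_1// -leNgt.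
Qed.

Lemma tchange_lip s t : `|tchange e s - tchange e t| <= 3 / 2 * `|s - t|.
Proof.
have [k /andP[k0 k1] ->] := tchange_mvt s t; rewrite normrM ler_pM ?clamp_dist//.
by rewrite ger0_norm// (le_trans _ k0)// invr_ge0.
Qed.

Lemma tchange_unif_cont : unif_cont (tchange e).
Proof. exact: lip_unif_cont tchange_lip. Qed.

(** The preimage is looked for in [0,1]; for admissible [e], [clamp] gives every
    real number one there, see [tchange_invP]. *)
Definition tchange_inv t : R := xget 0 [set s | 0 <= s <= 1 /\ tchange e s = clamp t].

Lemma tchange_invP t : 0 <= tchange_inv t <= 1 /\ tchange e (tchange_inv t) = clamp t.
Proof.
suff : exists s, [set s | 0 <= s <= 1 /\ tchange e s = clamp t] s.
  by move=> /(xgetPex 0).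
have [|c] := @IVT R (tchange e) 0 1 (clamp t) ler01 (continuous_subspaceT (@tchange_continuous e)).
  by rewrite tchange0 tchange1 min_l// max_r// clamp_in.
by rewrite in_itv => c01 <-; exists c.
Qed.

Lemma tchange_inv_in01 t : 0 <= tchange_inv t <= 1. Proof. by have [] := tchange_invP t. Qed.

Lemma tchange_invK t : 0 <= t <= 1 -> tchange e (tchange_inv t) = t.
Proof. by have [_ ->] := tchange_invP t => /clamp_id. Qed.

Lemma tchange_inv_incr s t : 0 <= s <= 1 -> 0 <= t <= 1 ->
  (tchange_inv s < tchange_inv t) = (s < t).
Proof. by move=> s01 t01; rewrite -tchange_incr ?tchange_inv_in01// !tchange_invK. Qed.

Lemma tchangeK t : 0 <= t <= 1 -> tchange_inv (tchange e t) = t.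
Proof.
move=> t01; have := tchange_invK (tchange_in01 t) => H.
apply/eqP; rewrite eq_le !leNgt -(tchange_incr t01 (tchange_inv_in01 _)).
rewrite -(tchange_incr (tchange_inv_in01 _) t01).
by rewrite H ltxx.
Qed.

Lemma tchange_inv0 : tchange_inv 0 = 0.
Proof. by rewrite -[in LHS](tchange0 e) tchangeK// in01_0. Qed.

Lemma tchange_inv1 : tchange_inv 1 = 1.
Proof. by rewrite -[in LHS](tchange1 e) tchangeK// in01_1. Qed.

Lemma tchange_inv_oo t : 0 < t < 1 -> 0 < tchange_inv t < 1.
Proof.
move=> /andP[t0 t1]; have t01 : 0 <= t <= 1 by rewrite !ltW.
rewrite -[X in X < _ < _]tchange_inv0 -[X in _ < _ < X]tchange_inv1.
by rewrite !tchange_inv_incr ?in01_0 ?in01_1// t0.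
Qed.

Lemma tchange_inv_lip s t : `|tchange_inv s - tchange_inv t| <= 2 * `|s - t|.
Proof.
have [_ hs] := tchange_invP s; have [_ ht] := tchange_invP t.
have [k /andP[k0 k1] H] := tchange_mvt (tchange_inv s) (tchange_inv t).
rewrite hs ht (clamp_id (tchange_inv_in01 s)) (clamp_id (tchange_inv_in01 t)) in H.
have kp : 0 < k by apply: lt_le_trans k0; rewrite invr_gt0.
apply: (@le_trans _ _ (2 * `|clamp s - clamp t|)); last first.
  by rewrite ler_wpM2l// clamp_dist.
rewrite H normrM gtr0_norm// mulrA ler_peMl//; lra.
Qed.

Lemma tchange_inv_unif_cont : unif_cont tchange_inv.
Proof. exact: lip_unif_cont tchange_inv_lip. Qed.

(** The fixed-point equation of the inverse, from which the first-order
    behaviour of the inverse in [e] is read off. *)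
Lemma tchange_inv_sub t : 0 <= t <= 1 -> tchange_inv t - t = - (e * u (tchange_inv t)).
Proof.
move=> t01; have := tchange_invK t01; rewrite /tchange clamp_id ?tchange_inv_in01// => H.
by rewrite -[X in _ - X]H; ring.
Qed.

End Admissible.

Section Density.
Local Opaque weight dweight prim expR.
Variable l : R -> int -> R.
Hypothesis Hl : NMC l.

(** The factor contributed by a jump from [z] at time [t] to the density of the
    time-changed process with respect to the original one. *)
Definition weight_ratio e z t : R :=
  weight l z (tchange e t) * (1 + e * deriv01 u (clamp t)) / weight l z t.

Lemma weight_ratio_clamp e z t : weight_ratio e z (clamp t) = weight_ratio e z t.
Proof. by rewrite /weight_ratio tchange_clamp clampK weight_clamp. Qed.

Lemma weight_ratio_continuous e z : continuous (weight_ratio e z).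
Proof.
have [[_ cu'] _ _] := Hu.
move=> t; apply: cvgM; last first.
  by apply: cvgV; [rewrite gt_eqF ?weight_gt0|exact: weight_continuous].
apply: cvgM.
  apply: (@continuous_comp _ _ _ (tchange e) (weight l z)); first exact: tchange_continuous.
  exact: weight_continuous.
apply: cvgD; first exact: cvg_cst.
apply: cvgM; first exact: cvg_cst.
exact: comp_clamp_continuous cu' t.
Qed.

Lemma weight_ratio_unif_cont e z : unif_cont (weight_ratio e z).
Proof. exact: clamped_unif_cont (@weight_ratio_continuous e z) (weight_ratio_clamp e z). Qed.

Lemma weight_ratio_bounded e z : exists B : R, forall t, `|weight_ratio e z t| <= B.
Proof. exact: clamped_bounded (@weight_ratio_continuous e z) (weight_ratio_clamp e z). Qed.

Lemma weight_ratioE e z t : 0 < t < 1 ->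
  weight l z (tchange e t) * (1 + e * deriv01 u t) = weight l z t * weight_ratio e z t.
Proof.
move=> /andP[t0 t1]; rewrite /weight_ratio clamp_id ?ltW//.
by rewrite [RHS]mulrC divfK// gt_eqF// weight_gt0.
Qed.

(** The weight is Lipschitz and bounded below; the time change moves every point
    by O(e) and has slope 1 + O(e), uniformly. *)
Lemma weight_ratio_dist z : exists2 K : R, 0 < K & forall e t, admissible e ->
  `|weight_ratio e z t - 1| <= K * e.
Proof.
have [[_ cu'] _ _] := Hu; have [Bd Bd0 HBd] := bounded01 cu'.
have [Bu Bu0 HBu] := bounded01 perturbation_within.
have [Lp Lp0 HL] := weight_lip Hl z.
have [C HC] := weight_bounded Hl z.
have [c c0 Hc] := weight_inv_bounded Hl z.
exists ((Lp * Bu + `|C| * Bd) * c + 1).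
  by rewrite ltr_wpDl// mulr_ge0 ?addr_ge0 ?mulr_ge0// ltW.
move=> e t [e0 _].
have w0 := weight_gt0 Hl z t.
have -> : weight_ratio e z t - 1 = (weight l z (tchange e t) - weight l z t +
    weight l z (tchange e t) * (e * deriv01 u (clamp t))) / weight l z t.
  rewrite /weight_ratio; move: (weight l z (tchange e t)) (weight l z t) w0 => w' w w0.
  by field; rewrite gt_eqF.
have wi0 : 0 <= (weight l z t)^-1 by rewrite invr_ge0 ltW.
rewrite normrM (ger0_norm wi0).
apply: (@le_trans _ _ ((Lp * Bu + `|C| * Bd) * e * c)); last first.
  by rewrite (mulrDl _ 1) mul1r (mulrAC _ e) lerDl.
apply: ler_pM => //; apply: (le_trans (ler_normD _ _)); rewrite (mulrDl (Lp * Bu)); apply: lerD.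
  rewrite -(weight_clamp l z t); apply: (le_trans (HL _ _)).
  rewrite -mulrA; apply: ler_wpM2l; first exact: ltW.
  rewrite /tchange addrAC subrr add0r normrM (ger0_norm e0).
  by rewrite mulrC ler_wpM2r// HBu// clamp_in.
have Hw : `|weight l z (tchange e t)| <= `|C| by exact: le_trans (HC _) (ler_norm _).
have Hu' : `|deriv01 u (clamp t)| <= Bd by exact: HBd (clamp_in t).
rewrite normrM -mulrA; apply: ler_pM; [exact: normr_ge0|exact: normr_ge0|exact: Hw|].
by rewrite normrM (ger0_norm e0) mulrC; apply: ler_wpM2r.
Qed.

(** Closeness of order [e], uniform in the instants, is what dominates the
    difference quotients of the density. *)
Lemma jump_prod_dist n z : exists2 K : R, 0 < K & forall e r, admissible e -> e <= 1 ->
  size r = n -> `|jump_prod (weight_ratio e) z r - 1| <= K * e.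
Proof.
elim: n z => [|n IH] z.
  exists 1 => // e [|//] [e0 _] _ _; by rewrite subrr normr0 mulr_ge0.
have [K K0 HK] := weight_ratio_dist z; have [K' K'0 HK'] := IH (z + 1).
exists ((K + 1) * K' + K) => [|e [//|t r] se e1 /= [rn]].
  by rewrite addr_gt0// mulr_gt0// addr_gt0.
have h1 := HK e t se; have h2 := HK' e r se e1 rn; have [e0 _] := se.
rewrite (_ : _ - 1 = weight_ratio e z t * (jump_prod (weight_ratio e) (z + 1) r - 1) +
  (weight_ratio e z t - 1)); last by ring.
apply: (le_trans (ler_normD _ _)); rewrite mulrDl lerD// normrM -mulrA ler_pM//.
rewrite (_ : weight_ratio e z t = (weight_ratio e z t - 1) + 1); last by ring.
apply: (le_trans (ler_normD _ _)); rewrite normr1 lerD//.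
by apply: (le_trans h1); rewrite ler_piMr// ltW.
Qed.

(** The integrand of the duality formula, obtained as the derivative at [e = 0]
    of the factor of one jump. *)
Definition dens_rate t z : R := deriv01 u t + Xi l t z * u t.

Lemma is_derive_weight_ratio z t : 0 < t < 1 ->
  is_derive (0 : R) 1 (fun e => weight_ratio e z t) (dens_rate t z).
Proof.
move=> t01; have t01' : 0 <= t <= 1 by case/andP: t01 => *; rewrite !ltW.
have w0 := weight_gt0 Hl z t.
have d0 : is_derive (0 : R) 1 (fun e => tchange e t) (u t).
  have := is_deriveD (is_derive_cst t (0 : R) 1)
    (is_deriveM (is_derive_id (0:R) 1) (is_derive_cst (u t) (0:R) 1)).
  have -> : (fun e => tchange e t) = cst t + id * cst (u t).
    by apply/funext => e; rewrite /tchange clamp_id.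
  by move=> H; apply: is_derive_eq H _; rewrite scaler0 !add0r /GRing.scale /= mulr1.
have tc00 : tchange 0 t = t by rewrite /tchange mul0r addr0 clamp_id.
have d1 : is_derive (tchange 0 t) 1 (weight l z) (dweight l z t).
  by rewrite tc00; exact: is_derive_weight.
have d2 := @is_derive1_comp _ (weight l z) (fun e => tchange e t) 0 _ _ d1 d0.
have d3 := is_deriveD (is_derive_cst (1 : R) (0 : R) 1)
    (is_deriveM (is_derive_id (0:R) 1) (is_derive_cst (deriv01 u t) (0:R) 1)).
have d4 := is_deriveM (is_deriveM d2 d3) (is_derive_cst (weight l z t)^-1 (0:R) 1).
rewrite (_ : (fun e => _) = ((weight l z \o tchange^~ t) * (cst 1 + id * cst (deriv01 u t)) *
        cst (weight l z t)^-1)); last first.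
  by apply/funext => e; rewrite /weight_ratio clamp_id.
apply: is_derive_eq d4 _.
rewrite /dens_rate (Xi_weight Hl)// /GRing.scale /= !fctE /= tc00.
by move: (dweight l z t) (weight l z t) w0 => w' w w0; field; rewrite gt_eqF.
Qed.

Lemma weight_ratio0 z t : weight_ratio 0 z t = 1.
Proof.
rewrite /weight_ratio /tchange !mul0r !addr0 mulr1 weight_clamp divff// gt_eqF// weight_gt0//.
Qed.

Lemma jump_prod0 z r : jump_prod (weight_ratio 0) z r = 1.
Proof. by elim: r z => //= t r IH z; rewrite IH weight_ratio0 mulr1. Qed.

Lemma is_derive_jump_prod z r : all (fun t => 0 < t < 1) r ->
  is_derive (0 : R) 1 (fun e => jump_prod (weight_ratio e) z r) (jump_sum dens_rate z r).
Proof.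
elim: r z => [|t r IH] z /=; first by move=> _; exact: is_derive_cst.
move=> /andP[t01 r01].
have := is_deriveM (is_derive_weight_ratio z t01) (IH (z + 1) r01).
rewrite weight_ratio0 jump_prod0 /GRing.scale /= !mul1r => H.
exact: is_derive_eq H (addrC _ _).
Qed.

End Density.
End TimeChange.

(** * Counting paths and their time changes *)

Section Paths.
Context {R : realType}.
Implicit Types (e s t d r : R) (q : seq R) (z : int) (w : Omega R).

(** In an increasing list, the entries up to [t] are exactly the first ones. *)
Lemma sorted_nth_le q d t i : sorted <%R q -> (i < size q)%N ->
  (nth d q i <= t) = (i < count (fun r : R => r <= t)%R q)%N.
Proof.
elim: q i => [//|r q IH] i /= rq iq.
have sq := path_sorted rq.
have [rt|tr] := leP r t; last first.
  have Hq : all (fun x : R => t < x) q.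
    by apply: sub_all (order_path_min lt_trans rq) => x; exact: lt_trans.
  have -> : count (fun r : R => r <= t) q = 0%N.
    apply/eqP; rewrite -leqn0 leqNgt -has_count; apply/hasPn => x xq.
    by rewrite -ltNge; exact: (allP Hq).
  rewrite ltn0; case: i iq => [|i] /= iq; apply/negbTE; rewrite -ltNge//.
  exact/(allP Hq)/mem_nth.
by case: i iq => [|i] //= iq; rewrite IH.
Qed.

(** The number of entries up to each [t] is known, and it determines every entry
    of an increasing list. *)
Lemma has_jumps_uniq (f : R -> int) q q' : has_jumps f q -> has_jumps f q' -> q = q'.
Proof.
move=> [sq aq fq] [sq' aq' fq'].
have C t : count (fun r => r <= t) q = count (fun r => r <= t) q'.
  by have := fq' t; rewrite fq => /addrI[].
have full p : all (fun r : R => 0 < r < 1) p -> count (fun r => r <= 1) p = size p.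
  move=> ap; apply/eqP; rewrite -all_count; apply: sub_all ap => x /andP[_].
  exact: ltW.
have S : size q = size q' by rewrite -(full _ aq) -(full _ aq').
apply: (@eq_from_nth _ 0) => // i iq; have iq' := iq; rewrite S in iq'.
apply/eqP; rewrite eq_le.
rewrite (sorted_nth_le _ _ sq iq) C -(sorted_nth_le 0 _ sq' iq') lexx /=.
by rewrite (sorted_nth_le _ _ sq' iq') -C -(sorted_nth_le 0 _ sq iq) lexx.
Qed.

Lemma jumpsP w : has_jumps (traj w) (jumps w).
Proof. exact: svalP (cid (trajP w)). Qed.

Lemma jumps_sorted w : sorted <%R (jumps w). Proof. by have [] := jumpsP w. Qed.
Lemma jumps_oo w : all (fun r => 0 < r < 1) (jumps w).
Proof. by have [] := jumpsP w. Qed.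

Lemma X_count t w : X t w = X 0 w + (count (fun r => r <= t) (jumps w))%:Z.
Proof. by have [_ _] := jumpsP w; apply. Qed.

Lemma count_clamp q t : all (fun r => 0 < r < 1) q ->
  count (fun r => r <= clamp t) q = count (fun r => r <= t) q.
Proof.
move=> aq; apply: eq_in_count => r /(allP aq) /andP[r0 r1].
by have [[? ->]|[? ->]|[/andP[? ?] ->]] := clampP t; apply/idP/idP => ?; lra.
Qed.

Lemma X_clamp t w : X (clamp t) w = X t w.
Proof. by rewrite X_count (X_count t) count_clamp// jumps_oo. Qed.

Lemma X1_size w : X 1 w = X 0 w + (size (jumps w))%:Z.
Proof.
rewrite X_count; congr (_ + Posz _); apply/eqP; rewrite -all_count.
by apply: sub_all (jumps_oo w) => x /andP[_]; exact: ltW.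
Qed.

Lemma X_mono s t w : s <= t -> X s w <= X t w.
Proof.
move=> st; rewrite X_count (X_count t) lerD2l lez_nat.
by apply: sub_count => r /= /le_trans; apply.
Qed.

(** Finitely many instants leave a gap to the left of [t]. *)
Lemma near_count_left q t :
  \forall s \near t^'-, count (fun r => r <= s) q = count (fun r : R => r < t) q.
Proof.
elim: q => [|r q IH] /=; first by near=> s.
have [rt|tr] := ltP r t.
  near=> s; have -> : r <= s by near: s; exact: nbhs_left_ge.
  by congr (_ + _)%N; near: s.
near=> s; have -> : r <= s = false.
  by apply/negbTE; rewrite -ltNge; apply: lt_le_trans tr; near: s; exact: nbhs_left_lt.
by congr (_ + _)%N; near: s.
Unshelve. all: by end_near. Qed.

Lemma Xminus_count t w : Xminus t w = X 0 w + (count (fun r : R => r < t) (jumps w))%:Z.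
Proof.
have H : \forall s \near t^'-, X s w = X 0 w + (count (fun r : R => r < t) (jumps w))%:Z.
  by near=> s; rewrite X_count; congr (_ + Posz _); near: s; exact: near_count_left.
apply: xget_unique => //= z Hz.
have : \forall s \near t^'-, z = X 0 w + (count (fun r : R => r < t) (jumps w))%:Z.
  by near=> s; rewrite -(near H s)//; apply/esym; near: s.
by case/filter_ex.
Unshelve. all: by end_near. Qed.

Lemma intX_jump_sum f w : intX f w = jump_sum f (X 0 w) (jumps w).
Proof.
rewrite /intX; under eq_bigr do rewrite Xminus_count.
elim: (jumps w) (jumps_sorted w) (X 0 w) => [|r q IH] /= rq z; first by rewrite big_nil.
rewrite big_cons ltxx add0n; congr (_ + _).
  congr (f r _); rewrite (_ : count _ q = 0%N) ?addr0//.
  apply/eqP; rewrite -leqn0 leqNgt -has_count; apply/hasPn => x xq.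
  by rewrite -leNgt ltW//; exact: (allP (order_path_min lt_trans rq)).
rewrite -IH ?(path_sorted rq)//.
apply: eq_big_seq => x xq; congr (f x _).
by rewrite (allP (order_path_min lt_trans rq) x xq) /= PoszD addrA.
Qed.

Section Theta.
Variables (u : R -> R) (e : R).
Hypotheses (Hu : perturbation u) (He : admissible u e).

Lemma tchange_inv_le s t : 0 <= s <= 1 -> 0 <= t <= 1 ->
  (tchange_inv u e s <= t) = (s <= tchange u e t).
Proof.
move=> s01 t01; rewrite !leNgt; congr negb.
by rewrite -[in RHS](tchange_invK Hu e s01) (tchange_incr Hu He)// (tchange_inv_in01 Hu).
Qed.

(** A jump of the original path at [r] is seen by the time-changed path when its
    clock shows [r], that is at the inverse image of [r]. *)
Lemma has_jumps_map_tchange_inv (f : R -> int) q :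
  sorted <%R q -> all (fun r => 0 < r < 1) q ->
  (forall t, f t = f (clamp t)) ->
  (forall t, 0 <= t <= 1 -> f t = f 0 + (count (fun r => r <= tchange u e t) q)%:Z) ->
  has_jumps f (map (tchange_inv u e) q).
Proof.
move=> sq aq fc fq.
have aq' : all (fun r => 0 < r < 1) (map (tchange_inv u e) q).
  by rewrite all_map; apply: sub_all aq => t /=; exact: tchange_inv_oo.
split=> //.
- elim: q sq aq {fq aq'} => [//|r q IH] /= rq /andP[/andP[r0 r1] aq].
  have {}IH := IH (path_sorted rq) aq.
  case: q rq aq IH => [//|r' q] /= /andP[rr' _] /andP[/andP[r0' r1'] _] ->.
  by rewrite (tchange_inv_incr Hu He) ?rr'// ?ltW //; apply/andP; split; exact: ltW.
- move=> t; rewrite fc fq ?clamp_in//; congr (_ + Posz _).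
  rewrite -(count_clamp t aq') count_map; apply: eq_in_count => r /(allP aq)/andP[r0 r1] /=.
  by rewrite tchange_inv_le ?clamp_in// !ltW.
Qed.

(** [Theta] chooses a path that satisfies a specification; the path that jumps
    at the inverse images shows that there is one. *)
Lemma Theta_spec w : forall t, 0 <= t <= 1 -> X t (Theta u e w) = X (theta u e t) w.
Proof.
suff : exists w' : Omega R, forall t, 0 <= t <= 1 -> X t w' = X (theta u e t) w.
  by move=> /(xgetPex w).
pose f t := X 0 w + (count (fun r => r <= t) (map (tchange_inv u e) (jumps w)))%:Z.
have aj : all (fun r => 0 < r < 1) (map (tchange_inv u e) (jumps w)).
  by rewrite all_map; apply: sub_all (jumps_oo w) => t /=; exact: tchange_inv_oo.
have f0 : f 0 = X 0 w.
  rewrite /f (_ : count _ _ = 0%N) ?addr0//.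
  apply/eqP; rewrite -leqn0 leqNgt -has_count; apply/hasPn => x /(allP aj)/andP[x0 _].
  by rewrite -ltNge.
have fE t : 0 <= t <= 1 -> f t = X 0 w + (count (fun r => r <= tchange u e t) (jumps w))%:Z.
  move=> t01; rewrite /f; congr (_ + Posz _); rewrite count_map.
  apply: eq_in_count => r /(allP (jumps_oo w))/andP[r0 r1] /=.
  by rewrite tchange_inv_le// !ltW.
have pf : exists q, has_jumps f q.
  exists (map (tchange_inv u e) (jumps w)); apply: has_jumps_map_tchange_inv.
  - exact: jumps_sorted.
  - exact: jumps_oo.
  - by move=> t; rewrite /f count_clamp.
  - by move=> t t01; rewrite f0; exact: fE.
by exists (Path pf) => t t01; rewrite -(tchange_theta u e t01) /X /= fE// -X_count.
Qed.

Lemma Theta0 w : X 0 (Theta u e w) = X 0 w.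
Proof. by rewrite Theta_spec ?in01_0// -tchange_theta ?in01_0// tchange0. Qed.

Lemma jumps_Theta w : jumps (Theta u e w) = map (tchange_inv u e) (jumps w).
Proof.
apply: has_jumps_uniq (jumpsP _) _; apply: has_jumps_map_tchange_inv.
- exact: jumps_sorted.
- exact: jumps_oo.
- by move=> t; have := X_clamp t (Theta u e w).
- move=> t t01; have := Theta_spec w t01; rewrite -tchange_theta// (X_count (tchange u e t)).
  by rewrite -Theta0.
Qed.

End Theta.
End Paths.

(** * Reading a path on a grid *)

Section Grid.
Context {R : realType}.
Implicit Types (e s t d r : R) (q : seq R) (z : int) (w : Omega R).

Lemma Filt_cylinder t (c : seq (R * int)) : all (fun p => 0 <= p.1 <= t) c ->
  Filt t [set w | all (fun p => X p.1 w == p.2) c].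
Proof.
pose T := g_sigma_algebraType (@gen_upto R t).
suff H : all (fun p => 0 <= p.1 <= t) c ->
  @measurable _ T [set w : path_space R | all (fun p => X p.1 w == p.2) c] by [].
elim: c => [_|[s z] c IH] /=.
  rewrite (_ : [set _ | _] = setT); first exact: measurableT.
  by apply/seteqP; split.
move=> /andP[st /IH mc].
rewrite (_ : [set _ | _] = [set w : path_space R | [set z] (w s)] `&`
  [set w : path_space R | all (fun p => X p.1 w == p.2) c]); last first.
  apply/seteqP; split=> w /=; first by move=> /andP[/eqP].
  by move=> [] xw cw; apply/andP; split=> //; apply/eqP.
apply: measurableI => //; apply: sub_sigma_algebra.
by exists s, [set z].
Qed.

Lemma Filt_measurable t (A : set (Omega R)) : t <= 1 -> Filt t A -> measurable A.
Proof.
move=> t1; apply: sub_sigma_algebra2 => B [s [C [/andP[s0 st] ->]]].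
by exists s, C; split=> //; rewrite s0 (le_trans st).
Qed.

(** A function of finitely many integers is measurable, whatever it is: its
    preimages are countable unions of cylinders. *)
Lemma measurable_skeleton K (s : nat -> R) (G : (nat -> int) -> R) :
  (forall i, (i < K)%N -> 0 <= s i <= 1) ->
  (forall f g, (forall i, (i < K)%N -> f i = g i) -> G f = G g) ->
  measurable_fun setT (fun w : Omega R => G (fun i => X (s i) w)).
Proof.
move=> s01 GE _ B mB; rewrite setTI.
pose ext (c : {ffun 'I_K -> int}) (i : nat) : int :=
  if insub i is Some j then c j else 0.
pose A (c : {ffun 'I_K -> int}) : set (Omega R) := if G (ext c) \in B then
   [set w | all (fun p => X p.1 w == p.2) [seq (s (val i), c i) | i <- enum 'I_K]] else set0.
rewrite (_ : _ @^-1` _ = \bigcup_c A c); last first.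
  apply/seteqP; split=> w /=.
    move=> Gw; pose c := [ffun i : 'I_K => X (s i) w]; exists c => //.
    rewrite /A; have -> : G (ext c) = G (fun i => X (s i) w).
      apply: GE => i iK; rewrite /ext insubT//=; first by rewrite ffunE.
    have -> : G (fun i => X (s i) w) \in B by rewrite inE.
    by rewrite /= all_map; apply/allP => i _ /=; rewrite ffunE.
  move=> [c _]; rewrite /A; case: ifPn => // + /=.
  rewrite inE all_map => GB /allP Hc.
  have <- // : G (ext c) = G (fun i => X (s i) w).
  apply: GE => i iK; rewrite /ext insubT//=.
  by have /eqP/esym := Hc (Ordinal iK) (mem_enum _ _).
apply: countable_bigcupT_measurable; first exact: countableP.
move=> c; rewrite /A; case: ifPn => _; last exact: measurable0.
apply: (Filt_measurable (lexx 1)); apply: Filt_cylinder.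
by rewrite all_map; apply/allP => i _ /=; exact: s01.
Qed.

Definition grid N j : R := j%:R / N.+1%:R.

Lemma grid_in01 N j : (j <= N.+1)%N -> 0 <= grid N j <= 1.
Proof.
move=> jN; rewrite /grid divr_ge0//= ler_pdivrMr// mul1r ler_nat//.
Qed.

Lemma gridS N j : grid N j.+1 = grid N j + N.+1%:R^-1.
Proof. by rewrite /grid -natr1 mulrDl mul1r. Qed.

Lemma grid0 N : grid N 0 = 0. Proof. by rewrite /grid mul0r. Qed.
Lemma grid1 N : grid N N.+1 = 1. Proof. by rewrite /grid divff. Qed.

Lemma grid_lt N j : grid N j < grid N j.+1.
Proof. by rewrite gridS ltrDl. Qed.

(** Each jump is moved to the next grid point. The list at rank [j] is then a
    function of the path at the grid points up to [j], hence known at time [grid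
    N j]. *)
Fixpoint grid_jumps N (k : nat -> nat) j : seq R :=
  if j is j'.+1 then grid_jumps N k j' ++ nseq (k j - k j') (grid N j) else [::].

Lemma grid_jumps_ext N k k' j : (forall i, (i <= j)%N -> k i = k' i) ->
  grid_jumps N k j = grid_jumps N k' j.
Proof.
elim: j => //= j IH kk'; rewrite IH ?kk'// => i ij.
by rewrite kk'// leqW.
Qed.

Definition grid_count N w j : nat := count (fun r => r <= grid N j) (jumps w).

Lemma grid_count0 N w : grid_count N w 0 = 0%N.
Proof.
rewrite /grid_count grid0; apply/eqP; rewrite -leqn0 leqNgt -has_count.
by apply/hasPn => x /(allP (jumps_oo w))/andP[x0 _]; rewrite -ltNge.
Qed.

Lemma grid_countE N w j : grid_count N w j = `|X (grid N j) w - X 0 w|%N.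
Proof. by rewrite X_count addrC addKr absz_nat. Qed.

Lemma grid_count_mono N w i j : (i <= j)%N -> (grid_count N w i <= grid_count N w j)%N.
Proof.
move=> ij; apply: sub_count => r /= /le_trans; apply.
by rewrite /grid ler_pM2r// ler_nat.
Qed.

Lemma grid_count1 N w : grid_count N w N.+1 = size (jumps w).
Proof.
rewrite /grid_count grid1; apply/eqP; rewrite -all_count.
by apply: sub_all (jumps_oo w) => r /andP[_]; exact: ltW.
Qed.

Lemma size_grid_jumps N k j : k 0%N = 0%N -> (forall i, (i < j)%N -> (k i <= k i.+1)%N) ->
  size (grid_jumps N k j) = k j.
Proof.
move=> k0; elim: j => [|j IH] kk /=; first by rewrite k0.
rewrite size_cat size_nseq IH; first by rewrite subnKC// kk.
by move=> i ij; rewrite kk// leqW.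
Qed.

Lemma size_grid_jumps_grid_count N w j : size (grid_jumps N (grid_count N w) j) = grid_count N w j.
Proof.
by rewrite size_grid_jumps ?grid_count0// => i _; rewrite grid_count_mono.
Qed.

Lemma filter_le_nil q r s : path <%R r q -> s < r -> [seq a <- q | a <= s] = [::].
Proof.
move=> rq sr; apply/eqP; rewrite -(negbK (_ == _)) -has_filter; apply/hasPn => a aq.
rewrite -ltNge (lt_trans sr)//; exact: (allP (order_path_min lt_trans rq)).
Qed.

Lemma filter_le_cat q s t : sorted <%R q -> s <= t ->
  [seq r <- q | r <= t] =
  [seq r <- q | r <= s] ++ [seq r <- q | s < r <= t].
Proof.
move=> + st; elim: q => //= r q IH rq; have [rs|sr] := leP r s.
  by rewrite (le_trans rs st) /= IH// (path_sorted rq).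
have := IH (path_sorted rq); rewrite (filter_le_nil rq sr) /= => ->.
by case: ifP.
Qed.

Lemma near_seq_nseq d m s q : size q = m -> all (fun r => `|s - r| < d) q ->
  near_seq d (nseq m s) q.
Proof. by elim: m q => [|m IH] [|r q] //= [qm] /andP[-> /IH ->]. Qed.

Lemma grid_jumps_near N w j d : N.+1%:R^-1 < d ->
  near_seq d (grid_jumps N (grid_count N w) j) [seq r <- jumps w | r <= grid N j].
Proof.
move=> Nd; elim: j => [|j IH] /=.
  rewrite (_ : seq.filter _ _ = [::])//; apply: size0nil.
  by rewrite size_filter -[LHS]/(grid_count N w 0) grid_count0.
rewrite (filter_le_cat (jumps_sorted w) (ltW (grid_lt N j))).
apply: near_seq_cat => //; apply: near_seq_nseq.
  apply/eqP; rewrite -(eqn_add2l (grid_count N w j)) subnKC ?grid_count_mono//.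
  have := congr1 size (filter_le_cat (jumps_sorted w) (ltW (grid_lt N j))).
  by rewrite size_cat !size_filter /grid_count => ->.
apply/allP => r; rewrite mem_filter gridS => /andP[/andP[h1 h2] _].
have N0 : 0 < N.+1%:R^-1 :> R by rewrite invr_gt0.
move: Nd h2 N0; move: (N.+1%:R^-1 : R) => x Nd h2 N0.
rewrite ltr_norml; apply/andP; split; lra.
Qed.

Lemma grid_jumps_near1 N w d : N.+1%:R^-1 < d ->
  near_seq d (grid_jumps N (grid_count N w) N.+1) (jumps w).
Proof.
move=> Nd; have := @grid_jumps_near N w N.+1 d Nd; rewrite (_ : seq.filter _ _ = jumps w)//.
apply/all_filterP; rewrite grid1.
by apply: sub_all (jumps_oo w) => r /andP[_]; exact: ltW.
Qed.

Lemma near_invn d : 0 < d -> \forall N \near \oo, (N.+1%:R^-1 : R) < d.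
Proof. by move=> d0; have /= := near_infty_natSinv_lt (PosNum d0). Qed.

Lemma BUC_grid_jumps_cvg n (F : seq R -> R) w : BUC n F -> size (jumps w) = n ->
  F (grid_jumps N (grid_count N w) N.+1) @[N --> \oo] --> F (jumps w).
Proof.
move=> [_ uF] wn; apply/cvgrPdist_lt => e /uF[d d0 Hd].
near=> N; rewrite distrC; apply: Hd; first by rewrite size_grid_jumps_grid_count grid_count1.
by apply: grid_jumps_near1; near: N; exact: near_invn.
Unshelve. all: by end_near. Qed.

(** Every functional below factors through the initial state and the list of
    jumps. Moving the jumps to a grid makes it a function of finitely many
    integers, and it is recovered in the limit by uniform continuity. *)
Lemma measurable_jumps (g : int -> seq R -> R) : (forall z n, BUC n (g z)) ->
  measurable_fun setT (fun w : Omega R => g (X 0 w) (jumps w)).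
Proof.
move=> Hg.
apply: (@measurable_fun_cvg _ _ _ setT
  (fun N w => g (X 0 w) (grid_jumps N (grid_count N w) N.+1))); last first.
  by move=> w _; apply: (BUC_grid_jumps_cvg (Hg (X 0 w) (size (jumps w)))).
move=> N.
pose G (f : nat -> int) := g (f 0%N) (grid_jumps N (fun i => `|f i - f 0%N|%N) N.+1).
rewrite (_ : (fun w => _) = (fun w => G (fun i => X (grid N i) w))); last first.
  apply/funext => w; rewrite /G grid0; congr (g _ _).
  by apply: grid_jumps_ext => i _; rewrite grid_countE.
apply: (@measurable_skeleton N.+2 (grid N) G).
  by move=> i; rewrite ltnS; exact: grid_in01.
move=> f f' ff'; rewrite /G ff'//; congr (g _ _); apply: grid_jumps_ext => i iN.
by rewrite ff'.
Qed.

End Grid.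

(** * The compensator *)

Section Compensator.
Context {R : realType}.
Implicit Types (e s t d r : R) (q : seq R) (z : int) (w : Omega R).
Variable l : R -> int -> R.
Hypothesis Hl : NMC l.

Lemma rate_bound : exists2 C : R, 0 < C & forall t z, 0 <= t <= 1 -> 0 <= l t z <= C.
Proof.
have [l0 [C HC] _] := Hl; exists C => [|t z t01]; last by rewrite HC// ltW// l0.
exact: lt_le_trans (l0 0 0 in01_0) (HC 0 0 in01_0).
Qed.

Lemma measurable_count_comp (h : int -> R -> R) q z : (forall z, measurable_fun setT (h z)) ->
  measurable_fun setT (fun s => h (z + (count (fun r => r < s) q)%:Z) s).
Proof.
move=> mh; elim: q z => [|r q IH] z /=.
  by rewrite (_ : (fun s => _) = h z)//; apply/funext => s; rewrite addr0.
rewrite (_ : (fun s => _) = (fun s => if r < s then h (z + 1 + (count (fun r => r < s) q)%:Z) s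
   else h (z + (count (fun r => r < s) q)%:Z) s)).
  by apply: measurable_fun_ifT => //; exact: measurable_fun_ltr.
by apply/funext => s; case: ifP => _ /=; rewrite ?add0n// PoszD addrA.
Qed.

Definition rate_along w s : R := l s (Xminus s w).

Lemma integrable_rate_along w :
  lebesgue_measure.-integrable `[0, 1] (EFin \o rate_along w).
Proof.
have [C C0 HC] := rate_bound.
have mf : measurable_fun setT (fun s => l (clamp s) (Xminus s w)).
  under eq_fun do rewrite Xminus_count.
  apply: (@measurable_count_comp (fun z s => l (clamp s) z)) => z.
  exact: continuous_measurable_fun (@rate_continuous _ _ Hl z).
have : lebesgue_measure.-integrable `[0, 1] (EFin \o (fun s => l (clamp s) (Xminus s w))).
  apply: measurable_bounded_integrable => //=.
  - by rewrite lebesgue_measure_itv /= lte_fin ltr01 sube0 ltry.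
  - exact: measurable_funTS.
  - exists C; split; first by rewrite num_real.
    move=> y Cy s _ /=; have /andP[h0 h1] := HC _ (Xminus s w) (clamp_in s).
    by rewrite ger0_norm// (le_trans h1)// ltW.
apply: eq_integrable => // s; rewrite inE /= in_itv /= /rate_along => s01.
by rewrite clamp_id.
Qed.

(** All that is needed of the compensator: its growth [I] is bounded by the
    bound on the rates, and over an interval without a jump it is the increase
    of the cumulated rate of the current state. *)
Lemma compensated_incr w s t (C : R) :
  (forall t z, 0 <= t <= 1 -> 0 <= l t z <= C) ->
  0 <= s -> s <= t -> t <= 1 ->
  exists I : R, [/\ compensated l t w - compensated l s w = (X t w - X s w)%:~R - I,
    0 <= I <= C * (t - s) &
    X s w = X t w -> I = cumrate l (X s w) t - cumrate l (X s w) s].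
Proof.
move=> HC s0 st t1; exists (\int[lebesgue_measure]_(r in `]s, t]) rate_along w r).
have i01 := integrable_rate_along w.
have i0t : lebesgue_measure.-integrable `[0, t] (EFin \o rate_along w).
  apply: integrableS i01 => //.
  by move=> r /=; rewrite !in_itv /= => /andP[? ?]; apply/andP; split; lra.
have ist : lebesgue_measure.-integrable `]s, t] (EFin \o rate_along w).
  apply: integrableS i01 => //.
  by move=> r /=; rewrite !in_itv /= => /andP[? ?]; apply/andP; split; lra.
have mst : fine (lebesgue_measure `]s, t]%classic) = t - s.
  rewrite lebesgue_measure_itv /= lte_fin; case: ifPn => //=.
  by rewrite -leNgt => ts; apply/esym/eqP; rewrite subr_eq0 eq_le ts st.
have mfin : (lebesgue_measure `]s, t]%classic < +oo)%E.
  by rewrite lebesgue_measure_itv /=; case: ifP => _; rewrite ?ltry// -EFinB ltry.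
have fb r : `]s, t]%classic r -> 0 <= rate_along w r <= C.
  rewrite /= in_itv /= => /andP[? ?]; apply: HC; apply/andP; split; lra.
split.
- rewrite /compensated.
  have := @Rintegral_itvB _ (rate_along w) (BLeft 0) (BRight t) s i0t.
  rewrite !bnd_simp => /(_ s0 st) <-.
  by rewrite /rate_along !intrD !rmorphN; ring.
- apply/andP; split.
    by apply: Rintegral_ge0 => r rst; case/andP: (fb r rst).
  rewrite -mst -Rintegral_cst//; apply: le_Rintegral => //.
    apply: measurable_bounded_integrable => //.
    exists C; split; first by rewrite num_real.
    have C0 : 0 <= C by have /andP[] := HC 0 0 in01_0; exact: le_trans.
    by move=> y Cy r _ /=; rewrite ger0_norm// ltW.
  by move=> r rst; case/andP: (fb r rst).
- move=> Xst; rewrite /cumrate /prim.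
  rewrite (@Rintegral_itvB _ _ (BLeft (-1)) (BRight t) s).
  + apply: eq_Rintegral => r; rewrite inE /= in_itv /= => /andP[sr rt].
    rewrite /rate_along clamp_id; last by apply/andP; split; lra.
    congr (l r _); rewrite Xminus_count (X_count s); congr (_ + Posz _).
    move: Xst; rewrite (X_count s) (X_count t) => /addrI[] E.
    apply/eqP; rewrite eqn_leq; apply/andP; split.
      by rewrite E; apply: sub_count => a /= /ltW /le_trans; apply.
    by apply: sub_count => a /= /le_lt_trans; apply.
  + apply: continuous_compact_integrable; first exact: segment_compact.
    exact: continuous_subspaceT (@rate_continuous _ _ Hl _).
  + by rewrite bnd_simp; lra.
  + by rewrite bnd_simp.
Qed.

Lemma compensated0 w : compensated l 0 w = 0.
Proof. by rewrite /compensated subrr sub0r set_itv1 Rintegral_set1 oppr0. Qed.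

End Compensator.

(** * Backward values *)

Section Backward.
Context {R : realType}.
Implicit Types (e s t d r : R) (q S : seq R) (z : int) (w : Omega R) (k N j : nat).
Variable l : R -> int -> R.
Hypothesis Hl : NMC l.
Variables (x : int) (n : nat) (F : seq R -> R).
Hypothesis HF : BUC n F.
Local Notation J := (simplex_int (weight l)).
Let cw := @weight_continuous _ _ Hl.
Let bw := @weight_bounded _ _ Hl.

(** Up to the constant factor exp(Lambda_{x+n}(1)), the conditional expectation
    of F(T_1,...,T_n) on the event of [n] jumps, given that [k] jumps have
    occurred before [t], at the instants in the list [S]. *)
Definition backward k t S : R := if (k <= n)%N then
  expR (cumrate l (x + k%:Z) (clamp t)) * J (n - k) (x + k%:Z) (fun q => F (S ++ q)) (clamp t)
  else 0.

(** The change of the backward value if a jump occurs at [t]: the integrand in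
    the martingale representation. *)
Definition backward_jump k t S : R := backward k.+1 t (rcons S t) - backward k t S.

Lemma backward_gt k t S : (n < k)%N -> backward k t S = 0.
Proof. by move=> nk; rewrite /backward leqNgt nk. Qed.

Lemma backward_jump_gt k t S : (n < k)%N -> backward_jump k t S = 0.
Proof. by move=> nk; rewrite /backward_jump !backward_gt ?subrr// ltnW. Qed.

Lemma backward_BUC k : BUC k.+1 (fun q => backward k (head 0 q) (behead q)).
Proof.
rewrite /backward; case: leqP => kn; last exact: BUC_cst.
apply: BUC_mul; last by apply: simplex_int_cat_BUC => //; rewrite subnKC.
pose g t := expR (cumrate l (x + k%:Z) (clamp t)).
have cg : continuous g.
  move=> t; apply: (@continuous_comp _ _ _ (fun t => cumrate l (x + k%:Z) (clamp t)) expR).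
    exact: (@cumrate_clamp_continuous _ _ Hl).
  exact: continuous_expR.
have gc t : g (clamp t) = g t by rewrite /g clampK.
apply: BUC_ext (BUC_comp_tail (clamped_unif_cont cg gc) (clamped_bounded cg gc) (BUC_cst k 1)).
by move=> q _; rewrite mulr1.
Qed.

(** Only the [n + 1] values [k <= n] matter, so that a common modulus exists. *)
Lemma backward_unif_cont e : 0 < e -> exists2 d : R, 0 < d & forall k t t' S S',
  size S = k -> near_seq d S S' -> `|t - t'| < d -> `|backward k t S - backward k t' S'| < e.
Proof.
move=> e0.
suff Wn m : exists2 d : R, 0 < d & forall k t t' S S', (k <= m)%N ->
    size S = k -> near_seq d S S' -> `|t - t'| < d -> `|backward k t S - backward k t' S'| < e.
  have [d d0 Hd] := Wn n; exists d => // k t t' S S'; have [kn|nk] := leqP k n; first exact: Hd.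
  by move=> *; rewrite !backward_gt// subrr normr0.
have W k : exists2 d : R, 0 < d & forall t t' S S', size S = k -> near_seq d S S' ->
    `|t - t'| < d -> `|backward k t S - backward k t' S'| < e.
  have [_ /(_ e e0)[d d0 Hd]] := backward_BUC k; exists d => // t t' S S' Sk SS' tt'.
  have := Hd (t :: S) (t' :: S'); apply; first by rewrite /= Sk.
  by rewrite /near_seq /= tt'.
elim: m => [|m [d d0 Hd]].
  have [d d0 Hd] := W 0%N; exists d => // k t t' S S'; rewrite leqn0 => /eqP ->.
  exact: Hd.
have [d' d'0 Hd'] := W m.+1; exists (Num.min d d'); first by rewrite lt_min d0.
move=> k t t' S S' + Sk SS'; rewrite lt_min => km /andP[td td'].
move: km; rewrite leq_eqVlt => /predU1P[km|km].
  rewrite km; apply: Hd'; rewrite -?km//; exact: near_seq_minr SS'.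
by apply: Hd => //; exact: near_seq_minl SS'.
Qed.

Lemma backward_bounded : exists2 B : R, 0 < B & forall k t S, size S = k -> `|backward k t S| <= B.
Proof.
suff Wn m : exists2 B : R, 0 < B & forall k t S, (k <= m)%N -> size S = k ->
    `|backward k t S| <= B.
  have [B B0 HB] := Wn n; exists B => // k t S; have [kn|nk] := leqP k n; first exact: HB.
  by move=> *; rewrite !backward_gt// normr0 ltW.
have W k : exists2 B : R, 0 < B & forall t S, size S = k -> `|backward k t S| <= B.
  have [[B HB] _] := backward_BUC k; exists (`|B| + 1); first by rewrite ltr_wpDl.
  move=> t S Sk; have := HB (t :: S) => /= H; rewrite (le_trans (H _)) ?Sk//.
  by rewrite (le_trans (ler_norm _))// lerDl.
elim: m => [|m [B B0 HB]].
  have [B B0 HB] := W 0%N; exists B => // k t S; rewrite leqn0 => /eqP ->.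
  exact: HB.
have [B' B'0 HB'] := W m.+1; exists (B + B'); first by rewrite addr_gt0.
move=> k t S; rewrite leq_eqVlt => /predU1P[->|km] Sk.
  by rewrite (le_trans (HB' _ _ Sk))// lerDr ltW.
by rewrite (le_trans (HB _ _ _ _ Sk))// lerDl ltW.
Qed.

Lemma backward_jump_bounded (B : R) : (forall k t S, size S = k -> `|backward k t S| <= B) ->
  forall k t S, size S = k -> `|backward_jump k t S| <= 2 * B.
Proof.
move=> HB k t S Sk; rewrite (le_trans (ler_normB _ _))// mulr2n mulrDl mul1r lerD//.
  by apply: HB; rewrite size_rcons Sk.
exact: HB.
Qed.

Lemma backward_continuous k S : size S = k -> continuous (fun t => backward k t S).
Proof.
move=> Sk t; apply: dist_near_cvg => e /backward_unif_cont[d d0 Hd]; exists d => // s st.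
by apply: Hd => //; exact: near_seq_refl.
Qed.

Local Opaque prim expR.

(** The backward equation. Differentiating the exponential reproduces the value,
    with the rate as a factor; differentiating the iterated integral in its
    lower bound opens the list [S] to a jump at [t], and the weight of that jump
    turns the cumulated rate of [x + k] into that of [x + k + 1]. *)
Lemma is_derive_backward k t S : size S = k -> 0 < t < 1 ->
  is_derive t 1 (fun t => backward k t S) (- (l t (x + k%:Z) * backward_jump k t S)).
Proof.
move=> Sk t01; have t01' : 0 <= t <= 1 by case/andP: t01 => *; rewrite !ltW.
have [nk|kn] := ltnP n k.
  rewrite backward_jump_gt// mulr0 oppr0 (_ : (fun t => _) = cst 0); first exact: is_derive_cst.
  by apply/funext => s; rewrite backward_gt.
(* near an interior point [clamp] disappears *)
have nearE (f : R -> R) d : is_derive t 1 f d -> (forall s, 0 < s < 1 -> f s = backward k s S) ->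
    is_derive t 1 (fun t => backward k t S) d.
  move=> H fE; apply: (near_eq_is_derive _ H).
  have : \forall s \near t, s \in `]0, 1[ by apply: near_in_itvoo; rewrite in_itv.
  by apply: filterS => s; rewrite in_itv /=; exact: fE.
set z := x + k%:Z.
have dE : is_derive t 1 (expR \o cumrate l z) (expR (cumrate l z t) * l t z).
  have := is_derive_cumrate Hl z t01' => ?; exact: is_derive1_comp.
move: kn; rewrite leq_eqVlt => /predU1P[kn|kn].
  apply: (nearE ((expR \o cumrate l z) * cst (F S)) _ _).
    have H := is_deriveM dE (is_derive_cst (F S) t 1).
    apply: is_derive_eq H _.
    rewrite /backward_jump backward_gt ?kn// sub0r /backward -kn leqnn subnn /=.
    rewrite cats0 clamp_id// /GRing.scale /= mulr0 add0r -/z; ring.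
  move=> s /andP[s0 s1]; rewrite /backward kn leqnn subnn /= cats0 clamp_id ?ltW//.
  by rewrite /z kn.
have nk : (n - k = (n - k.+1).+1)%N by rewrite subnSK.
have HS : BUC (n - k.+1).+1 (fun q => F (S ++ q)).
  by rewrite -nk; apply: BUC_cat Sk _; rewrite subnKC// ltnW.
have dJ := is_derive_simplex_int cw bw z HS t01'.
apply: (nearE ((expR \o cumrate l z) * (J (n - k.+1).+1 z (fun q => F (S ++ q)))) _ _).
  have H := is_deriveM dE dJ.
  apply: is_derive_eq H _.
  have kn' : (k <= n)%N by exact: ltnW.
  rewrite /backward_jump /backward kn' kn clamp_id// nk -/z.
  have -> : x + k.+1%:Z = z + 1 by rewrite /z -addn1 PoszD addrA.
  have -> : J (n - k.+1) (z + 1) (fun q => F (rcons S t ++ q)) t =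
            J (n - k.+1) (z + 1) (fun q => F (S ++ t :: q)) t.
    by apply: simplex_int_ext => q _; rewrite cat_rcons.
  (* the choice of the weight: it trades the exponential of the state left for
     that of the state entered *)
  have Ez : expR (cumrate l z t) * weight l z t = l t z * expR (cumrate l (z + 1) t).
    by rewrite /weight clamp_id// mulrCA -expRD addrC subrK.
  rewrite /GRing.scale /= mulrN mulrA Ez.
  move: (prim _ 1 - prim _ _) (J _ _ _ _) => j1 j2; ring.
by move=> s /andP[s0 s1]; rewrite /backward (ltnW kn) nk clamp_id// !ltW.
Qed.

(** Without a jump the backward value and the compensator cancel to first order:
    the mean value theorem applies to their sum, whose derivative is the rate
    times the variation of [backward_jump], by the backward equation. *)
Lemma backward_cell (C e s t : R) k S : (forall t z, 0 <= t <= 1 -> 0 <= l t z <= C) ->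
  size S = k -> 0 <= s -> s <= t -> t <= 1 ->
  (forall r, s <= r <= t -> `|backward_jump k r S - backward_jump k s S| <= e) ->
  `|backward k t S - backward k s S +
     backward_jump k s S * (cumrate l (x + k%:Z) t - cumrate l (x + k%:Z) s)|
    <= C * e * (t - s).
Proof.
move=> HC Sk s0 st t1 He; set z := x + k%:Z; set H := backward_jump k s S.
pose g r := backward k r S + H * cumrate l z r.
have cg : {within `[0, 1], continuous g}.
  apply: within_continuousD; first exact: continuous_subspaceT (backward_continuous Sk).
  apply: derivable_within_continuous => r; rewrite in_itv /= => r01.
  have [] := is_deriveZ H (is_derive_cumrate Hl z r01); by [].
have dg r : 0 < r < 1 -> is_derive r 1 g (l r z * (H - backward_jump k r S)).
  move=> r01; have r01' : 0 <= r <= 1 by case/andP: r01 => *; rewrite !ltW.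
  have K := is_deriveD (is_derive_backward Sk r01) (is_deriveZ H (is_derive_cumrate Hl z r01')).
  apply: is_derive_eq K _; rewrite /GRing.scale /= -/z; ring.
have s01 : 0 <= s <= 1 by apply/andP; split; lra.
have t01 : 0 <= t <= 1 by apply/andP; split; lra.
have [c c01 [cs [ct E]]] := MVT01 cg dg s01 t01.
have -> : backward k t S - backward k s S + H * (cumrate l z t - cumrate l z s) = g t - g s.
  by rewrite /g; ring.
have ts0 : 0 <= t - s by lra.
rewrite E normrM (ger0_norm ts0) ler_wpM2r// normrM.
have /andP[l0 lC] := HC c z c01.
apply: ler_pM => //; first by rewrite (ger0_norm l0).
rewrite distrC; apply: He.
rewrite (ger0_norm ts0) in cs ct.
move: cs ct; rewrite !ler_norml => /andP[? ?] /andP[? ?].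
apply/andP; split; lra.
Qed.

End Backward.

(** * Discrete stochastic integrals along a path *)

Section GridSums.
Context {R : realType}.
Implicit Types (e s t d r : R) (q S : seq R) (z : int) (w : Omega R) (k N j : nat).

(** The instants are distinct, so that a fine grid has at most one of them in
    each cell. *)
Lemma jump_gap q : sorted <%R q -> exists2 g : R, 0 < g & forall s h : R, h < g ->
  (count (fun r => r <= s + h)%R q <= (count (fun r => r <= s)%R q).+1)%N.
Proof.
elim: q => [_|r q IH rq]; first by exists 1.
have [g g0 Hg] := IH (path_sorted rq).
have [g' g'0 [g'g Hg']] : exists2 g' : R, 0 < g' & g' <= g /\ {in q, forall r', r + g' <= r'}.
  case: q {IH Hg} rq => [_|r' q] /=; first by exists g.
  move=> /andP[rr' r'q]; exists (Num.min g (r' - r)); first by rewrite lt_min g0 subr_gt0.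
  split; first by rewrite ge_min lexx.
  have m1 : r + Num.min g (r' - r) <= r'.
    by rewrite -lerBrDl ge_min lexx orbT.
  move=> a; rewrite inE => /predU1P[->//|aq]; apply: (le_trans m1); apply: ltW.
  exact: (allP (order_path_min lt_trans r'q)).
exists g' => // s h hg /=.
have H := Hg s h (lt_le_trans hg g'g).
have [rs|sr] := leP r s.
  by case: (r <= s + h); rewrite /= ?add1n ?add0n ?ltnS// (leq_trans H).
rewrite add0n; have [rsh|_] := leP r (s + h); last by rewrite add0n.
rewrite add1n ltnS (_ : count _ q = 0%N)//.
apply/eqP; rewrite -leqn0 leqNgt -has_count; apply/hasPn => a /Hg' ra.
by rewrite -ltNge; lra.
Qed.

Variable l : R -> int -> R.
Hypothesis Hl : NMC l.
Variables (x : int) (n : nat) (F : seq R -> R).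
Hypothesis HF : BUC n F.
Local Notation backward := (backward l x n F).
Local Notation backward_jump := (backward_jump l x n F).

Definition grid_value N w j : R :=
  backward (grid_count N w j) (grid N j) (grid_jumps N (grid_count N w) j).
Definition grid_integrand N w j : R :=
  backward_jump (grid_count N w j) (grid N j) (grid_jumps N (grid_count N w) j).
Definition stopped_comp (tau : R) N w j : R := compensated l (Num.min (grid N j) tau) w.

Variables (B C : R).
Hypothesis HB : forall k t S, size S = k -> `|backward k t S| <= B.
Hypothesis HC : forall t z, 0 <= t <= 1 -> 0 <= l t z <= C.

Let B0 : 0 <= B.
Proof. exact: le_trans (normr_ge0 _) (@HB 0%N 0 [::] erefl). Qed.
Let C0 : 0 <= C.
Proof. by have /andP[] := HC 0 in01_0; exact: le_trans. Qed.

Lemma grid_integrand_bound N w j : `|grid_integrand N w j| <= 2 * B.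
Proof. by apply: backward_jump_bounded HB _ _ _ _; exact: size_grid_jumps_grid_count. Qed.

Lemma min_grid_in01 N j (tau : R) : (j <= N.+1)%N -> 0 <= tau <= 1 ->
  0 <= Num.min (grid N j) tau <= 1.
Proof.
move=> jN /andP[t0 t1]; have /andP[g0 g1] := @grid_in01 R N j jN.
by rewrite le_min g0 t0 ge_min t1 orbT.
Qed.

(** The increments of the compensated process are dominated by those of the path
    plus those of a linear compensator, and these telescope. The bound depends
    neither on the grid nor on the stopping time. *)
Lemma grid_sum_bound (tau : R) N w : 0 <= tau <= 1 ->
  `|\sum_(0 <= j < N.+1) grid_integrand N w j *
      (stopped_comp tau N w j.+1 - stopped_comp tau N w j)|
    <= 2 * B * ((X 1 w - X 0 w)%:~R + C).
Proof.
move=> tau01; have [tau0 tau1] := andP tau01.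
pose m j := Num.min (grid N j) tau.
(* each increment of the compensated process is at most one of [Y] *)
pose Y j := (X (m j) w)%:~R + C * m j.
apply: (le_trans (ler_norm_sum _ _ _)).
apply: (@le_trans _ _ (\sum_(0 <= j < N.+1) 2 * B * (Y j.+1 - Y j))).
  rewrite !big_nat; apply: ler_sum => j /andP[_ jN].
  have /andP[a0 a1] : 0 <= m j <= 1 by apply: min_grid_in01 => //; exact: ltnW.
  have /andP[b0 b1] : 0 <= m j.+1 <= 1 by exact: min_grid_in01.
  have ab : m j <= m j.+1.
    by rewrite /m le_min !ge_min lexx orbT (ltW (grid_lt N j)).
  have [I [E /andP[I0 IC] _]] := compensated_incr Hl w HC a0 ab b1.
  rewrite normrM ler_pM//; first exact: grid_integrand_bound.
  rewrite /stopped_comp E; apply: (le_trans (ler_normB _ _)).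
  rewrite (ger0_norm I0) ger0_norm ?ler0z ?subr_ge0 ?X_mono// intrD rmorphN /Y; lra.
rewrite -big_distrr /= telescope_sumr// ler_wpM2l ?mulr_ge0//.
rewrite /Y /m grid1 grid0 (min_l tau0) (min_r tau1) mulr0 addr0.
have : X tau w <= X 1 w by exact: X_mono.
rewrite -(ler_int R) intrD rmorphN => h.
have : C * tau <= C by rewrite ler_piMr.
lra.
Qed.

Section Cell.
Variables (e d : R) (N : nat) (w : Omega R).
Hypothesis e0 : 0 < e.
Hypothesis X0 : X 0 w = x.
Hypothesis Nd : N.+1%:R^-1 < d.
Hypothesis Hd : forall k t t' S S', size S = k -> near_seq d S S' ->
  `|t - t'| < d -> `|backward k t S - backward k t' S'| < e.

Let d0 : 0 < d. Proof. by apply: lt_trans Nd; rewrite invr_gt0. Qed.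

(** In a cell without a jump this is [backward_cell]. In a cell with one jump,
    the jump is moved to the right end, where the backward value has changed by
    [backward_jump] up to uniform continuity; the compensator is then
    negligible, and such cells are as many as the jumps. *)
Lemma grid_cell_error j : (j <= N)%N -> (grid_count N w j.+1 <= (grid_count N w j).+1)%N ->
  `|grid_value N w j.+1 - grid_value N w j -
     grid_integrand N w j * (stopped_comp 1 N w j.+1 - stopped_comp 1 N w j)|
    <= C * (2 * e) * N.+1%:R^-1 +
       (grid_count N w j.+1 - grid_count N w j)%N%:R * (e + 2 * B * (C * N.+1%:R^-1)).
Proof.
move=> jN dj.
have /andP[a0 a1] := @grid_in01 R N j (leqW jN).
have /andP[b0 b1] := @grid_in01 R N j.+1 jN.
have ab : grid N j <= grid N j.+1 :> R by exact: ltW (grid_lt N j).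
have abd : grid N j.+1 - grid N j = N.+1%:R^-1 :> R by rewrite gridS addrC addKr.
have [I [E I0C Ieq]] := compensated_incr Hl w HC a0 ab b1.
rewrite abd in I0C; have /andP[I0 IC] := I0C.
rewrite /stopped_comp !min_l// E.
have Sk := size_grid_jumps_grid_count N w j.
have N0 : 0 <= N.+1%:R^-1 :> R by rewrite invr_ge0.
have Xj i : X (grid N i) w = x + (grid_count N w i)%:Z by rewrite X_count X0.
have := grid_count_mono N w (leqnSn j).
rewrite leq_eqVlt => /predU1P[kk|kk].
- have Sj : grid_jumps N (grid_count N w) j.+1 = grid_jumps N (grid_count N w) j :> seq R.
    by rewrite /= -kk subnn cats0.
  rewrite -kk subnn mul0r addr0 Xj Xj -kk subrr sub0r.
  rewrite Ieq ?Xj -?kk// /grid_value /grid_integrand Sj -kk mulrN opprK -abd.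
  apply: (backward_cell Hl HF HC Sk a0 ab b1) => r /andP[jr rj].
  have rd : `|r - grid N j| < d.
    by apply: le_lt_trans Nd; rewrite -abd ger0_norm; lra.
  rewrite /backward_jump.
  have h1 : `|backward (grid_count N w j).+1 r (rcons (grid_jumps N (grid_count N w) j) r) -
      backward (grid_count N w j).+1 (grid N j)
        (rcons (grid_jumps N (grid_count N w) j) (grid N j))| < e.
    apply: Hd => //; first by rewrite size_rcons Sk.
    rewrite -!cats1; apply: near_seq_cat; first exact: near_seq_refl.
    by rewrite /near_seq /= rd.
  have h2 : `|backward (grid_count N w j) r (grid_jumps N (grid_count N w) j) -
      backward (grid_count N w j) (grid N j) (grid_jumps N (grid_count N w) j)| < e.
    by apply: Hd => //; exact: near_seq_refl.
  move: h1 h2; set v1 := backward _ _ _; set v2 := backward _ _ _.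
  set v3 := backward _ _ _; set v4 := backward _ _ _ => h1 h2.
  rewrite (_ : v1 - v3 - (v2 - v4) = (v1 - v2) - (v3 - v4)); last by ring.
  apply: (le_trans (ler_normB _ _)); lra.
- have {}kk : grid_count N w j.+1 = (grid_count N w j).+1 by apply/eqP; rewrite eqn_leq dj.
  have Sj : grid_jumps N (grid_count N w) j.+1 =
      rcons (grid_jumps N (grid_count N w) j) (grid N j.+1) :> seq R.
    by rewrite /= kk subSnn /= cats1.
  rewrite !Xj kk subSnn mul1r.
  have -> : (x + (grid_count N w j).+1%:Z - (x + (grid_count N w j)%:Z))%:~R = 1 :> R.
    by rewrite opprD addrACA subrr add0r -addn1 PoszD addrAC subrr add0r.
  rewrite /grid_value kk Sj /grid_integrand.
  have h1 : `|backward (grid_count N w j).+1 (grid N j.+1)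
        (rcons (grid_jumps N (grid_count N w) j) (grid N j.+1)) -
      backward (grid_count N w j).+1 (grid N j)
        (rcons (grid_jumps N (grid_count N w) j) (grid N j))| < e.
    have rd : `|grid N j.+1 - grid N j| < d by rewrite abd ger0_norm.
    apply: Hd => //; first by rewrite size_rcons Sk.
    rewrite -!cats1; apply: near_seq_cat; first exact: near_seq_refl.
    by rewrite /near_seq /= rd.
  have h2 : `|backward_jump (grid_count N w j) (grid N j) (grid_jumps N (grid_count N w) j) * I| <=
     2 * B * (C * N.+1%:R^-1).
    by rewrite normrM (ger0_norm I0) ler_pM//; exact: backward_jump_bounded HB _ _ _ Sk.
  have h3 : 0 <= C * (2 * e) * N.+1%:R^-1.
    by rewrite !mulr_ge0// ltW.
  move: h1 h2 h3; rewrite /backward_jump.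
  set v1 := backward _ _ _; set v2 := backward _ _ _.
  set v3 := backward _ _ _ => h1 h2 h3.
  (* the jump contributes 1 to the increment and the compensator [I]: the 1
     cancels the change of the backward value *)
  rewrite (_ : v1 - v3 - (v2 - v3) * (1 - I) = (v1 - v2) + (v2 - v3) * I); last by ring.
  apply: (le_trans (ler_normD _ _)).
  by rewrite -[leLHS]add0r; apply: lerD => //; apply: lerD => //; exact: ltW.
Qed.

Lemma grid_sum_error : (forall j, (grid_count N w j.+1 <= (grid_count N w j).+1)%N) ->
  `|grid_value N w N.+1 - grid_value N w 0 -
     \sum_(0 <= j < N.+1) grid_integrand N w j * (stopped_comp 1 N w j.+1 - stopped_comp 1 N w j)|
    <= C * (2 * e) + (size (jumps w))%:R * (e + 2 * B * (C * N.+1%:R^-1)).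
Proof.
move=> dj; rewrite -telescope_sumr// -sumrB.
apply: (le_trans (ler_norm_sum _ _ _)).
apply: (@le_trans _ _ (\sum_(0 <= j < N.+1) (C * (2 * e) * N.+1%:R^-1 +
       (grid_count N w j.+1 - grid_count N w j)%N%:R * (e + 2 * B * (C * N.+1%:R^-1))))).
  by rewrite !big_nat; apply: ler_sum => j /andP[_ jN]; exact: grid_cell_error.
rewrite big_split /= sumr_const_nat subn0 -big_distrl /=.
rewrite -[X in X + _]mulr_natr divfK// lerD2l// ler_wpM2r//.
  by rewrite addr_ge0 ?(ltW e0)// !mulr_ge0// invr_ge0.
rewrite -natr_sum ler_nat (_ : (\sum_(0 <= i < N.+1) _)%N =
  (grid_count N w N.+1 - grid_count N w 0)%N).
  by rewrite grid_count0 subn0 grid_count1.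
by rewrite telescope_sumn//; exact: grid_count_mono.
Qed.

End Cell.

(** The discrete form of the martingale representation, for every path started
    at [x]: the errors of the cells add up to o(1). *)
Lemma grid_sum_cvg w : X 0 w = x ->
  backward (size (jumps w)) 1 (jumps w) - backward 0 0 [::] -
    \sum_(0 <= j < N.+1) grid_integrand N w j * (stopped_comp 1 N w j.+1 - stopped_comp 1 N w j)
  @[N --> \oo] --> (0 : R).
Proof.
move=> X0; apply/cvgrPdist_le => e' e'0.
set p := size (jumps w).
(* the coefficient of [e] in the total error, once the mesh is below [e]; the
   last 1 pays for moving all jumps to the grid at time 1 *)
pose D := C * 2 + p%:R * (1 + 2 * B * C) + 1.
have D0 : 0 < D.
  by rewrite ltr_wpDl// addr_ge0 ?mulr_ge0// addr_ge0// !mulr_ge0.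
pose e := e' / D; have e0 : 0 < e by rewrite divr_gt0.
have [d d0 Hd] := backward_unif_cont Hl x HF e0.
have [g g0 Hg] := jump_gap (jumps_sorted w).
near=> N.
have Nd : N.+1%:R^-1 < d by near: N; exact: near_invn.
have Ne : N.+1%:R^-1 < e by near: N; exact: near_invn.
have Ng : N.+1%:R^-1 < g by near: N; exact: near_invn.
have dj j : (grid_count N w j.+1 <= (grid_count N w j).+1)%N.
  by rewrite /grid_count gridS; exact: Hg.
have h1 := grid_sum_error e0 X0 Nd Hd dj.
have h2 : `|backward p 1 (grid_jumps N (grid_count N w) N.+1) - backward p 1 (jumps w)| < e.
  apply: Hd; first by rewrite size_grid_jumps_grid_count grid_count1.
    exact: grid_jumps_near1.
  by rewrite subrr normr0.
move: h1; rewrite /grid_value grid1 grid0 grid_count1 grid_count0 -/p.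
set s := \sum_(0 <= _ < _) _; move: h2.
set v1 := backward _ _ _; set v2 := backward _ _ _.
set v3 := backward _ _ _ => h2 h1.
rewrite sub0r normrN (_ : v2 - v3 - s = (v1 - v3 - s) - (v1 - v2)); last by ring.
apply: (le_trans (ler_normB _ _)).
have h3 : p%:R * (e + 2 * B * (C * N.+1%:R^-1)) <= p%:R * (e + 2 * B * (C * e)).
  by rewrite ler_wpM2l// lerD2l// ler_wpM2l ?mulr_ge0// ler_wpM2l// ltW.
have <- : D * e = e' by rewrite mulrC divfK// gt_eqF.
rewrite (_ : D * e = (C * (2 * e) + p%:R * (e + 2 * B * (C * e))) + e).
  apply: lerD; last exact: ltW.
  by apply: (le_trans h1); rewrite lerD2l.
by rewrite /D; ring.
Unshelve. all: by end_near. Qed.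

End GridSums.

(** * Mean-zero random variables *)

Section MeanZero.
Context {d : measure_display} {T : measurableType d} {R : realType}.
Variable P : probability T R.
Implicit Types (f g h : T -> R).

(** The second component alone would not do, because the integral of a function
    that is not integrable is given a conventional value. *)
Definition mean_zero f : Prop :=
  P.-integrable setT (EFin \o f) /\ \int[P]_w f w = 0.

Lemma integrable_const (c : R) : P.-integrable setT (EFin \o (fun=> c)).
Proof. exact: finite_measure_integrable_cst. Qed.

Lemma integral_const (c : R) : (\int[P]_w c%:E = c%:E)%E.
Proof. by rewrite integral_cst//= probability_setT mule1. Qed.

Lemma integrable_add f g : P.-integrable setT (EFin \o f) ->
  P.-integrable setT (EFin \o g) -> P.-integrable setT (EFin \o (fun w => f w + g w)).
Proof. by move=> f1 g1; exact: (integrableD measurableT f1 g1). Qed.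

Lemma integrable_sub f g : P.-integrable setT (EFin \o f) ->
  P.-integrable setT (EFin \o g) -> P.-integrable setT (EFin \o (fun w => f w - g w)).
Proof. by move=> f1 g1; exact: (integrableB measurableT f1 g1). Qed.

Lemma integralE_Rintegral f : P.-integrable setT (EFin \o f) ->
  (\int[P]_w (f w)%:E = (\int[P]_w f w)%R%:E)%E.
Proof. by move=> fi; rewrite /Rintegral fineK//; exact: integrable_fin_num. Qed.

Lemma mean_zero0 : mean_zero (fun=> 0).
Proof.
split; first exact: finite_measure_integrable_cst.
by rewrite Rintegral_cst// mul0r.
Qed.

Lemma mean_zeroD f g : mean_zero f -> mean_zero g -> mean_zero (fun w => f w + g w).
Proof.
move=> [f1 f2] [g1 g2]; split; last by rewrite RintegralD// f2 g2 addr0.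
exact: integrableD f1 g1.
Qed.

Lemma mean_zeroZ c f : mean_zero f -> mean_zero (fun w => c * f w).
Proof.
move=> [f1 f2]; split; last by rewrite RintegralZl// f2 mulr0.
exact: integrableZl f1.
Qed.

Lemma mean_zero_sum (I : Type) (s : seq I) (f : I -> T -> R) :
  (forall i, mean_zero (f i)) -> mean_zero (fun w => \sum_(i <- s) f i w).
Proof.
move=> Hf; elim: s => [|i s IH].
  by under eq_fun do rewrite big_nil; exact: mean_zero0.
under eq_fun do rewrite big_cons; exact: mean_zeroD.
Qed.

Lemma mean_zero_ae f g : P.-integrable setT (EFin \o g) ->
  {ae P, forall w, f w = g w} -> mean_zero f -> mean_zero g.
Proof.
move=> ig fg [f1 f2]; split=> //; rewrite -f2; congr fine.
apply: ae_eq_integral => //; [exact: measurable_int ig|exact: measurable_int f1|].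
by apply: filterS fg => w /= ->.
Qed.

Lemma integrable_bounded_mul f g (B : R) : measurable_fun setT f ->
  (forall w, `|f w| <= B) -> P.-integrable setT (EFin \o g) ->
  P.-integrable setT (EFin \o (fun w => f w * g w)).
Proof.
move=> mf fB ig.
have bf : [bounded f w | w in [set: T]].
  exists B; split; first by rewrite num_real.
  by move=> y By w _ /=; rewrite (le_trans (fB w))// ltW.
have := integrableMr measurableT mf bf ig; apply: eq_integrable => //.
Qed.

Lemma integrable_bounded f (B : R) : measurable_fun setT f ->
  (forall w, `|f w| <= B) -> P.-integrable setT (EFin \o f).
Proof.
move=> mf fB; apply: measurable_bounded_integrable => //; first exact: fin_num_fun_lty.
exists B; split; first by rewrite num_real.
by move=> y By w _ /=; rewrite (le_trans (fB w))// ltW.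
Qed.

End MeanZero.

(** * The law of the jump instants *)

Section Law.
Context {R : realType}.
Implicit Types (e s t d r : R) (q S : seq R) (z : int) (w : Omega R) (k N j : nat).
Variable l : R -> int -> R.
Hypothesis Hl : NMC l.
Variables (x : int) (P : probability (Omega R) R).
Hypothesis X0P : {ae P, forall w, X 0 w = x}.
Variable tau : nat -> Omega R -> R.
Hypothesis tau01 : forall N w, 0 <= tau N w <= 1.
Hypothesis tauP : {ae P, forall w, \forall N \near \oo, tau N w = 1}.
Hypothesis Mtau : forall N, martingale P (fun t w => compensated l (Num.min t (tau N w)) w).

Lemma measurable_growth : measurable_fun setT (fun w : Omega R => (X 1 w - X 0 w)%:~R : R).
Proof.
rewrite (_ : (fun w => _) = (fun w => (size (jumps w))%:R)).
  apply: (@measurable_jumps _ (fun _ q => (size q)%:R)) => z m.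
  by apply: (@BUC_ext _ _ (fun=> m%:R)); [move=> q ->|exact: BUC_cst].
by apply/funext => w; rewrite X1_size addrC addKr.
Qed.

(** The constancy of the mean of a martingale that starts from 0. *)
Lemma martingale_start N : (\int[P]_w (compensated l (Num.min 1 (tau N w)) w)%:E = 0)%E.
Proof.
have [_ iM mM] := Mtau N.
have FT : Filt 0 [set: Omega R].
  have := @Filt_cylinder R 0 [::] isT; congr (Filt 0 _).
  by apply/seteqP; split.
rewrite (mM 0 1 setT (lexx _) ler01 (lexx _) FT).
rewrite (_ : (fun w => _) = cst 0%E) ?integral0//.
apply/funext => w /=; rewrite min_l; last by have /andP[] := tau01 N w.
by rewrite compensated0.
Qed.

(** The compensated process is a priori integrable only after stopping. Stopped,
    and increased by the bound [C] on the compensator, it is nonnegative with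
    mean [C], and Fatou's lemma removes the stopping. *)
Lemma integrable_growth : P.-integrable setT (EFin \o (fun w : Omega R => (X 1 w - X 0 w)%:~R : R)).
Proof.
have [C C0 HC] := rate_bound Hl.
have bound w t : 0 <= t <= 1 ->
    [/\ 0 <= compensated l t w + C & t = 1 -> (X 1 w - X 0 w)%:~R <= compensated l t w + C].
  move=> /andP[t0 t1]; have [I [E /andP[I0 IC] _]] := compensated_incr Hl w HC (lexx 0) t0 t1.
  have {}E : compensated l t w = (X t w - X 0 w)%:~R - I.
    by rewrite -E compensated0// subr0.
  have IC' : I <= C by rewrite (le_trans IC)// subr0 ler_piMr// ltW.
  have X0t : 0 <= (X t w - X 0 w)%:~R :> R by rewrite ler0z subr_ge0 X_mono.
  by split=> [|t1']; rewrite E; [lra|rewrite t1' in X0t *; lra].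
pose f N w : \bar R := (compensated l (Num.min 1 (tau N w)) w + C)%:E.
have iM N : P.-integrable setT (EFin \o (fun w => compensated l (Num.min 1 (tau N w)) w)).
  by have [_ + _] := Mtau N; apply; exact: in01_1.
have min01 N w : 0 <= Num.min 1 (tau N w) <= 1.
  by have /andP[? ?] := tau01 N w; rewrite le_min ler01 ge_min lexx /= andbT.
have if_ N : P.-integrable setT (f N).
  exact: integrable_add (iM N) (integrable_const P C).
have mf N : measurable_fun setT (f N) by exact: measurable_int (if_ N).
have f0 N w : setT w -> (0 <= f N w)%E.
  by move=> _; rewrite lee_fin; have [] := bound w _ (min01 N w).
have If N : (\int[P]_w f N w = C%:E)%E.
  rewrite /f; under eq_integral do rewrite EFinD.
  rewrite integralD//; last exact: finite_measure_integrable_cst.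
    by rewrite martingale_start add0e integral_const.
  exact: iM.
have fat := fatou P measurableT mf f0.
apply/integrableP; split; first by apply/measurable_EFinP; exact: measurable_growth.
apply: (@le_lt_trans _ _ (\int[P]_w limn_einf (f^~ w))%E); last first.
  apply: (le_lt_trans fat); rewrite (_ : (fun n => _) = cst C%:E).
    have cC : (cst C%:E : (\bar R)^nat) @ \oo --> C%:E by exact: cvg_cst.
    by rewrite (cvg_limn_einf_sup cC) ltry.
  by apply/funext => N; rewrite If.
apply: ae_ge0_le_integral => //=.
- apply/measurable_EFinP; apply: measurableT_comp => //.
  exact: measurable_growth.
- move=> w _; rewrite limn_einf_lim; apply: lime_ge; first exact: is_cvg_einfs.
  by apply: nearW => N; apply: le_ereal_inf_tmp => _ [m /= _ <-]; exact: f0.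
- rewrite (_ : (fun w => _) = (fun w => - limn_esup (fun N => - f N w))%E)//.
  apply: measurableT_comp => //; apply: measurable_fun_limn_esup => N.
  exact: measurableT_comp.
apply: filterS tauP => w tw _.
have cv : f N w @[N --> \oo] --> (compensated l 1 w + C)%:E.
  apply: cvg_near_cst; near=> N; rewrite /f min_l//.
  by rewrite (near tw N)//; near: N.
have [_ /(_ erefl) b1] := bound w 1 in01_1.
by rewrite (cvg_limn_einf_sup cv) lee_fin ger0_norm// ler0z subr_ge0 X_mono.
Unshelve. all: by end_near. Qed.

Section Functional.
Variables (n : nat) (F : seq R -> R).
Hypothesis HF : BUC n F.

(** The integrand is predictable: it is determined by the path at the grid
    points up to the current one. *)
Lemma grid_integrand_ext N w w' j :
  (forall i, (i <= j)%N -> X (grid N i) w = X (grid N i) w') ->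
  grid_integrand l x n F N w j = grid_integrand l x n F N w' j.
Proof.
move=> E; have k i : (i <= j)%N -> grid_count N w i = grid_count N w' i.
  by move=> ij; rewrite !grid_countE -!(grid0 N) !E.
by rewrite /grid_integrand k// (grid_jumps_ext N k).
Qed.

Lemma measurable_grid_integrand N j : (j <= N.+1)%N ->
  measurable_fun setT (fun w : Omega R => grid_integrand l x n F N w j).
Proof.
move=> jN.
pose k (f : nat -> int) i := `|f i - f 0%N|%N.
pose G (f : nat -> int) := backward_jump l x n F (k f j) (grid N j) (grid_jumps N (k f) j).
rewrite (_ : (fun w => _) = (fun w => G (fun i => X (grid N i) w))); last first.
  apply/funext => w; rewrite /G /grid_integrand /k grid0 -grid_countE.
  congr backward_jump; apply: grid_jumps_ext => i _; by rewrite grid_countE.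
apply: (@measurable_skeleton _ j.+1 (grid N) G).
  by move=> i; rewrite ltnS => ij; apply: grid_in01; exact: leq_trans jN.
move=> f f' ff'; rewrite /G.
have kE i : (i <= j)%N -> k f i = k f' i by move=> ij; rewrite /k !ff'.
by rewrite kE// (grid_jumps_ext N kE).
Qed.

Lemma martingale_increment_event N N' j (A : set (Omega R)) :
  (j <= N)%N -> Filt (grid N j) A ->
  mean_zero P (fun w => \1_A w *
    (stopped_comp l (tau N' w) N w j.+1 - stopped_comp l (tau N' w) N w j)).
Proof.
move=> jN FA; have [_ iM mM] := Mtau N'.
have /andP[a0 a1] := @grid_in01 R N j (leqW jN).
have /andP[b0 b1] := @grid_in01 R N j.+1 jN.
have ab := ltW (@grid_lt R N j).
have mA : measurable A by exact: Filt_measurable FA.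
have i1 := iM _ (introT andP (conj b0 b1)).
have i0 := iM _ (introT andP (conj a0 a1)).
have e := mM _ _ _ a0 ab b1 FA.
split.
  apply: (integrable_bounded_mul (B := 1)); first exact: measurable_indic.
    by move=> w; rewrite indicE; case: (_ \in _); rewrite ?normr1 ?normr0.
  exact: integrable_sub i1 i0.
rewrite (_ : (fun w => _) = ((fun w => stopped_comp l (tau N' w) N w j.+1 -
     stopped_comp l (tau N' w) N w j) \_ A)).
  rewrite -Rintegral_mkcond RintegralB.
  - rewrite /Rintegral; apply/eqP; rewrite subr_eq0; apply/eqP.
    exact: (congr1 fine e).
  - exact: mA.
  - exact: (integrableS measurableT mA (@subsetT _ _) i1).
  - exact: (integrableS measurableT mA (@subsetT _ _) i0).
apply/funext => w; rewrite /patch indicE; case: (_ \in _); by rewrite ?mul1r ?mul0r.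
Qed.

(** The integrand vanishes once more than [n] jumps have occurred; so it is,
    almost surely, a finite linear combination of indicators of events of the
    past, and the martingale property applies to each. *)
Lemma mean_zero_grid_integrand N N' j (B : R) : (j <= N)%N ->
  (forall w, `|grid_integrand l x n F N w j| <= B) ->
  mean_zero P (fun w => grid_integrand l x n F N w j *
    (stopped_comp l (tau N' w) N w j.+1 - stopped_comp l (tau N' w) N w j)).
Proof.
move=> jN HB.
have [_ iM _] := Mtau N'.
pose D w := stopped_comp l (tau N' w) N w j.+1 - stopped_comp l (tau N' w) N w j.
have iD : P.-integrable setT (EFin \o D).
  by apply: integrable_sub; apply: iM; apply: grid_in01 => //; exact: leqW.
pose A (c : {ffun 'I_j.+1 -> 'I_n.+1}) : set (Omega R) :=
  [set w | all (fun p => X p.1 w == p.2)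
    [seq (grid N (val i), x + (c i : nat)%:Z) | i <- enum 'I_j.+1]].
have AP c w : A c w <-> forall i : 'I_j.+1, X (grid N i) w = x + (c i : nat)%:Z.
  rewrite /A /= all_map; split=> [/allP H i|H]; first by apply/eqP; exact: (H i (mem_enum _ _)).
  by apply/allP => i _ /=; rewrite H.
(* the value of the integrand on the cylinder [A c], where it is constant *)
pose h c := if pselect (exists w, A c w) is left e then
  grid_integrand l x n F N (sval (cid e)) j else 0.
have mZ c : mean_zero P (fun w => h c * (\1_(A c) w * D w)).
  apply: mean_zeroZ; apply: martingale_increment_event => //.
  apply: Filt_cylinder; rewrite all_map; apply/allP => i _ /=.
  have ij : (i <= j)%N by rewrite -ltnS.
  have /andP[-> _] := @grid_in01 R N i (leqW (leq_trans ij jN)).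
  by rewrite /grid ler_pM2r// ler_nat.
apply: (mean_zero_ae _ _ (mean_zero_sum (enum {ffun 'I_j.+1 -> 'I_n.+1}) mZ)).
  by apply: integrable_bounded_mul HB iD; apply: measurable_grid_integrand; exact: leqW.
apply: filterS X0P => w X0; rewrite -/(D w).
have hA c : A c w -> h c = grid_integrand l x n F N w j.
  move=> Ac; rewrite /h; case: pselect => [e|]; last by case; exists w.
  apply: grid_integrand_ext => i ij; have /AP H := svalP (cid e).
  move/AP: Ac => Ac.
  by rewrite (H (Ordinal (ij : (i < j.+1)%N))) (Ac (Ordinal (ij : (i < j.+1)%N))).
have Xk i : X (grid N i) w = x + (grid_count N w i)%:Z by rewrite X_count X0.
have [kn|nk] := leqP (grid_count N w j) n; last first.
  rewrite [in RHS]/grid_integrand backward_jump_gt// mul0r big1// => c _.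
  rewrite indicE (_ : w \in A c = false) ?mul0r ?mulr0//.
  apply/negbTE; rewrite notin_setE => /AP /(_ ord_max) /=; rewrite Xk => /addrI[] e.
  by have := ltn_ord (c ord_max); rewrite -e ltnS leqNgt nk.
(* the only cylinder that contains [w] is given by its own counts *)
pose c0 := [ffun i : 'I_j.+1 => inord (grid_count N w i) : 'I_n.+1].
have c0E i : (c0 i : nat) = grid_count N w i.
  by rewrite ffunE inordK// ltnS (leq_trans _ kn)// grid_count_mono// -ltnS ltn_ord.
have Ac0 : A c0 w by apply/AP => i; rewrite c0E Xk.
rewrite big_enum /= (bigD1 c0)//= big1 ?addr0.
  by rewrite hA// indicE mem_set// mul1r.
move=> c cc0; rewrite indicE (_ : w \in A c = false) ?mul0r ?mulr0//.
apply/negbTE; rewrite notin_setE => /AP Ac; move/eqP: cc0; apply.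
apply/ffunP => i; apply: val_inj; rewrite /= c0E.
by have := Ac i; rewrite Xk => /addrI[].
Qed.

Lemma measurable_backward_jumps :
  measurable_fun setT (fun w : Omega R => backward l x n F (size (jumps w)) 1 (jumps w)).
Proof.
apply: (@measurable_jumps _ (fun _ q => backward l x n F (size q) 1 q)) => _ k.
apply: (@BUC_ext _ _ (fun q => backward l x n F k 1 q)); first by move=> q ->.
exact: (@BUC_cons _ k _ 1 (backward_BUC Hl x HF k)).
Qed.

(** The mean of the backward value is the same at times 1 and 0. The same index
    [N] refines the grid and removes the stopping, so that a single dominated
    convergence does both. *)
Lemma jump_law_backward :
  (\int[P]_w (backward l x n F (size (jumps w)) 1 (jumps w))%:E = (backward l x n F 0 0 [::])%:E)%E.
Proof.
have [B B0 HB] := backward_bounded Hl x HF.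
have [C C0 HC] := rate_bound Hl.
pose V w := backward l x n F (size (jumps w)) 1 (jumps w).
pose v0 := backward l x n F 0 0 [::].
have mV : measurable_fun setT V.
  exact: measurable_backward_jumps.
have iV : P.-integrable setT (EFin \o V).
  by apply: (@integrable_bounded _ _ _ P V B mV) => w; exact: HB.
pose S N w := \sum_(0 <= j < N.+1) grid_integrand l x n F N w j *
   (stopped_comp l (tau N w) N w j.+1 - stopped_comp l (tau N w) N w j).
have zS N : mean_zero P (S N).
  rewrite /S; under eq_fun do rewrite big_mkord.
  apply: mean_zero_sum => j; apply: (@mean_zero_grid_integrand N N j (2 * B)).
    by rewrite -ltnS.
  by move=> w; exact: grid_integrand_bound.
pose f N w := V w - v0 - S N w.
have if_ N : P.-integrable setT (EFin \o f N).
  apply: integrable_sub; last by have [] := zS N.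
  by apply: integrable_sub => //; exact: integrable_const.
(* the dominating function: the two backward values, and [grid_sum_bound] *)
pose g w := 2 * B + 2 * B * ((X 1 w - X 0 w)%:~R + C).
have ig : P.-integrable setT (EFin \o g).
  apply: integrable_add; first exact: integrable_const.
  apply: (integrable_bounded_mul (B := 2 * B)) => //.
    by move=> w; rewrite ger0_norm// mulr_ge0// ltW.
  by apply: integrable_add; [exact: integrable_growth|exact: integrable_const].
have [||_ _] := @dominated_convergence _ _ _ P setT measurableT (fun N => EFin \o f N)
   (cst 0%E) (EFin \o g) (fun N => measurable_int P (if_ N)) (measurable_cst _) _ ig.
- apply: filterS2 X0P tauP => w X0 tw _.
  have cv := grid_sum_cvg Hl HF HB HC X0.
  apply: (@cvg_trans _ (EFin (V w - v0 - \sum_(0 <= j < N.+1) grid_integrand l x n F N w j *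
       (stopped_comp l 1 N w j.+1 - stopped_comp l 1 N w j)) @[N --> \oo])).
    apply: near_eq_cvg; near=> N; rewrite /f /S /= (near tw N)//; by near: N.
  by apply: cvg_EFin => //; exact: nearW.
- apply: nearW => w N _; rewrite lee_fin /f /g.
  apply: (le_trans (ler_normB _ _)); apply: lerD; last exact: grid_sum_bound.
  rewrite (le_trans (ler_normB _ _))// mulr2n mulrDl mul1r lerD//; exact: HB.
rewrite integral0 => /= cv.
have E N : (\int[P]_w (f N w)%:E)%E = (\int[P]_w V w - v0)%:E.
  have [iS S0] := zS N.
  rewrite integralE_Rintegral//; congr EFin; rewrite /f.
  rewrite RintegralB//; last by apply: integrable_sub => //; exact: integrable_const.
  rewrite S0 subr0 RintegralB//; last exact: integrable_const.
  by congr (_ - _); rewrite /Rintegral integral_const.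
have : (\int[P]_w V w - v0)%:E @[N --> \oo] --> (0%E : \bar R).
  by apply: cvg_trans cv; apply: near_eq_cvg; apply: nearW => N; rewrite /= E.
move=> c0; have : (\int[P]_w V w - v0)%:E = 0%E.
  have cc : (\int[P]_w V w - v0)%:E @[N --> \oo] --> (\int[P]_w V w - v0)%:E.
    exact: cvg_cst.
  exact: (cvg_unique (@ereal_hausdorff R) cc c0).
move=> [] /eqP; rewrite subr_eq0 => /eqP; rewrite -/V -/v0 => <-.
exact: integralE_Rintegral.
Unshelve. all: by end_near. Qed.

(** At time 1 an iterated integral in at least one variable vanishes, so that
    the backward value is concentrated on the event of exactly [n] jumps. *)
Lemma jump_law :
  (\int[P]_w (if size (jumps w) == n then F (jumps w) else 0)%:E =
   (expR (cumrate l x 0 - cumrate l (x + n%:Z) 1) * simplex_int (weight l) n x F 0)%:E)%E.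
Proof.
have [B B0 HB] := backward_bounded Hl x HF.
have bE q : backward l x n F (size q) 1 q =
    if size q == n then expR (cumrate l (x + n%:Z) 1) * F q else 0.
  rewrite /backward clamp_id ?in01_1//; case: ltngtP => [qn|//|->].
    by rewrite -subnSK// simplex_int1 mulr0.
  by rewrite subnn /= cats0.
have E0 := expR_gt0 (cumrate l (x + n%:Z) 1).
rewrite (_ : (fun w => _) = (fun w : Omega R => (expR (- cumrate l (x + n%:Z) 1))%:E *
   (backward l x n F (size (jumps w)) 1 (jumps w))%:E)%E); last first.
  apply/funext => w; rewrite -EFinM bE; congr EFin; case: ifP => _; last by rewrite mulr0.
  by rewrite mulrA -expRD addNr expR0 mul1r.
rewrite integralZl//; last first.
  apply: (@integrable_bounded _ _ _ P (fun w => backward l x n F (size (jumps w)) 1 (jumps w)) B).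
    exact: measurable_backward_jumps.
  by move=> w; exact: HB.
rewrite jump_law_backward -EFinM; congr EFin.
rewrite /backward leq0n subn0 addr0 clamp_id ?in01_0//=.
by rewrite mulrA -expRD addrC.
Qed.

End Functional.
End Law.

(** * Smooth functions on the cube under time changes *)

Section SmoothCube.
Context {R : realType} (m : nat).
Implicit Types (s t e r : R) (v w : 'rV[R]_m) (i j : 'I_m).
Variable f : 'rV[R]_m -> R.
Hypothesis Hf : Ck_cube 1 f.

Definition partial i v : R := deriv01 (along f i v) (v 0 i).
Definition upd v i s : 'rV[R]_m := \row_j (if j == i then s else v 0 j).

Lemma cube_compact : compact (cube R m).
Proof.
rewrite (_ : cube R m = [set v : 'rV[R]_m | forall i, `[0, 1]%classic (v ord0 i)]).
  by apply: (@rV_compact R m (fun=> `[0, 1]%classic)) => _; exact: segment_compact.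
by apply/seteqP; split=> v H i; have := H i; rewrite /= in_itv.
Qed.

Lemma cube_bounded (g : 'rV[R]_m -> R) : {within cube R m, continuous g} ->
  exists2 B : R, 0 < B & forall v, cube R m v -> `|g v| <= B.
Proof.
move=> cg; have /compact_bounded := continuous_compact cg cube_compact.
move=> [B [_ HB]]; exists (`|B| + 1); first by rewrite ltr_wpDl.
move=> v cv; apply: (HB (`|B| + 1)); last by exists v.
by rewrite (le_lt_trans (ler_norm _))// ltrDl.
Qed.

Lemma upd_cube v i s : cube R m v -> 0 <= s <= 1 -> cube R m (upd v i s).
Proof. by move=> cv s01 j; rewrite mxE; case: ifP. Qed.

Lemma along_mvt v i s t : cube R m v -> 0 <= s <= 1 -> 0 <= t <= 1 ->
  exists2 c : R, 0 <= c <= 1 & `|c - s| <= `|t - s| /\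
    f (upd v i t) - f (upd v i s) = partial i (upd v i c) * (t - s).
Proof.
move=> cv s01 t01; have [_ /(_ i)[df _]] := Hf.
have aE r : along f i (upd v i r) = along f i v.
  by apply/funext => r'; rewrite /along; congr f; apply/rowP => j; rewrite !mxE; case: (j == i).
have uE r : (upd v i r) 0 i = r by rewrite mxE eqxx.
have da r : 0 <= r <= 1 -> derivable01 (along f i v) r.
  by move=> r01; have := df _ (upd_cube i cv r01); rewrite aE uE.
have ca : {within `[0, 1], continuous (along f i v)}.
  exact/clamp_within/derivable01_clamp_continuous.
have da' r : 0 < r < 1 -> is_derive r 1 (along f i v) (partial i (upd v i r)).
  move=> r01; rewrite /partial aE uE; apply: is_derive01 => //; apply: da.
  by case/andP: r01 => *; rewrite !ltW.
have [c c01 [cs [_ E]]] := MVT01 ca da' s01 t01.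
by exists c.
Qed.

Definition hyb (k : nat) v w : 'rV[R]_m := \row_j (if (j < k)%N then w 0 j else v 0 j).

(** Only partial derivatives are available: change one coordinate at a time and
    apply the mean value theorem to each step. *)
Lemma increment v w : cube R m v -> cube R m w ->
  exists xi : 'I_m -> 'rV[R]_m,
    (forall i, cube R m (xi i) /\ forall j, `|xi i 0 j - v 0 j| <= `|w 0 j - v 0 j|) /\
    f w - f v = \sum_(i < m) partial i (xi i) * (w 0 i - v 0 i).
Proof.
move=> cv cw.
have ch k : cube R m (hyb k v w) by move=> j; rewrite mxE; case: ifP.
have H i : exists y : 'rV[R]_m, (cube R m y /\ forall j, `|y 0 j - v 0 j| <= `|w 0 j - v 0 j|) /\
    f (hyb i.+1 v w) - f (hyb i v w) = partial i y * (w 0 i - v 0 i).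
  have [c c01 [cd E]] := along_mvt i (ch i) (cv i) (cw i).
  exists (upd (hyb i v w) i c); split.
    split; first exact: upd_cube.
    move=> j; rewrite !mxE; case: eqP => [->//|_]; case: ifP => // _.
    by rewrite subrr normr0.
  rewrite -E; congr (f _ - f _); apply/rowP => j; rewrite !mxE; last first.
    by case: eqP => [->|//]; rewrite ltnn.
  rewrite ltnS leq_eqVlt; case: eqP => [ji|ji].
    by rewrite (val_inj ji) eqxx.
  by case: eqP => // ji'; case: ji; rewrite ji'.
exists (fun i => sval (cid (H i))); split.
  by move=> i; case: (cid (H i)) => y /= [].
have -> : f w - f v = f (hyb m v w) - f (hyb 0 v w).
  by congr (f _ - f _); apply/rowP => j; rewrite !mxE ?ltn_ord.
rewrite -(telescope_sumr (fun k => f (hyb k v w)) (leq0n m)) big_mkord.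
by apply: eq_bigr => i _; case: (cid (H i)) => y /= [].
Qed.

Lemma partial_bounded : exists2 B : R, 0 < B &
  forall i v, cube R m v -> `|partial i v| <= B.
Proof.
have W i : exists2 B : R, 0 < B & forall v, cube R m v -> `|partial i v| <= B.
  by have [_ /(_ i)[_ [cp _]]] := Hf; exact: cube_bounded.
pose b i := sval (cid2 (W i)).
have b0 i : 0 < b i by rewrite /b; case: (cid2 (W i)).
exists (\sum_i b i + 1) => [|i v cv]; first by rewrite ltr_wpDl// sumr_ge0// => i _; exact: ltW.
have : `|partial i v| <= b i by rewrite /b; case: (cid2 (W i)) => B /= _; apply.
move=> /le_trans; apply; rewrite (bigD1 i)//= -addrA lerDl addr_ge0// sumr_ge0// => j _.
exact: ltW.
Qed.

Lemma smooth_lip : exists2 B : R, 0 < B & forall v w, cube R m v -> cube R m w ->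
  `|f w - f v| <= B * \sum_(i < m) `|w 0 i - v 0 i|.
Proof.
have [B B0 HB] := partial_bounded; exists B => // v w cv cw.
have [xi [Hxi ->]] := increment cv cw.
apply: (le_trans (ler_norm_sum _ _ _)); rewrite big_distrr /=; apply: ler_sum => i _.
by rewrite normrM ler_wpM2r// HB//; have [] := Hxi i.
Qed.

Section Flow.
Variable u : R -> R.
Hypothesis Hu : perturbation u.

(** How the inverse time change acts on the vector of jump instants. *)
Definition flow e v : 'rV[R]_m := \row_i tchange_inv u e (v 0 i).

Lemma flow_cube e v : cube R m (flow e v).
Proof. by move=> i; rewrite mxE; exact: tchange_inv_in01. Qed.

Lemma flow_lip : exists2 K : R, 0 < K & forall e v, 0 < e -> cube R m v ->
  `|e^-1 * (f (flow e v) - f v)| <= K.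
Proof.
have [B B0 HB] := smooth_lip; have [Bu Bu0 HBu] := bounded01 (perturbation_within Hu).
exists (B * (m%:R * Bu) + 1) => [|e v e0 cv].
  by rewrite ltr_wpDl// !mulr_ge0// ltW.
rewrite normrM gtr0_norm ?invr_gt0// mulrC ler_pdivrMr//.
apply: (le_trans (HB _ _ cv (flow_cube e v))); apply: (@le_trans _ _ (B * (m%:R * Bu) * e)).
  rewrite -mulrA ler_wpM2l// ?(ltW B0)// -mulrA mulr_natl.
  rewrite -[X in _ *+ X]card_ord -sumr_const; apply: ler_sum => i _.
  rewrite mxE tchange_inv_sub// normrN normrM gtr0_norm// mulrC ler_wpM2r// ?(ltW e0)//.
  by rewrite HBu// tchange_inv_in01.
by rewrite ler_wpM2r ?(ltW e0)// lerDl.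
Qed.

Lemma tchange_inv_cvg t : 0 <= t <= 1 -> tchange_inv u e t @[e --> 0^'+] --> t.
Proof.
move=> t01; have [B B0 HB] := bounded01 (perturbation_within Hu).
apply/cvgrPdist_le => d d0; near=> e.
rewrite distrC tchange_inv_sub// normrN normrM.
have e0 : 0 < e by near: e; exact: nbhs_right_gt.
have ed : e <= d / B by near: e; apply: nbhs_right_le; rewrite divr_gt0.
rewrite gtr0_norm//; apply: (@le_trans _ _ (d / B * B)); last by rewrite divfK// gt_eqF.
by rewrite ler_pM// ?(ltW e0)// HB// tchange_inv_in01.
Unshelve. all: by end_near. Qed.

(** By [increment], the quotient is a sum of partial derivatives at points that
    converge to [v], times the velocities -u of the inverse time change. *)
Lemma flow_cvg v : cube R m v ->
  e^-1 * (f (flow e v) - f v) @[e --> 0^'+] --> \sum_(i < m) partial i v * - u (v 0 i).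
Proof.
move=> cv; pose xi e := sval (cid (increment cv (flow_cube e v))).
have xiP e : (forall i, cube R m (xi e i) /\
     forall j, `|xi e i 0 j - v 0 j| <= `|flow e v 0 j - v 0 j|) /\
    f (flow e v) - f v = \sum_(i < m) partial i (xi e i) * (flow e v 0 i - v 0 i).
  by rewrite /xi; case: (cid _).
apply: (@cvg_trans _ ((\sum_(i < m) partial i (xi e i) *
    - u (tchange_inv u e (v 0 i))) @[e --> 0^'+])).
  apply: near_eq_cvg; near=> e.
  have e0 : 0 < e by near: e; exact: nbhs_right_gt.
  have [_ ->] := xiP e; rewrite big_distrr /=; apply: eq_bigr => i _.
  rewrite mxE tchange_inv_sub//; field; by rewrite gt_eqF.
apply: cvg_big => [|i _]; first exact: add_continuous.
apply: cvgM; last first.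
  apply: cvgN.
  have cu := comp_clamp_continuous (perturbation_within Hu) (x := v 0 i).
  have := cvg_comp _ _ (tchange_inv_cvg (cv i)) cu; rewrite /= clamp_id//.
  rewrite (_ : (u \o clamp) \o (tchange_inv u)^~ (v 0 i) =
    (fun e => u (tchange_inv u e (v 0 i))))//.
  by apply/funext => e /=; rewrite clamp_id// tchange_inv_in01.
have [_ /(_ i)[_ [cp _]]] := Hf.
apply: cvg_comp (within_cvg cp cv).
move=> V /=; rewrite /within /= => HV.
have [d /= d0 Hd] := (nbhs_ballP _ _).1 HV.
have [Bu Bu0 HBu] := bounded01 (perturbation_within Hu).
near=> e; apply: (Hd (xi e i)); last by have [/(_ i)[]] := xiP e.
have [/(_ i)[_ Hxi] _] := xiP e.
have e0 : 0 < e by near: e; exact: nbhs_right_gt.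
have ed : e < d / Bu by near: e; apply: nbhs_right_lt; rewrite divr_gt0.
split=> // a j; rewrite (ord1 a) /ball /= distrC; apply: (le_lt_trans (Hxi j)).
rewrite mxE tchange_inv_sub// normrN normrM gtr0_norm//.
apply: (@le_lt_trans _ _ (e * Bu)); last by rewrite -ltr_pdivlMr.
by rewrite ler_wpM2l ?(ltW e0)// HBu// tchange_inv_in01.
Unshelve. all: by end_near. Qed.

End Flow.
End SmoothCube.

(** * Conditioning on an event *)

Section Conditioning.
Context {d : measure_display} {T : measurableType d} {R : realType}.
Variables (P : probability T R) (D : set T) (mD : measurable D).
Hypothesis PD : P D != 0%E.
Let Q : probability T R := mnormalize (mrestr P mD) P.
Let k : R := (fine (P D))^-1.

Let PDfin : P D \is a fin_num. Proof. exact: fin_num_measure. Qed.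
Let k0 : 0 <= k. Proof. by rewrite invr_ge0 fine_ge0. Qed.

Lemma conditionedE A : Q A = (P (A `&` D) * k%:E)%E.
Proof.
have -> : Q A = mnormalize (mrestr P mD) P A by [].
have DE : mrestr P mD setT = P D by rewrite /mrestr setTI.
have Doo : P D != +oo%E by move: PDfin; case: (P D).
rewrite /mnormalize [X in X == 0%E]DE [X in X == +oo%E]DE [X in fine X]DE.
by rewrite (negbTE PD) (negbTE Doo).
Qed.

Lemma ge0_integral_conditioned (f : T -> \bar R) : measurable_fun setT f ->
  (forall w, (0 <= f w)%E) -> (\int[Q]_w f w = k%:E * \int[P]_(w in D) f w)%E.
Proof.
move=> mf f0.
have QD : Q (~` D) = 0%E by rewrite conditionedE setICl measure0 mul0e.
have mD' : measurable (~` D) by exact: measurableC.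
rewrite (@ge0_negligible_integral _ _ _ Q setT (~` D))//.
rewrite setTD setCK.
rewrite (eq_measure_integral (mscale (NngNum k0) P)); last first.
  move=> A mA AD; rewrite [LHS]conditionedE (setIidl AD) muleC.
  by [].
rewrite ge0_integral_mscale//; exact: measurable_funS mf.
Qed.

Lemma integral_conditioned (f : T -> R) : measurable_fun setT f ->
  P.-integrable D (EFin \o f) ->
  Q.-integrable setT (EFin \o f) /\
  (\int[Q]_w (f w)%:E = k%:E * \int[P]_(w in D) (f w)%:E)%E.
Proof.
move=> mf fi.
have mf' : measurable_fun setT (EFin \o f) by exact/measurable_EFinP.
have fi' : Q.-integrable setT (EFin \o f).
  apply/integrableP; split=> //.
  rewrite ge0_integral_conditioned//; last exact: measurableT_comp.
  have /integrableP[_] := fi; move=> h.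
  rewrite lte_mul_pinfty// ?lee_fin//.
split=> //.
rewrite (integralE Q) (integralE P D (fun w => (f w)%:E)).
rewrite !ge0_integral_conditioned//; [|exact: measurable_funeneg|exact: measurable_funepos].
by apply/esym/muleBr => //; exact: integrable_add_def fi.
Qed.

End Conditioning.

(** * The duality formula *)

Section Duality.
Context {R : realType}.
Implicit Types (e s t : R) (q : seq R) (z : int) (w : Omega R).
Variables (m : nat) (phi : int -> 'rV[R]_m -> R).
Hypothesis Hphi : forall z, Ck_cube 1 (phi z).
Variables (u : R -> R) (l : R -> int -> R).
Hypotheses (Hu : perturbation u) (Hl : NMC l).

(** The default value 1 is the convention T_i = 1 beyond the last jump; on
    instants of a path [clamp] is the identity, and it makes the functional
    bounded and uniformly continuous on arbitrary lists. *)
Definition jump_row q : 'rV[R]_m := \row_i clamp (nth 1 q i).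
Definition jump_fun z q : R := phi z (jump_row q).

Lemma jump_row_cube q : cube R m (jump_row q).
Proof. by move=> i; rewrite mxE clamp_in. Qed.

Lemma near_seq_nth d q q' i : 0 < d -> near_seq d q q' -> `|nth 1 q i - nth 1 q' i| < d.
Proof.
move=> d0; elim: q q' i => [|t q IH] [|t' q'] //= [|i]; rewrite ?subrr ?normr0//.
  by move=> /andP[].
by move=> /andP[_]; exact: IH.
Qed.

Lemma jump_fun_BUC z k : BUC k (jump_fun z).
Proof.
have [c0 _] := Hphi z; have [B B0 HB] := cube_bounded c0.
split; first by exists B => q _; apply/HB/jump_row_cube.
have [L L0 HL] := smooth_lip (Hphi z).
move=> e e0; have M0 : 0 < L * m%:R + 1 by rewrite ltr_wpDl// mulr_ge0// ltW.
exists (e / (L * m%:R + 1)) => [|q q' _ qq']; first by rewrite divr_gt0.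
have d0 : 0 < e / (L * m%:R + 1) by rewrite divr_gt0.
apply: (le_lt_trans (HL _ _ (jump_row_cube q') (jump_row_cube q))).
apply: (@le_lt_trans _ _ (L * m%:R * (e / (L * m%:R + 1)))).
  rewrite -mulrA ler_wpM2l// ?(ltW L0)// mulr_natl -[X in _ *+ X]card_ord -sumr_const.
  apply: ler_sum => i _; rewrite !mxE; apply: (le_trans (clamp_dist _ _)).
  by apply/ltW/near_seq_nth.
by rewrite mulrA ltr_pdivrMr// mulrC ltr_pM2l// ltrDl.
Qed.

Lemma jump_row_tchange_inv e q : admissible u e ->
  jump_row (map (tchange_inv u e) q) = flow u e (jump_row q).
Proof.
move=> se; apply/rowP => i; rewrite !mxE.
have tciC t : tchange_inv u e (clamp t) = tchange_inv u e t by rewrite /tchange_inv clampK.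
rewrite tciC; have [iq|qi] := ltnP i (size q).
  by rewrite (nth_map 1)// clamp_id// tchange_inv_in01.
by rewrite !nth_default ?size_map// (tchange_inv1 Hu se) clamp_id// in01_1.
Qed.

Lemma jump_fun_tchangeK e z q : admissible u e ->
  jump_fun z (map (tchange_inv u e) (map (tchange u e) q)) = jump_fun z q.
Proof.
move=> se; rewrite /jump_fun -map_comp; congr phi; apply/rowP => i; rewrite !mxE.
have [iq|qi] := ltnP i (size q); last by rewrite !nth_default ?size_map.
by rewrite (nth_map 1)//= -tchange_clamp (tchangeK Hu se) ?clamp_in// clampK.
Qed.

Lemma jump_fun_jump_prod_BUC e z k :
  BUC k (fun q => jump_fun z q * jump_prod (weight_ratio u l e) z q).
Proof.
apply: BUC_mul; first exact: jump_fun_BUC.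
by apply: BUC_jump_prod => z'; [exact: weight_ratio_unif_cont|exact: weight_ratio_bounded].
Qed.

Lemma jump_fun_tchange_inv_BUC e z k : admissible u e ->
  BUC k (fun q => jump_fun z (map (tchange_inv u e) q)).
Proof. by move=> se; apply: BUC_map; [exact: tchange_inv_unif_cont|exact: jump_fun_BUC]. Qed.

(** The substitution t = theta(s), applied to the functional of the inverse
    images, undoes the time change and produces the density. *)
Lemma simplex_girsanov e z k : admissible u e ->
  simplex_int (weight l) k z (fun q => jump_fun z (map (tchange_inv u e) q)) 0 =
  simplex_int (weight l) k z (fun q => jump_fun z q * jump_prod (weight_ratio u l e) z q) 0.
Proof.
move=> se.
have := @simplex_int_change R (weight l) (@weight_continuous _ _ Hl) (weight_bounded Hl)
  (tchange u e) (fun t => 1 + e * deriv01 u t) (weight_ratio u l e)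
  (fun t _ => tchange_in01 Hu se t) (tchange1 Hu e) (tchange_unif_cont Hu se)
  (fun t t01 => is_derive_tchange Hu e t01) (fun z => @weight_ratio_unif_cont _ _ Hu _ Hl e z)
  (fun z => weight_ratio_bounded Hu Hl e z) (fun z t t01 => weight_ratioE u Hl e z t01)
  k z _ 0 (jump_fun_tchange_inv_BUC z k se) in01_0.
rewrite (tchange0 Hu) => ->; apply: simplex_int_ext => q _.
by rewrite jump_fun_tchangeK.
Qed.

(** The difference quotient that defines the derivative of the functional. *)
Definition quot_shift e z q : R :=
  e^-1 * (jump_fun z (map (tchange_inv u e) q) - jump_fun z q).

(** The difference quotient of the density, with the same mean as [quot_shift]
    on the event of a given number of jumps. *)
Definition quot_dens e z q : R :=
  e^-1 * (jump_fun z q * (jump_prod (weight_ratio u l e) z q - 1)).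
Definition lim_shift z q : R :=
  \sum_(i < m) partial (phi z) i (jump_row q) * - u (jump_row q 0 i).
Definition lim_dens z q : R := jump_fun z q * jump_sum (dens_rate u l) z q.

Lemma quot_shift_BUC e z k : admissible u e -> BUC k (quot_shift e z).
Proof.
move=> se; apply: BUC_mul; first exact: BUC_cst.
by apply: BUC_sub; [exact: jump_fun_tchange_inv_BUC|exact: jump_fun_BUC].
Qed.

Lemma quot_dens_BUC e z k : BUC k (quot_dens e z).
Proof.
apply: BUC_mul; first exact: BUC_cst; apply: BUC_mul; first exact: jump_fun_BUC.
apply: BUC_sub; last exact: BUC_cst.
by apply: BUC_jump_prod => z'; [exact: weight_ratio_unif_cont|exact: weight_ratio_bounded].
Qed.

Lemma quot_shift_cvg z q : quot_shift e z q @[e --> 0^'+] --> lim_shift z q.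
Proof.
have H := flow_cvg (Hphi z) Hu (jump_row_cube q).
apply: cvg_trans H; apply: near_eq_cvg.
have [e0 e00 He0] := near_admissible Hu.
near=> e; have se : admissible u e.
  apply: He0; apply/andP; split; near: e; [exact: nbhs_right_gt|exact: nbhs_right_le].
by rewrite /quot_shift /jump_fun jump_row_tchange_inv.
Unshelve. all: by end_near. Qed.

Lemma quot_dens_cvg z q : all (fun t => 0 < t < 1) q ->
  quot_dens e z q @[e --> 0^'+] --> lim_dens z q.
Proof.
move=> q01; have H := is_derive_cvg0 (is_derive_jump_prod u Hl z q01).
rewrite (jump_prod0 u Hl) in H.
rewrite (_ : (fun e => _) = (fun e => jump_fun z q *
    (e^-1 * (jump_prod (weight_ratio u l e) z q - 1)))).
  by apply: cvgM; [exact: cvg_cst|exact: H].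
by apply/funext => e; rewrite /quot_dens mulrCA.
Qed.

Lemma quot_shift_bound z : exists2 K : R, 0 < K & forall e q, 0 < e -> admissible u e ->
  `|quot_shift e z q| <= K.
Proof.
have [K K0 HK] := flow_lip (Hphi z) Hu; exists K => // e q e0 se.
by rewrite /quot_shift /jump_fun jump_row_tchange_inv// HK//; exact: jump_row_cube.
Qed.

Lemma quot_dens_bound z k : exists2 K : R, 0 < K & forall e q, 0 < e -> e <= 1 -> admissible u e ->
  size q = k -> `|quot_dens e z q| <= K.
Proof.
have [[B HB] _] := jump_fun_BUC z k; have [K K0 HK] := jump_prod_dist Hu Hl k z.
exists ((`|B| + 1) * K) => [|e q e0 e1 se qk]; first by rewrite mulr_gt0// ltr_wpDl.
rewrite /quot_dens mulrCA normrM; apply: ler_pM => //.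
  by rewrite (le_trans (HB q qk))// (le_trans (ler_norm _))// lerDl.
by rewrite normrM gtr0_norm ?invr_gt0// mulrC ler_pdivrMr// HK.
Qed.

(** Measurability and dominated convergence are statements on sequences. *)
Lemma admissible_seq : exists ek : nat -> R,
  [/\ forall k, admissible u (ek k), forall k, 0 < ek k, forall k, ek k <= 1 &
      ek @ \oo --> (0 : R)^'+].
Proof.
have [e0 e00 He0] := near_admissible Hu.
pose e1 := Num.min e0 1; have e10 : 0 < e1 by rewrite lt_min e00 ltr01.
pose ek (k : nat) := e1 / k.+1%:R.
have ek0 k : 0 < ek k by rewrite divr_gt0.
have eke k : ek k <= e1 by rewrite ler_pdivrMr// ler_peMr ?(ltW e10)// ler1n.
exists ek; split=> // [k|k|].
- by apply: He0; rewrite ek0 (le_trans (eke k))// ge_min lexx.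
- by rewrite (le_trans (eke k))// ge_min lexx orbT.
- move=> V [d /= d0 Hd]; suff : \forall k \near \oo, V (ek k) by [].
  near=> k; apply: Hd => //=.
  rewrite sub0r normrN gtr0_norm// /ek.
  have : k.+1%:R^-1 < d / e1 by near: k; apply: near_invn; rewrite divr_gt0.
  by rewrite ltr_pdivlMr// mulrC.
Unshelve. all: by end_near. Qed.

Lemma measurable_lim_shift :
  measurable_fun setT (fun w : Omega R => lim_shift (X 0 w) (jumps w)).
Proof.
have [ek [es e0 e1 ec]] := admissible_seq.
apply: (@measurable_fun_cvg _ _ _ setT (fun k w => quot_shift (ek k) (X 0 w) (jumps w))).
  by move=> k; apply: measurable_jumps => z k'; exact: quot_shift_BUC.
by move=> w _; exact: (cvg_comp _ _ ec (@quot_shift_cvg (X 0 w) (jumps w))).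
Qed.

Lemma measurable_lim_dens :
  measurable_fun setT (fun w : Omega R => lim_dens (X 0 w) (jumps w)).
Proof.
have [ek [es e0 e1 ec]] := admissible_seq.
apply: (@measurable_fun_cvg _ _ _ setT (fun k w => quot_dens (ek k) (X 0 w) (jumps w))).
  by move=> k; apply: measurable_jumps => z k'; exact: quot_dens_BUC.
by move=> w _; exact: (cvg_comp _ _ ec (@quot_dens_cvg (X 0 w) _ (jumps_oo w))).
Qed.

Lemma cvg_norm_bound (f : nat -> R) (L K : R) :
  f @ \oo --> L -> (forall k, `|f k| <= K) -> `|L| <= K.
Proof.
move=> /cvg_norm H HK; rewrite -(cvg_lim _ H)//; apply: limr_le.
  by apply/cvg_ex; exists `|L|.
exact: nearW.
Qed.

Lemma lim_shift_bound z : exists B : R, forall q, `|lim_shift z q| <= B.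
Proof.
have [ek [es e0 e1 ec]] := admissible_seq.
have [K K0 HK] := quot_shift_bound z; exists K => q.
apply: (cvg_norm_bound (cvg_comp _ _ ec (@quot_shift_cvg z q))) => k.
exact: HK.
Qed.

Lemma lim_dens_bound z n : exists B : R, forall q, size q = n ->
  all (fun t => 0 < t < 1) q -> `|lim_dens z q| <= B.
Proof.
have [ek [es e0 e1 ec]] := admissible_seq.
have [K K0 HK] := quot_dens_bound z n; exists K => q qn q01.
apply: (cvg_norm_bound (cvg_comp _ _ ec (@quot_dens_cvg z q q01))) => k.
exact: HK.
Qed.

Definition path_fun w : R := jump_fun (X 0 w) (jumps w).

(** The time-changed path has the same initial state, and its jumps are the
    inverse images of the original ones. *)
Lemma DTheta_lim w : DTheta u path_fun w = lim_shift (X 0 w) (jumps w).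
Proof.
rewrite /DTheta; apply/cvg_lim => //.
apply: cvg_trans (@quot_shift_cvg (X 0 w) (jumps w)); apply: near_eq_cvg.
have [e0 e00 He0] := near_admissible Hu.
near=> e; have se : admissible u e.
  apply: He0; apply/andP; split; near: e; [exact: nbhs_right_gt|exact: nbhs_right_le].
by rewrite /quot_shift /path_fun (Theta0 Hu se) (jumps_Theta Hu se).
Unshelve. all: by end_near. Qed.

Lemma rhs_lim w :
  path_fun w * intX (fun t z => deriv01 u t + Xi l t z * u t) w = lim_dens (X 0 w) (jumps w).
Proof. by rewrite intX_jump_sum. Qed.

Section Bridge.
Variables (x y : int) (P : probability (Omega R) R).
Hypothesis xy : x <= y.
Hypothesis X0P : {ae P, forall w, X 0 w = x}.
Hypothesis MP : local_martingale P (compensated l).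

Let n := `|y - x|%N.

Lemma y_def : y = x + n%:Z.
Proof. by rewrite /n gez0_abs ?subr_ge0// subrKC. Qed.

Lemma final_atE w : X 0 w = x -> (w \in final_at R y) = (size (jumps w) == n).
Proof.
move=> X0; apply/idP/eqP => [|wn].
  by rewrite inE /final_at /= X1_size X0 y_def => /addrI[].
by rewrite inE /final_at /= X1_size X0 wn -y_def.
Qed.

Lemma final_law (F : seq R -> R) : BUC n F ->
  (\int[P]_w (if size (jumps w) == n then F (jumps w) else 0)%:E =
   (expR (cumrate l x 0 - cumrate l y 1) * simplex_int (weight l) n x F 0)%:E)%E.
Proof.
move=> HF; have [tau [st mono ev mart]] := MP.
rewrite [in RHS]y_def; apply: (jump_law Hl X0P (tau := tau)) => //.
  by move=> N w; have [] := st N.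
apply: filterS ev => w [N tN]; exists N => // k /= Nk.
have tle : tau N w <= tau k w.
  elim: k Nk => [|k IH]; first by rewrite leqn0 => /eqP ->.
  rewrite leq_eqVlt => /predU1P[->//|]; rewrite ltnS => /IH /le_trans; apply.
  exact: mono.
by apply/eqP; rewrite eq_le -{2}tN tle andbT; have [/(_ w)/andP[]] := st k.
Qed.

Lemma measurable_if_size (F : seq R -> R) : BUC n F ->
  measurable_fun setT (fun w : Omega R => if size (jumps w) == n then F (jumps w) else 0).
Proof.
move=> HF.
apply: (@measurable_jumps _ (fun _ q => if size q == n then F q else 0)) => _ k.
have [->|kn] := eqVneq k n; first by apply: BUC_ext HF => q ->; rewrite eqxx.
by apply: (@BUC_ext _ _ (fun=> 0)); [move=> q ->; rewrite (negbTE kn)|exact: BUC_cst].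
Qed.

Lemma integrable_if_size (F : seq R -> R) : BUC n F ->
  P.-integrable setT (EFin \o (fun w : Omega R => if size (jumps w) == n then F (jumps w) else 0)).
Proof.
move=> HF; have [[B HB] _] := HF.
apply: (@integrable_bounded _ _ _ P _ `|B| (measurable_if_size HF)) => w.
case: eqP => [/HB H|_]; last by rewrite normr0.
by rewrite (le_trans H)// ler_norm.
Qed.

(** Positive weights give the simplex a positive mass; hence the bridge is the
    genuine conditional law. *)
Lemma final_at_gt0 : P (final_at R y) != 0%E.
Proof.
have mD := @measurable_final_at R y.
have : (0 < \int[P]_w (if size (jumps w) == n then 1 else 0 : R)%:E)%E.
  rewrite (final_law (F := fun=> 1)); last exact: BUC_cst.
  rewrite lte_fin mulr_gt0 ?expR_gt0//.
  apply: (simplex_int1_gt0 (@weight_continuous _ _ Hl) (weight_bounded Hl)).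
    exact: weight_gt0.
  by rewrite lexx ltr01.
rewrite (_ : (\int[P]_w _)%E = P (final_at R y)); first by move=> /gt_eqF ->.
have <- : (\int[P]_w (\1_(final_at R y) w)%:E = P (final_at R y))%E.
  by rewrite (integral_indic P measurableT mD) setIT.
apply: ae_eq_integral => //.
- by apply/measurable_EFinP; apply: (measurable_if_size (F := fun=> 1)); exact: BUC_cst.
- by apply/measurable_EFinP; exact: measurable_indic.
- by apply: filterS X0P => w X0 _; rewrite indicE final_atE//; case: eqP.
Qed.

(** Both means are given by the law of the jumps as the same integral over the
    simplex. *)
Lemma quotients_mean_zero e : admissible u e ->
  mean_zero P (fun w => if size (jumps w) == n then
     quot_shift e x (jumps w) - quot_dens e x (jumps w) else 0).
Proof.
move=> se.
have B1 := jump_fun_tchange_inv_BUC x n se; have B2 := jump_fun_jump_prod_BUC e x n.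
have i1 := integrable_if_size B1; have i2 := integrable_if_size B2.
rewrite (_ : (fun w => _) = (fun w => e^-1 * (
   (if size (jumps w) == n then jump_fun x (map (tchange_inv u e) (jumps w)) else 0) +
   (-1) * (if size (jumps w) == n then
     jump_fun x (jumps w) * jump_prod (weight_ratio u l e) x (jumps w) else 0)))).
  apply: mean_zeroZ; split.
    by apply: integrable_add => //; exact: integrableZl i2.
  rewrite RintegralD//; last exact: integrableZl i2.
  rewrite RintegralZl// mulN1r /Rintegral (final_law B1) (final_law B2) simplex_girsanov//.
  by rewrite subrr.
apply/funext => w; case: ifP => _; last by rewrite !mulr0 addr0 mulr0.
by rewrite /quot_shift /quot_dens; ring.
Qed.

(** The quotients are bounded uniformly in small [e] once the number of jumps is
    fixed. *)
Lemma limits_mean_zero :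
  mean_zero P (fun w => if size (jumps w) == n then
     lim_shift x (jumps w) - lim_dens x (jumps w) else 0).
Proof.
have [ek [es e0 e1 ec]] := admissible_seq.
have [K K0 HK] := quot_shift_bound x; have [K' K'0 HK'] := quot_dens_bound x n.
pose f k w := if size (jumps w) == n then
     quot_shift (ek k) x (jumps w) - quot_dens (ek k) x (jumps w) else 0.
pose g w := if size (jumps w) == n then lim_shift x (jumps w) - lim_dens x (jumps w) else 0.
have zf k : mean_zero P (f k) by exact: quotients_mean_zero.
have mf k : measurable_fun setT (EFin \o f k) by have [/measurable_int] := zf k.
have fg w : f k w @[k --> \oo] --> g w.
  rewrite /f /g; case: eqP => _; last exact: cvg_cst.
  apply: cvgB; first exact: (cvg_comp _ _ ec (@quot_shift_cvg x (jumps w))).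
  exact: (cvg_comp _ _ ec (@quot_dens_cvg x _ (jumps_oo w))).
have mg : measurable_fun setT g.
  apply: (@measurable_fun_cvg _ _ _ setT f) => [k|w _]; last exact: fg.
  exact/measurable_EFinP.
have [|||ig _] := @dominated_convergence _ _ _ P setT measurableT (fun k => EFin \o f k)
   (EFin \o g) (EFin \o (fun=> K + K')) mf _ _ (integrable_const P (K + K')).
- exact/measurable_EFinP.
- by apply: nearW => w _; apply: cvg_EFin; [exact: nearW|exact: fg].
- apply: nearW => w k _; rewrite lee_fin /f; case: eqP => [wn|_]; last first.
    by rewrite normr0 addr_ge0// ltW.
  by apply: (le_trans (ler_normB _ _)); apply: lerD; [exact: HK|exact: HK'].
move=> cv; split=> //; apply/eqP.
have : (\int[P]_w (g w)%:E)%E = 0%E.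
  have c0 : (\int[P]_w (f k w)%:E)%E @[k --> \oo] --> (0%E : \bar R).
    rewrite (_ : (fun k => _) = cst 0%E); first exact: cvg_cst.
    by apply/funext => k; have [ifk f0] := zf k; rewrite integralE_Rintegral// f0.
  exact: (cvg_unique (@ereal_hausdorff R) cv c0).
by rewrite integralE_Rintegral// => -[] /eqP.
Qed.

Lemma integrable_ae_bounded (f : Omega R -> R) (B : R) : measurable_fun setT f ->
  {ae P, forall w, final_at R y w -> `|f w| <= B} ->
  P.-integrable (final_at R y) (EFin \o f).
Proof.
move=> mf fB; have mD := @measurable_final_at R y.
have mf' : measurable_fun (final_at R y) (EFin \o f).
  by apply/measurable_EFinP; exact: measurable_funTS.
apply/integrableP; split=> //.
apply: (@le_lt_trans _ _ (\int[P]_(w in final_at R y) (`|B|)%:E)%E).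
  apply: ae_ge0_le_integral => //=.
  - apply/measurable_EFinP; apply: measurableT_comp => //; exact: measurable_funTS.
  - apply: filterS fB => w fB wD; rewrite lee_fin.
    by rewrite (le_trans (fB wD))// ler_norm.
by rewrite integral_cst//= ltey_eq fin_numM//; exact: fin_num_measure.
Qed.

(** Under the bridge a path starts almost surely from [x] and has [n] jumps, so
    that the difference of the two sides is the mean in [limits_mean_zero]
    divided by the probability of the event. *)
Lemma duality :
  let Rxy := bridge P y in
  let rhs := fun w => path_fun w * intX (fun t z => deriv01 u t + Xi l t z * u t) w in
  [/\ Rxy.-integrable setT (EFin \o DTheta u path_fun),
      Rxy.-integrable setT (EFin \o rhs) &
      ('E_Rxy[DTheta u path_fun] = 'E_Rxy[rhs])%E].
Proof.
move=> Rxy rhs.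
have -> : DTheta u path_fun = (fun w => lim_shift (X 0 w) (jumps w)).
  by apply/funext => w; exact: DTheta_lim.
have -> : rhs = (fun w => lim_dens (X 0 w) (jumps w)).
  by apply/funext => w; exact: rhs_lim.
pose f w := lim_shift (X 0 w) (jumps w); pose g w := lim_dens (X 0 w) (jumps w).
have mD := @measurable_final_at R y.
have fi : P.-integrable (final_at R y) (EFin \o f).
  have [B HB] := lim_shift_bound x.
  apply: (integrable_ae_bounded (B := B) measurable_lim_shift).
  by apply: filterS X0P => w X0 _; rewrite /f X0; exact: HB.
have gi : P.-integrable (final_at R y) (EFin \o g).
  have [B HB] := lim_dens_bound x n.
  apply: (integrable_ae_bounded (B := B) measurable_lim_dens).
  apply: filterS X0P => w X0 wD; rewrite /g X0; apply: HB; last exact: jumps_oo.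
  by apply/eqP; rewrite -final_atE// inE.
have [fi' fE] := integral_conditioned mD final_at_gt0 measurable_lim_shift fi.
have [gi' gE] := integral_conditioned mD final_at_gt0 measurable_lim_dens gi.
split=> //; rewrite unlock [LHS]fE [RHS]gE; congr (_ * _)%E.
have E h : P.-integrable (final_at R y) (EFin \o h) ->
    (\int[P]_(w in final_at R y) (h w)%:E = (\int[P]_(w in final_at R y) h w)%R%:E)%E.
  by move=> hi; rewrite /Rintegral fineK//; exact: integrable_fin_num.
rewrite (E _ fi) (E _ gi); congr EFin; apply/eqP; rewrite -subr_eq0 -RintegralB//.
have [i0 z0] := limits_mean_zero.
rewrite -z0 Rintegral_mkcond; apply/eqP; congr fine.
have mfg : measurable_fun setT (fun w => f w - g w).
  by apply: measurable_funB; [exact: measurable_lim_shift|exact: measurable_lim_dens].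
apply: ae_eq_integral => //.
- apply/measurable_EFinP; apply/(measurable_restrictT _ mD); exact: measurable_funTS.
- exact: measurable_int i0.
- apply: filterS X0P => w X0 _ /=; congr EFin.
  by rewrite /patch final_atE// /f /g X0.
Qed.

End Bridge.
End Duality.

Unset Implicit Arguments.

Theorem lemma2p18 (R : realType) (l : R -> int -> R) (x y : int)
    (Rx : probability (Omega R) R) :
  NMC l -> x <= y -> counting_law l x Rx ->
  forall (Phi : Omega R -> R) (u : R -> R),
    simple_functional Phi -> perturbation u ->
    let Rxy := bridge Rx y in
    let rhs := fun w => Phi w *
      intX (fun t z => deriv01 u t + Xi l t z * u t) w in
    [/\ Rxy.-integrable setT (EFin \o DTheta u Phi),
        Rxy.-integrable setT (EFin \o rhs) &
        ('E_Rxy[DTheta u Phi] = 'E_Rxy[rhs])%E].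
Proof.
move=> Hl xy [X0P MP] Phi u [m [phi [_ Cphi Phi_phi]]] Hu.
have -> : Phi = path_fun phi.
  apply/funext => w; rewrite Phi_phi /path_fun /jump_fun; congr phi.
  apply/rowP => i; rewrite !mxE clamp_id//.
  have [iq|qi] := ltnP i (size (jumps w)); last by rewrite /jumpT nth_default// in01_1.
  by have /andP[? ?] := allP (jumps_oo w) _ (mem_nth 1 iq); rewrite !ltW.
exact: (@duality R m phi (fun z => Cphi z 1%N) u l Hu Hl x y Rx xy X0P MP).
Qed.
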